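(* Assume that $p\in(1,\infty]$, $q\in[1,\infty]$, $(p=\infty\Rightarrow q=\infty)$ and $r_{0}\in(n,\infty]$. Let $f\in L^{p,q}(\mathbb{R}^{n})\cap L^{r_{0},\infty}(\mathbb{R}^{n})$ (with values in $\mathbb{R}^n$), and let $T\in(0,\infty]$ be the maximal time for which there exists $u\in\mathcal{J}_{p,q}^{0}(T_{-})\cap\mathcal{J}_{\overline{\infty},\infty}^{-n/r_{0}}(T_{-})$ (with values in $\mathbb{R}^n$) satisfying $u(t,x)= S[f](t,x) - B[u,u](t,x)$ for all $(t,x)\in(0,T)\times\mathbb{R}^n$. If $T<\infty$, then the unique solution $u\in\mathcal{J}_{p,q}^{0}(T_{-})\cap\mathcal{J}_{\overline{\infty},\infty}^{-n/r_{0}}(T_{-})$ satisfies $$\|u(t_{0})\|_{L^{r,\infty}(\mathbb{R}^{n})}^{*} \geq \frac{1}{4\eta_{n,r}(T-t_{0})^{\frac{1}{2}\left(1-\frac{n}{r}\right)}} \quad \text{for all }r\in(n,\infty]\text{ and }t_{0}\in(0,T),$$ where $\|u(t_{0})\|_{L^{r,\infty}(\mathbb{R}^{n})}^{*}=\infty$ by convention if $u(t_{0})\notin L^{r,\infty}(\mathbb{R}^{n})$. Moreover, the same inequality remains true with $L^{r,\infty}$ replaced by $L^{r,\tilde q}$ for any $\tilde q\in[1,\infty]$ (with $\tilde q=\infty$ if $r=\infty$).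
   Context: $n\ge1$ is the integer space dimension; $|A|$ is the Lebesgue measure of a set $A$; $|\cdot|$ is also the Euclidean norm of vectors and tensors; $r'$ is the Hölder conjugate of $r$; $\frac1\infty=0$. The summation convention over repeated indices is used. Lorentz spaces. For a measurable (scalar-, vector- or tensor-valued) function $f$ on $\mathbb{R}^{n}$ let $\lambda_f(y)=|\{x:|f(x)|>y\}|$ for $y>0$ and $f^*(t)=\sup\{y\in(0,\infty):\lambda_f(y)>t\}$ for $t>0$ ($\sup\emptyset=0$). Put $\|f\|^*_{L^{p,q}}=\left(\frac qp\int_0^\infty[t^{1/p}f^*(t)]^q\frac{dt}{t}\right)^{1/q}$ for $p,q\in[1,\infty)$, and $\|f\|^*_{L^{p,\infty}}=\sup_{t>0}t^{1/p}f^*(t)$ for $p\in[1,\infty]$. The additional symbol $\overline\infty$ refers to the true supremum: $\|f\|^*_{L^{\overline\infty,\infty}}=\|f\|_{L^{\overline\infty}}=\sup_x|f(x)|$. $L^{p,q}(\mathbb{R}^n)$ is the set of measurable $f$ with $\|f\|^*_{L^{p,q}}<\infty$, modulo equality a.e. if $p\in[1,\infty]$, and modulo equality everywhere if $p=\overline\infty$. Path spaces. For $T\in(0,\infty]$ and $\sigma\in\mathbb{R}$, $\mathcal{J}^\sigma_{p,q}(T)$ is the space of measurable functions $u$ on $(0,T)\times\mathbb{R}^n$ with $\sup_{t\in(0,T)}t^{-\sigma/2}\|u(t)\|^*_{L^{p,q}(\mathbb{R}^n)}<\infty$, functions being identified when $u(t)=v(t)$ in $L^{p,q}$ for all $t\in(0,T)$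 (a.e. equality in $x$ if $p\le\infty$, everywhere if $p=\overline\infty$). $\mathcal{J}^\sigma_{p,q}(T_-)=\bigcap_{T'\in(0,T)}\mathcal{J}^\sigma_{p,q}(T')$. In an intersection of path spaces the finer identification is used. Operators. $\Phi(t,x)=(4\pi t)^{-n/2}e^{-|x|^2/4t}$ is the heat kernel and $\mathcal{T}_{ij}(t,x)=(2\pi)^{-n}\int_{\mathbb{R}^n}e^{\mathrm{i}x\cdot\xi-t|\xi|^2}\left(\delta_{ij}-\frac{\xi_i\xi_j}{|\xi|^2}\right)d\xi$ is the Oseen kernel, for $(t,x)\in(0,\infty)\times\mathbb{R}^n$. Whenever the integrals are defined, $S_i[f](t,x)=\int_{\mathbb{R}^n}\Phi(t,x-y)f_i(y)\,dy$ and $B_i[u,v](t,x)=\int_0^t\int_{\mathbb{R}^n}\nabla_k\mathcal{T}_{ij}(t-s,x-y)u_j(s,y)v_k(s,y)\,dy\,ds$. The constant $\eta_{n,r}$. Fix positive constants $\alpha_n,\gamma_n$ depending only on $n$ such that $\|\Phi(t)\|^*_{L^{r',1}(\mathbb{R}^n)}\le\alpha_nt^{-\frac{n}{2r}}$ for all $t>0$ and $r\in(n,\infty]$, and $\|\nabla\mathcal{T}(t)\|_{L^1(\mathbb{R}^n)}\le\gamma_nt^{-\frac12}$ for all $t>0$. Put $\beta_{n/r}=\int_0^1(1-s)^{-\frac12}s^{-\frac nr}\,ds$, and $\eta_{n,r}=r'\alpha_n\beta_{n/r}\gamma_n$ for $r\in(n,\infty]$. *)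

(* Defs.v *)
From HB Require Import structures.
From mathcomp Require Import all_boot all_order all_algebra.
From mathcomp Require Import all_classical all_reals all_analysis.

Set Implicit Arguments.
Unset Strict Implicit.
Unset Printing Implicit Defensive.

Import Order.TTheory GRing.Theory Num.Theory.
Import numFieldNormedType.Exports.

Local Open Scope classical_set_scope.
Local Open Scope ring_scope.

Fact rV_display : measure_display.
Proof. exact: default_measure_display. Qed.

Section measurable_rV.
Context {R : realType} (n : nat).

Let coord (i : 'I_n) (x : 'rV[R]_n) : measurableTypeR R := x 0 i.

Let rV_set0 : g_sigma_preimage coord set0.
Proof. exact: sigma_algebra0. Qed.

Let rV_setC A : g_sigma_preimage coord A -> g_sigma_preimage coord (~` A).
Proof. exact: sigma_algebraC. Qed.

Let rV_bigcup (F : _^nat) : (forall i, g_sigma_preimage coord (F i)) ->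
  g_sigma_preimage coord (\bigcup_i (F i)).
Proof. exact: sigma_algebra_bigcup. Qed.

(* generated by the coordinates, as for [n.-tuple] in the library *)
HB.instance Definition _ :=
  @isMeasurable.Build rV_display 'rV[R]_n (g_sigma_preimage coord)
    rV_set0 rV_setC rV_bigcup.

Lemma measurable_coord (i : 'I_n) :
  measurable_fun [set: 'rV[R]_n] (coord i).
Proof.
move=> _ Y mY; rewrite setTI; apply: sub_sigma_algebra => /=.
rewrite -bigcup_seq/=; exists i => /=; first by rewrite mem_index_enum.
by exists Y => //; rewrite setTI.
Qed.

Lemma measurable_fun_rVP d (T : measurableType d) (f : T -> 'rV[R]_n) :
  measurable_fun [set: T] f <->
  forall i, measurable_fun [set: T] (coord i \o f).
Proof.
split=> [mf i|mf]; first exact: measurableT_comp (measurable_coord i) mf.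
apply: (@measurability _ _ _ _ _ _
  (\big[setU/set0]_(i < n) preimage_set_system setT (coord i) measurable)) => //.
move=> _ [B + <-]; rewrite -bigcup_seq => -[i _ [A mA <-]].
rewrite setTI; have := mf i measurableT A mA.
by rewrite comp_preimage !setTI.
Qed.

End measurable_rV.

Section lebesgue_rV.
Context {R : realType}.
Local Notation mR := (measurableTypeR R).

Definition cons_rV n (z : mR * 'rV[R]_n) : 'rV[R]_n.+1 :=
  row_mx (z.1%:M : 'rV[R]_1) z.2.

Definition uncons_rV n (x : 'rV[R]_n.+1) : mR * 'rV[R]_n :=
  (x 0 0, rsubmx (x : 'rV[R]_(1 + n))).

Lemma cons_rV0 n (z : mR * 'rV[R]_n) : cons_rV z 0 ord0 = z.1.
Proof.
pose z1 : 'rV[R]_1 := z.1%:M.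
transitivity (row_mx z1 z.2 0 (lshift n ord0)).
  by congr (row_mx _ _ _ _); exact: val_inj.
by rewrite row_mxEl mxE eqxx mulr1n.
Qed.

Lemma cons_rVS n (z : mR * 'rV[R]_n) (j : 'I_n) :
  cons_rV z 0 (lift ord0 j) = z.2 0 j.
Proof.
pose z1 : 'rV[R]_1 := z.1%:M.
transitivity (row_mx z1 z.2 0 (rshift 1 j)); last by rewrite row_mxEr.
by congr (row_mx _ _ _ _); exact: val_inj.
Qed.

Lemma cons_rVK n : cancel (@cons_rV n) (@uncons_rV n).
Proof.
move=> [a x]; rewrite /uncons_rV; congr (_, _); first exact: cons_rV0.
exact: row_mxKr.
Qed.

Lemma uncons_rVK n : cancel (@uncons_rV n) (@cons_rV n).
Proof.
move=> x; apply/rowP => i; case: (unliftP ord0 i) => [j|] ->.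
  by rewrite cons_rVS mxE; congr (x _ _); exact: val_inj.
by rewrite cons_rV0.
Qed.

Lemma measurable_cons_rV n : measurable_fun [set: mR * 'rV[R]_n] (@cons_rV n).
Proof.
apply/measurable_fun_rVP => i; case: (unliftP ord0 i) => [j|] ->.
  rewrite (_ : _ \o _ = (fun x : 'rV[R]_n => x 0 j : mR) \o snd).
    exact: measurableT_comp (measurable_coord j) measurable_snd.
  by apply/funext => z; exact: cons_rVS.
rewrite (_ : _ \o _ = fst); first exact: measurable_fst.
by apply/funext => z; exact: cons_rV0.
Qed.

Lemma measurable_uncons_rV n : measurable_fun [set: 'rV[R]_n.+1] (@uncons_rV n).
Proof.
apply/measurable_fun_pairP; split; first exact: measurable_coord.
apply/measurable_fun_rVP => j.
rewrite (_ : _ \o _ = (fun x : 'rV[R]_n.+1 => x 0 (rshift 1 j : 'I_n.+1) : mR)).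
  exact: measurable_coord.
by apply/funext => x; rewrite /= mxE.
Qed.

Section step.
Variables (n : nat) (mu : {sigma_finite_measure set 'rV[R]_n -> \bar R}).

Definition lebesgue_rV_step : set 'rV[R]_n.+1 -> \bar R :=
  pushforward (@lebesgue_measure R \x mu)%E (@cons_rV n).

Let step0 : lebesgue_rV_step set0 = 0%E.
Proof. by rewrite /lebesgue_rV_step /pushforward preimage_set0 measure0. Qed.

Let step_ge0 A : (0 <= lebesgue_rV_step A)%E.
Proof. by rewrite /lebesgue_rV_step /pushforward; apply: measure_ge0. Qed.

Let mpre A : measurable A -> measurable (@cons_rV n @^-1` A).
Proof.
move=> mA; rewrite -[X in measurable X]setTI.
exact: measurable_cons_rV.
Qed.

Let step_sigma_additive : semi_sigma_additive lebesgue_rV_step.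
Proof.
move=> F mF tF mUF; rewrite /lebesgue_rV_step /pushforward preimage_bigcup.
apply: measure_semi_sigma_additive.
- by move=> k; exact: mpre.
- apply/trivIsetP => /= i j _ _ ij; rewrite -preimage_setI.
  by move/trivIsetP : tF => /(_ _ _ _ _ ij) ->//; rewrite preimage_set0.
- by rewrite -preimage_bigcup; exact: mpre.
Qed.

HB.instance Definition _ := isMeasure.Build _ _ _ lebesgue_rV_step
  step0 step_ge0 step_sigma_additive.

Let step_sigma_finite : sigma_finite setT lebesgue_rV_step.
Proof.
have /sigma_finiteP[F [UF ndF mF]] := sigma_finiteT (@lebesgue_measure R).
have /sigma_finiteP[G [UG ndG mG]] := sigma_finiteT mu.
exists (fun k => @uncons_rV n @^-1` (F k `*` G k)).
  apply/esym; rewrite -subTset => x _.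
  have [i _ Fi] : (\bigcup_i F i) (uncons_rV x).1 by rewrite -UF.
  have [j _ Gj] : (\bigcup_i G i) (uncons_rV x).2 by rewrite -UG.
  exists (maxn i j) => //; split.
  - exact: (subsetPset _ _ (ndF _ _ (leq_maxl i j))).
  - exact: (subsetPset _ _ (ndG _ _ (leq_maxr i j))).
move=> k; have [mFk Fk] := mF k; have [mGk Gk] := mG k; split.
  rewrite -[X in measurable X]setTI.
  by apply: measurable_uncons_rV => //; exact: measurableX.
rewrite /lebesgue_rV_step /pushforward -comp_preimage.
rewrite (_ : _ \o _ = id); last by apply/funext => z; exact: cons_rVK.
by rewrite preimage_id product_measure1E// lte_mul_pinfty// ge0_fin_numE.
Qed.

HB.instance Definition _ := Measure_isSigmaFinite.Build _ _ _ lebesgue_rV_step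
  step_sigma_finite.

End step.

(* Fubini recursion: the measure on R^(n+1) is the product of the Lebesgue
   measures on R and on R^n, transported along [cons_rV] *)
Fixpoint lebesgue_rV n : {sigma_finite_measure set 'rV[R]_n -> \bar R} :=
  match n with
  | 0 => (\d_(0 : 'rV[R]_0))%R
  | m.+1 => lebesgue_rV_step (lebesgue_rV m)
  end.

Lemma lebesgue_rV_prod n (A : 'I_n -> set R) :
  (forall i, measurable (A i : set mR)) ->
  lebesgue_rV n [set x | forall i, A i (x 0 i)] =
  (\prod_(i < n) lebesgue_measure (A i))%E.
Proof.
elim: n A => [A _|n IH A mA].
  by rewrite big_ord0 /= diracE mem_set// => -[].
rewrite big_ord_recl -IH; last by move=> i; exact: mA.
have mB : measurable [set x : 'rV[R]_n | forall i, A (lift ord0 i) (x 0 i)].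
  rewrite (_ : mkset _ = \bigcap_(i in [set: 'I_n])
      ((fun x : 'rV[R]_n => x 0 i : mR) @^-1` A (lift ord0 i))); last first.
    by apply/seteqP; split => x /= xA i; have := xA i; exact.
  apply: fin_bigcap_measurable => [|i _]; first exact: finite_finset.
  rewrite -[X in measurable X]setTI.
  by apply: measurable_coord => //; exact: mA.
rewrite -(@product_measure1E _ _ _ _ _ (@lebesgue_measure R) (lebesgue_rV n))//.
congr ((_ \x _)%E _).
apply/seteqP; split => z /=.
  move=> zA; split; first by have := zA ord0; rewrite cons_rV0.
  by move=> i; have := zA (lift ord0 i); rewrite cons_rVS.
move=> [z0 zA] i; case: (unliftP ord0 i) => [j|] ->; rewrite ?cons_rV0//.
by rewrite cons_rVS.
Qed.

End lebesgue_rV.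

Section lorentz.
Context {R : realType} (n : nat).
Implicit Types (g : 'rV[R]_n -> R) (f : 'rV[R]_n -> 'rV[R]_n) (p q : \bar R).

(* the library's [`|x|] on row vectors is the sup norm *)
Definition enorm (x : 'rV[R]_n) : R := Num.sqrt (\sum_(i < n) x 0 i ^+ 2).

(* 1/p as a real number, with 1/oo = 0 *)
Definition rinv p : R := fine (p^-1)%E.

Local Open Scope ereal_scope.

Definition distr_fun g (y : R) : \bar R := lebesgue_rV n [set x | (y < `|g x|)%R].

(* the point 0 is added so that the supremum of the empty set is 0 *)
Definition rearr g (t : R) : \bar R :=
  ereal_sup (0 |` [set y%:E | y in [set y : R | (0 < y)%R /\ t%:E < distr_fun g y]]).

(* only used for p, q in [1, oo) and for p in [1, oo], q = oo; the value +oo on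
   the remaining pairs is a dummy one *)
Definition lorentz_norm p q g : \bar R :=
  match p, q with
  | p'%:E, q'%:E =>
      ((q' / p')%:E *
       \int[lebesgue_measure]_(t in `]0%R, +oo[)
         (((t `^ p'^-1)%:E * rearr g t) `^ q' * t^-1%:E)) `^ q'^-1
  | _, +oo => ereal_sup [set (t `^ rinv p)%:E * rearr g t | t in `]0%R, +oo[]
  | _, _ => +oo
  end.

Definition sup_norm g : \bar R := ereal_sup [set `|g x|%:E | x in setT].

(* Elements of L^{p,q} are represented by functions, not by classes, and
   "measurable" means Borel measurable: every class modulo a.e. equality of
   Lebesgue measurable functions has a Borel representative. *)
Definition lorentz_space p q : set ('rV[R]_n -> 'rV[R]_n) :=
  [set f | measurable_fun setT f /\ lorentz_norm p q (enorm \o f) < +oo].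

(* [path_space (lorentz_norm p q) sigma T] is J^sigma_{p,q}(T), and
   [path_space sup_norm sigma T] is J^sigma_{\overline oo,oo}(T); [_minus] is the
   version on T_-.  Slices [u t] are Borel because [u] is jointly Borel. *)
Definition path_space (N : ('rV[R]_n -> R) -> \bar R) (sigma : R) (T : \bar R) :
    set (R -> 'rV[R]_n -> 'rV[R]_n) :=
  [set u | measurable_fun
             [set z : measurableTypeR R * 'rV[R]_n | (0 < z.1)%R /\ z.1%:E < T]
             (fun z => u z.1 z.2) /\
           ereal_sup [set (t `^ (- sigma / 2))%:E * N (enorm \o u t)
                     | t in [set t : R | (0 < t)%R /\ t%:E < T]] < +oo].

Definition path_space_minus N sigma (T : \bar R) :
    set (R -> 'rV[R]_n -> 'rV[R]_n) :=
  [set u | forall T' : R, (0 < T')%R -> T'%:E < T -> path_space N sigma T'%:E u].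

End lorentz.

Section operators.
Context {R : realType} (n : nat).
Implicit Types (t : R) (x : 'rV[R]_n) (i j k : 'I_n).
Implicit Types (f : 'rV[R]_n -> 'rV[R]_n) (u v : R -> 'rV[R]_n -> 'rV[R]_n).

Local Notation mu := (@lebesgue_rV R n).

Definition heat_kernel t x : R :=
  (4 * pi * t) `^ (- (n%:R / 2)) * expR (- (enorm x ^+ 2 / (4 * t))).

(* The Fourier integral is real: its imaginary part, in which [cos] becomes
   [sin], has an odd integrand. *)
Definition oseen_kernel i j t x : R :=
  (2 * pi) ^- n *
  \int[mu]_xi (cos (\sum_(l < n) x 0 l * xi 0 l) * expR (- (t * enorm xi ^+ 2)) *
               ((i == j)%:R - xi 0 i * xi 0 j / enorm xi ^+ 2)).

Definition grad_oseen k i j t x : R :=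
  'D_(delta_mx 0 k) (oseen_kernel i j t) x.

Definition grad_oseen_norm t x : R :=
  Num.sqrt (\sum_(k < n) \sum_(i < n) \sum_(j < n) grad_oseen k i j t x ^+ 2).

(* The real-valued integral is a total operation; in [S_op] and [B_op] all
   integrals converge absolutely for f and u in the spaces of
   [mild_solution] below (p > 1, r0 > n). *)
Definition S_op f t x : 'rV[R]_n :=
  \row_i \int[mu]_y (heat_kernel t (x - y) * f y 0 i).

Definition B_op u v t x : 'rV[R]_n :=
  \row_i \int[lebesgue_measure]_(s in `]0, t[)
    \int[mu]_y (\sum_(j < n) \sum_(k < n)
      grad_oseen k i j (t - s) (x - y) * u s y 0 j * v s y 0 k).

Local Open Scope ereal_scope.

Definition mild_solution (p q r0 : \bar R) f (T : \bar R) u : Prop :=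
  [/\ path_space_minus (lorentz_norm p q) 0 T u,
      path_space_minus (@sup_norm R n) (- (n%:R * rinv r0)) T u &
      forall t x, (0 < t)%R -> t%:E < T ->
        u t x = (S_op f t x - B_op u u t x)%R].

Definition is_maximal_time (p q r0 : \bar R) f (T : \bar R) : Prop :=
  [/\ 0 < T, exists u, mild_solution p q r0 f T u &
      forall T', 0 < T' -> (exists u, mild_solution p q r0 f T' u) -> T' <= T].

Definition beta_const (a : R) : R :=
  (\int[lebesgue_measure]_(s in `]0, 1[) ((1 - s) `^ (- 2^-1) * s `^ (- a)))%R.

Definition eta_const (alpha gamma : R) (r : \bar R) : R :=
  (fine (hoelder_conjugate r) * alpha * beta_const (n%:R * rinv r) * gamma)%R.

End operators.

Arguments eta_const {R} n alpha gamma r.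
Arguments enorm {R n} x.

(* Main.v *)
From HB Require Import structures.
Require Import Defs.
From mathcomp Require Import all_boot all_order all_algebra.
From mathcomp Require Import all_classical all_reals all_analysis.
From mathcomp Require Import measurable_realfun ring lra.

Set Implicit Arguments.
Unset Strict Implicit.
Unset Printing Implicit Defensive.

Import Order.TTheory GRing.Theory Num.Theory.
Import numFieldNormedType.Exports.

Local Open Scope classical_set_scope.
Local Open Scope ring_scope.
Local Open Scope ereal_scope.

(** Suppose that the norm M of u(t0) in the weak Lorentz space L^{r,oo} lies
    below the bound, and put a = n/r < 1.  By the Hardy-Littlewood inequality
    the heat flow of u(t0) is bounded by A t^(-a/2) with A = r' alpha M, and the
    bilinear operator maps pairs of fields bounded by C t^(-a/2) to a field
    bounded by kap C^2 t^(-a/2) on (0, tau), where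
    kap = gamma beta_a tau^((1-a)/2).  Picard's iteration thus converges on
    (0, tau) as soon as 4 A kap < 1 ([picard]).  That M is below the bound says
    precisely that this holds for tau = T - t0, hence, by continuity, for some
    tau > T - t0.  Following u up to t0 and the new solution afterwards gives a
    solution on (0, t0 + tau), which contradicts the maximality of T
    ([extension]).  No information on an overlap is needed: the two pieces are
    glued at a single time.  The bound for L^{r,q'} follows because the weak
    norm is the smallest one in the Lorentz scale ([lorentz_weak_le]).

    Three things have to be justified.

    The glued field solves the integral equation ([restart]).  This rests on the
    identities by which the heat kernel at time s carries the heat kernel and
    the gradient of the Oseen kernel at time t to those at time t + s.  The
    gradient of the Oseen kernel is a Fourier integral ([grad_oseenE]), and
    convolution with the heat kernel multiplies the integrand by a Gaussian
    ([conv_fourier]), because of the Fourier transform of the Gaussian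
    ([gauss_fourier], [heat_fourier]).

    The glued field lies in both path spaces, i.e. the solution issued from
    u(t0) keeps its norms in L^{p,q} and in the supremum norm.  For a
    translation-invariant norm N with a Minkowski inequality for integrals and
    the Fatou property ([good_norm]), space convolutions cost only L^1 norms of
    kernels ([Et_norm]), and N is propagated along the iteration by means of a
    weight exp(lam t) with lam large ([picard_norm]).  The Lorentz functional is
    not a norm, so it is replaced by a dual norm (for p = +oo, by the supremum
    norm, which u(t0) has finite): the supremum of the pairings
    with all h for which the pairing with every G is controlled by the Lorentz
    functional of G ([Hset], [lorN]).  That the dual norm is bounded when the
    functional is finite is immediate; conversely the functional is recovered by
    testing against a superposition of indicators of superlevel sets of g
    ([truncY_pos_le]), which is admissible by Hardy's inequality
    ([hardy_inequality]), and for q = +oo against one such indicator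
    ([lorN_weak]).

    Finally, uniqueness on (0, T): in the weight t^(-a/2) exp(lam t), with
    a = n/r0 and lam large, the difference of two solutions is at most half of
    itself ([mild_unique]). *)

(** * Transport and affine changes of variable *)

Section transport.
Context d1 d2 (X : measurableType d1) (Y : measurableType d2) {R : realType}.

(** The image measure, with its structure of measure made explicit: equality of
    measures on measurable sets can then be transported under the integral. *)
Definition push_measure (mu : {measure set X -> \bar R}) (phi : X -> Y)
    (mphi : measurable_fun setT phi) : {measure set Y -> \bar R} :=
  measure_function_pushforward__canonical__measure_function_Measure mu mphi.

Lemma ge0_integral_transport (mu : {measure set X -> \bar R})
    (nu : {measure set Y -> \bar R}) (phi : X -> Y) (f : Y -> \bar R) :
  measurable_fun setT phi ->
  (forall A, measurable A -> nu A = mu (phi @^-1` A)) ->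
  measurable_fun setT f -> (forall y, 0 <= f y) ->
  \int[nu]_y f y = \int[mu]_x f (phi x).
Proof.
move=> mphi numu mf f0.
transitivity (\int[push_measure mu mphi]_y f y).
  by apply: eq_measure_integral => A mA _; exact: numu.
by rewrite (ge0_integral_pushforward mphi mu measurableT mf).
Qed.

End transport.

Section affine.
Context {R : realType}.
Local Notation mR := (measurableTypeR R).
Local Notation leb := (@lebesgue_measure R).

Lemma measurable_affine (c b : R) :
  measurable_fun setT (fun x : mR => (c * x + b)%R : mR).
Proof. by apply: measurable_funD => //; exact: measurable_funM. Qed.

Lemma lebesgue_measure_affine (c : {nonneg R}) (b : R) (A : set mR) :
  (0 < c%:num)%R -> measurable A ->
  leb A = c%:num%:E * leb ((fun x : mR => (c%:num * x + b)%R : mR) @^-1` A).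
Proof.
move=> c0 mA.
apply: (@lebesgue_measure_unique R (push_measure (mscale c leb) (@measurable_affine c%:num b))) => // _ [[u v]] _ <-.
rewrite /push_measure/= /pushforward /mscale /=.
rewrite (_ : _ @^-1` _ = [set` `]((u - b) / c%:num)%R, ((v - b) / c%:num)%R]]); last first.
  by apply/seteqP; split => x /=; rewrite !in_itv/= ltr_pdivrMr// ler_pdivlMr// ltrBlDr lerBrDr (mulrC x).
rewrite !lebesgue_measure_itv/= !lte_fin ltr_pM2r ?invr_gt0// ltrD2r.
case: ifPn => uv; last by rewrite mule0.
by rewrite -!EFinB -EFinM; congr EFin; field; exact: lt0r_neq0.
Qed.

(** Extends [lebesgue_measure_affine] from sets to integrands by transport
    along [x |-> c * x + b]. *)
Lemma ge0_integral_affine (c b : R) (f : R -> \bar R) : (0 < c)%R ->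
  measurable_fun setT (f : mR -> _) -> (forall x, 0 <= f x) ->
  \int[leb]_x f x = c%:E * \int[leb]_x f (c * x + b)%R.
Proof.
move=> c0 mf f0.
pose c' : {nonneg R} := NngNum (ltW c0).
rewrite (@ge0_integral_transport _ _ _ _ _ (mscale c' leb) _ _ _ (measurable_affine c b)) //.
  rewrite ge0_integral_mscale//=.
  by apply: (measurableT_comp mf); exact: measurable_affine.
by move=> A mA; exact: (@lebesgue_measure_affine c' b A c0 mA).
Qed.

Lemma ge0_integral_reflect (a : R) (f : R -> \bar R) :
  measurable_fun setT (f : mR -> _) -> (forall x, 0 <= f x) ->
  \int[leb]_x f (a - x)%R = \int[leb]_x f x.
Proof.
move=> mf f0.
have mN : measurable_fun setT (-%R : mR -> mR) by exact: oppr_measurable.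
rewrite (@ge0_integral_affine 1%R a f)// mul1e.
rewrite (@ge0_integral_transport _ _ _ _ _ leb _ _ _ mN) //.
- by apply: eq_integral => x _; rewrite mul1r opprK addrC.
- by move=> A mA; exact/esym/lebesgue_measureN.
- by apply: (measurableT_comp mf); exact: measurable_funB.
Qed.

End affine.

(** * Integration over row vectors *)

Section rV_integral.
Context {R : realType}.
Local Notation mR := (measurableTypeR R).
Local Notation leb := (@lebesgue_measure R).

Lemma measurable_coordT n (i : 'I_n) :
  measurable_fun setT (fun x : 'rV[R]_n => x 0%R i).
Proof. exact: measurable_coord. Qed.

Lemma measurable_fun_coord d (T : measurableType d) n (f : T -> 'rV[R]_n) (i : 'I_n) :
  measurable_fun setT f -> measurable_fun setT (fun z => f z 0%R i).
Proof. by move=> mf; exact: (measurableT_comp (measurable_coordT i) mf). Qed.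

Lemma measurable_fun_rV d (T : measurableType d) n (f : T -> 'rV[R]_n) :
  (forall i, measurable_fun setT (fun z => f z 0%R i)) -> measurable_fun setT f.
Proof. by move=> mf; apply/measurable_fun_rVP => i; exact: mf. Qed.

Lemma measurable_funB_rV d (T : measurableType d) n (f g : T -> 'rV[R]_n) :
  measurable_fun setT f -> measurable_fun setT g ->
  measurable_fun setT (fun z => f z - g z)%R.
Proof.
move=> mf mg; apply: measurable_fun_rV => i.
under eq_fun do rewrite !mxE.
by apply: measurable_funB; exact: measurable_fun_coord.
Qed.

Lemma measurable_fun_sqrt d (T : measurableType d) (f : T -> R) :
  measurable_fun setT f -> measurable_fun setT (fun z => Num.sqrt (f z)).
Proof.
move=> mf; apply: (measurableT_comp _ mf).
by apply: continuous_measurable_fun => x; exact: sqrt_continuous.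
Qed.

Lemma measurable_enorm n : measurable_fun setT (@enorm R n).
Proof.
apply: measurable_fun_sqrt; apply: measurable_sum => i.
by apply: measurable_funX; exact: measurable_coordT.
Qed.

Lemma ge0_integral_cons n (f : 'rV[R]_n.+1 -> \bar R) :
  measurable_fun setT f -> (forall x, 0 <= f x) ->
  \int[lebesgue_rV n.+1]_x f x =
  \int[leb]_a \int[lebesgue_rV n]_x f (cons_rV (a, x)).
Proof.
move=> mf f0.
rewrite (@ge0_integral_transport _ _ _ _ _ (leb \x lebesgue_rV n)%E _ (@cons_rV R n)) //.
  rewrite fubini_tonelli1//.
  by apply: (measurableT_comp mf); exact: measurable_cons_rV.
exact: measurable_cons_rV.
Qed.

Lemma measurable_cons2 n (a : mR) :
  measurable_fun setT (fun x : 'rV[R]_n => cons_rV (a, x)).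
Proof.
by apply: (measurableT_comp (@measurable_cons_rV R n)); exact: pair1_measurable.
Qed.

Lemma sub_cons_rV n (a : 'rV[R]_n.+1) (b : mR) (x : 'rV[R]_n) :
  (a - cons_rV (b, x) = cons_rV ((uncons_rV a).1 - b, (uncons_rV a).2 - x)%R)%R.
Proof.
apply/rowP => i; rewrite [LHS]mxE [X in (_ + X)%R]mxE; case: (unliftP ord0 i) => [j|] ->.
  by rewrite !cons_rVS/= !mxE; congr (a _ _ - _)%R; exact: val_inj.
by rewrite !cons_rV0.
Qed.

(** By induction on the dimension: the measure on n + 1 coordinates is a product,
    so the first coordinate is reflected by the one-dimensional statement and
    the other ones by the induction hypothesis. *)
Lemma ge0_integral_reflect_rV n (a : 'rV[R]_n) (f : 'rV[R]_n -> \bar R) :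
  measurable_fun setT f -> (forall x, 0 <= f x) ->
  \int[lebesgue_rV n]_x f (a - x)%R = \int[lebesgue_rV n]_x f x.
Proof.
elim: n a f => [a f mf f0|n IH a f mf f0].
  by apply: eq_integral => x _; congr f; apply/rowP => -[].
have mfa : measurable_fun setT (fun x : 'rV[R]_n.+1 => f (a - x)%R).
  by apply: (measurableT_comp mf); exact: measurable_funB_rV.
rewrite !ge0_integral_cons//.
under eq_integral.
  move=> b _; under eq_integral do rewrite sub_cons_rV.
  rewrite (IH _ (fun x => f (cons_rV ((uncons_rV a).1 - b, x)%R)))//; last first.
    by apply: (measurableT_comp mf); exact: measurable_cons2.
  over.
rewrite (@ge0_integral_reflect _ _ (fun b => \int[lebesgue_rV n]_x f (cons_rV (b, x)))) //.
- apply: (@measurable_fun_fubini_tonelli_F _ _ _ _ _ _ (fun z => f (cons_rV z))) => //.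
  by apply: (measurableT_comp mf); exact: measurable_cons_rV.
- by move=> b; apply: integral_ge0.
Qed.

Lemma ge0_integral_shift_rV n (a : 'rV[R]_n) (f : 'rV[R]_n -> \bar R) :
  measurable_fun setT f -> (forall x, 0 <= f x) ->
  \int[lebesgue_rV n]_x f (x - a)%R = \int[lebesgue_rV n]_x f x.
Proof.
move=> mf f0.
rewrite -[LHS](@ge0_integral_reflect_rV _ 0%R)//; last first.
  by apply: (measurableT_comp mf); exact: measurable_funB_rV.
rewrite -[RHS](@ge0_integral_reflect_rV _ (- a)%R)//.
by apply: eq_integral => x _; congr f; rewrite sub0r addrC.
Qed.

End rV_integral.

(** * Real-valued integrals and Euclidean norms *)

Section Rintegral_extra.
Context d (T : measurableType d) {R : realType}.
Variable mu : {measure set T -> \bar R}.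

Lemma integrable_dominated (f : T -> R) (g : T -> \bar R) :
  measurable_fun setT f -> measurable_fun setT g ->
  (forall x, `|f x|%:E <= g x) -> \int[mu]_x g x < +oo ->
  mu.-integrable setT (EFin \o f).
Proof.
move=> mf mg fg goo; apply/integrableP; split; first exact/measurable_EFinP.
apply: le_lt_trans goo; apply: ge0_le_integral => //; last by move=> x _; exact: fg.
by apply: measurableT_comp => //; exact/measurable_EFinP.
Qed.

Lemma EFin_Rintegral (f : T -> R) : mu.-integrable setT (EFin \o f) ->
  (\int[mu]_x f x)%R%:E = \int[mu]_x (f x)%:E.
Proof. by move=> fi; rewrite /Rintegral fineK//; exact: integrable_fin_num. Qed.

Lemma Rintegral_sum (I : Type) (s : seq I) (f : I -> T -> R) :
  (forall i, mu.-integrable setT (EFin \o f i)) ->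
  (\int[mu]_x (\sum_(i <- s) f i x) = \sum_(i <- s) \int[mu]_x f i x)%R.
Proof.
move=> fi; apply: EFin_inj; rewrite EFin_Rintegral.
  under eq_integral do rewrite -sumEFin.
  rewrite integral_sum// -sumEFin; apply: eq_bigr => i _.
  by rewrite EFin_Rintegral.
rewrite (_ : _ \o _ = fun x => (\sum_(i <- s) (EFin \o f i) x)%R).
  exact: integrable_sum.
by apply/funext => x /=; rewrite -sumEFin.
Qed.

Lemma integrable_Rsum (I : Type) (s : seq I) (f : I -> T -> R) :
  (forall i, mu.-integrable setT (EFin \o f i)) ->
  mu.-integrable setT (EFin \o (fun x => \sum_(i <- s) f i x)%R).
Proof.
move=> fi; rewrite (_ : _ \o _ = fun x => (\sum_(i <- s) (EFin \o f i) x)%R).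
  exact: integrable_sum.
by apply/funext => x /=; rewrite -sumEFin.
Qed.

Lemma integrable_RZl (k : R) (f : T -> R) :
  mu.-integrable setT (EFin \o f) ->
  mu.-integrable setT (EFin \o (fun x => k * f x)%R).
Proof. by move=> fi; exact: (@integrableZl _ _ _ mu setT measurableT k _ fi). Qed.

End Rintegral_extra.

Section Rfubini.
Context d1 d2 (T1 : measurableType d1) (T2 : measurableType d2) {R : realType}.
Variables (m1 : {sigma_finite_measure set T1 -> \bar R})
          (m2 : {sigma_finite_measure set T2 -> \bar R}).

(** The positive and the negative part of the inner integral are measurable by
    Tonelli's theorem, so no integrability is required: the real-valued integral
    is total. *)
Lemma measurable_fun_Rintegral (f : T1 * T2 -> R) : measurable_fun setT f ->
  measurable_fun setT (fun x => \int[m2]_y f (x, y))%R.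
Proof.
move=> mf; apply: (measurableT_comp (@fine_measurable R setT measurableT)).
under eq_fun do rewrite integralE.
have mfE : measurable_fun setT (EFin \o f) by exact/measurable_EFinP.
have mp := @measurable_fun_fubini_tonelli_F _ _ T1 T2 R m2 _
  (measurable_funepos mfE) (fun=> funepos_ge0 _ _).
have mn := @measurable_fun_fubini_tonelli_F _ _ T1 T2 R m2 _
  (measurable_funeneg mfE) (fun=> funeneg_ge0 _ _).
apply: eq_measurable_fun (emeasurable_funB mp mn) => x _. rewrite /fubini_F/=. congr (_ - _); by apply: eq_integral => y _; rewrite ?funeposE ?funenegE. 
Qed.

Lemma Rintegral_fine (d : measure_display) (T : measurableType d)
    (m : {measure set T -> \bar R}) (F : T -> \bar R) :
  m.-integrable setT F -> fine (\int[m]_x (fine (F x))%:E) = fine (\int[m]_x F x).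
Proof.
move=> iF; congr fine; apply: ae_eq_integral => //.
- apply/measurable_EFinP.
  by apply: measurableT_comp => //; exact: (measurable_int m).
- exact: (measurable_int m).
- have := integrable_ae measurableT iF; apply: filterS => x Fx _.
  by rewrite fineK// Fx.
Qed.

(** The inner integrals may be infinite on a null set, where the real-valued
    integral takes a default value; [Rintegral_fine] says that this does not
    affect the outer integral. *)
Lemma Rfubini (f : T1 * T2 -> R) : measurable_fun setT f ->
  \int[m1]_x \int[m2]_y `|f (x, y)|%:E < +oo ->
  (\int[m1]_x (\int[m2]_y f (x, y)) = \int[m2]_y (\int[m1]_x f (x, y)))%R.
Proof.
move=> mf foo.
have fi : (m1 \x m2)%E.-integrable setT (EFin \o f).
  by apply/integrable12ltyP => //; exact/measurable_EFinP.
have msf : measurable_fun setT (fun z : T2 * T1 => f (z.2, z.1)).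
  by apply: (measurableT_comp mf); exact: measurable_swap.
have gi : (m2 \x m1)%E.-integrable setT (EFin \o (fun z : T2 * T1 => f (z.2, z.1))).
  apply/integrable12ltyP => //; first exact/measurable_EFinP.
  rewrite -(@fubini_tonelli _ _ _ _ _ m1 m2 (fun z => `|f z|%:E))//.
  by apply/measurable_EFinP; exact: measurableT_comp.
rewrite /Rintegral (Rintegral_fine (integrable_fubini_F fi)).
rewrite (Rintegral_fine (integrable_fubini_F gi)).
by congr fine; exact: (Fubini fi).
Qed.

End Rfubini.

Section fnorm.
Context {R : realType}.

(** Vectors, matrices and third-order tensors are all families over a finite
    type; a single Euclidean norm serves them all. *)
Definition fnorm (I : finType) (a : I -> R) : R := Num.sqrt (\sum_i a i ^+ 2)%R.

Local Open Scope ring_scope.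

Lemma fnorm_sqr (I : finType) (a : I -> R) : fnorm a ^+ 2 = \sum_i a i ^+ 2.
Proof. by rewrite sqr_sqrtr// sumr_ge0// => i _; exact: sqr_ge0. Qed.

Lemma fnorm_ge0 (I : finType) (a : I -> R) : 0 <= fnorm a.
Proof. exact: sqrtr_ge0. Qed.

Lemma ler_fnorm (I : finType) (a : I -> R) i : `|a i| <= fnorm a.
Proof.
rewrite -(@ler_pXn2r _ 2)// ?nnegrE ?fnorm_ge0// fnorm_sqr.
by rewrite real_normK ?num_real// (bigD1 i)//= lerDl sumr_ge0// => j _; exact: sqr_ge0.
Qed.

Lemma fnorm_eq0 (I : finType) (a : I -> R) : fnorm a = 0 -> forall i, a i = 0.
Proof.
by move=> a0 i; apply/eqP; rewrite -normr_le0 -a0 ler_fnorm.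
Qed.

Lemma cauchy_schwarz (I : finType) (a b : I -> R) :
  \sum_i a i * b i <= fnorm a * fnorm b.
Proof.
have [a0|a0] := eqVneq (fnorm a) 0.
  by rewrite a0 mul0r big1// => i _; rewrite (fnorm_eq0 a0) mul0r.
have [b0|b0] := eqVneq (fnorm b) 0.
  by rewrite b0 mulr0 big1// => i _; rewrite (fnorm_eq0 b0) mulr0.
have A0 : 0 < fnorm a by rewrite lt_def a0 fnorm_ge0.
have B0 : 0 < fnorm b by rewrite lt_def b0 fnorm_ge0.
apply: (@le_trans _ _ (\sum_i (2^-1 * (fnorm b / fnorm a) * a i ^+ 2 +
                               2^-1 * (fnorm a / fnorm b) * b i ^+ 2))).
  apply: ler_sum => i _.
  have : 0 <= (fnorm b * a i - fnorm a * b i) ^+ 2 / (fnorm a * fnorm b).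
    by rewrite divr_ge0 ?sqr_ge0// mulr_ge0 ?fnorm_ge0.
  rewrite (_ : _ / _ = (fnorm b / fnorm a) * a i ^+ 2 +
                       (fnorm a / fnorm b) * b i ^+ 2 - 2 * (a i * b i)).
    lra.
  by field; rewrite a0 b0.
rewrite big_split/= -!mulr_sumr -!fnorm_sqr.
rewrite (_ : _ + _ = fnorm a * fnorm b)//.
by field; rewrite a0 b0.
Qed.

Lemma ler_fnormD (I : finType) (a b : I -> R) :
  fnorm (fun i => a i + b i) <= fnorm a + fnorm b.
Proof.
rewrite -(@ler_pXn2r _ 2)// ?nnegrE ?addr_ge0 ?fnorm_ge0//.
rewrite sqrrD !fnorm_sqr.
under eq_bigr do rewrite sqrrD.
rewrite !big_split/= lerD2r lerD2l.
by rewrite mulr2n lerD ?cauchy_schwarz.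
Qed.

Lemma fnormM (I J : finType) (a : I -> R) (b : J -> R) :
  fnorm (fun ij : I * J => a ij.1 * b ij.2) = fnorm a * fnorm b.
Proof.
rewrite /fnorm -sqrtrM ?sumr_ge0//; last by move=> i _; exact: sqr_ge0.
congr Num.sqrt; rewrite mulr_suml.
under [RHS]eq_bigr do rewrite mulr_sumr.
by rewrite pair_big/=; apply: eq_bigr => -[i j] _ /=; rewrite exprMn.
Qed.

Lemma fnormZ (I : finType) (c : R) (a : I -> R) :
  fnorm (fun i => c * a i) = `|c| * fnorm a.
Proof.
rewrite /fnorm -sqrtr_sqr -sqrtrM ?sqr_ge0//; congr Num.sqrt.
by rewrite mulr_sumr; apply: eq_bigr => i _; rewrite exprMn.
Qed.

Lemma fnorm_le_sum (I : finType) (a : I -> R) : fnorm a <= \sum_i `|a i|.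
Proof.
rewrite -(@ler_pXn2r _ 2)// ?nnegrE ?fnorm_ge0 ?sumr_ge0// fnorm_sqr.
rewrite expr2 mulr_suml; apply: ler_sum => i _.
rewrite -(real_normK (num_real (a i))) expr2 ler_wpM2l//.
by rewrite (bigD1 i)//= lerDl sumr_ge0.
Qed.

Lemma enormE n (x : 'rV[R]_n) : enorm x = fnorm (fun i => x 0 i).
Proof. by []. Qed.

Lemma enorm_ge0 n (x : 'rV[R]_n) : 0 <= enorm x.
Proof. exact: fnorm_ge0. Qed.

Lemma ler_enormD n (x y : 'rV[R]_n) : enorm (x + y) <= enorm x + enorm y.
Proof.
rewrite !enormE; apply: le_trans (ler_fnormD _ _); rewrite le_eqVlt; apply/orP; left.
by apply/eqP; congr fnorm; apply/funext => i; rewrite mxE.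
Qed.

Lemma enormN n (x : 'rV[R]_n) : enorm (- x) = enorm x.
Proof.
by rewrite /enorm; congr Num.sqrt; apply: eq_bigr => i _; rewrite mxE sqrrN.
Qed.

Lemma ler_enormB n (x y : 'rV[R]_n) : enorm (x - y) <= enorm x + enorm y.
Proof. by rewrite -(enormN y) ler_enormD. Qed.

Lemma enorm0 n : enorm (0 : 'rV[R]_n) = 0.
Proof.
by rewrite /enorm big1 ?sqrtr0// => i _; rewrite mxE expr0n.
Qed.

Lemma enorm_eq0 n (x : 'rV[R]_n) : enorm x = 0 -> x = 0.
Proof. by move=> /fnorm_eq0 x0; apply/rowP => i; rewrite x0 mxE. Qed.

End fnorm.

Section fnorm_integral.
Context d (T : measurableType d) {R : realType}.
Variable mu : {measure set T -> \bar R}.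

Lemma measurable_fnorm (I : finType) (F : I -> T -> R) :
  (forall i, measurable_fun setT (F i)) ->
  measurable_fun setT (fun x => fnorm (F ^~ x)).
Proof.
move=> mF; apply: measurable_fun_sqrt; apply: measurable_sum => i.
exact: measurable_funX.
Qed.

Lemma integrable_fnorm (I : finType) (F : I -> T -> R) :
  (forall i, mu.-integrable setT (EFin \o F i)) ->
  mu.-integrable setT (EFin \o (fun x => fnorm (F ^~ x))).
Proof.
move=> Fi.
apply: (@le_integrable _ _ _ _ _ measurableT _ (EFin \o (fun x => \sum_i `|F i x|)%R)).
- apply/measurable_EFinP; apply: measurable_fnorm => i.
  exact/measurable_EFinP/(measurable_int mu).
- move=> x _ /=; rewrite lee_fin ger0_norm ?fnorm_ge0// (le_trans (fnorm_le_sum _))//.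
  exact: ler_norm.
- by apply: integrable_Rsum => i; exact: integrable_norm.
Qed.

(** Minkowski's inequality for vector-valued integrals: pair the integral V with
    itself and apply Cauchy-Schwarz under the integral sign. *)
Lemma fnorm_Rintegral (I : finType) (F : I -> T -> R) :
  (forall i, mu.-integrable setT (EFin \o F i)) ->
  (fnorm (fun i => \int[mu]_x F i x) <= \int[mu]_x fnorm (F ^~ x))%R.
Proof.
move=> Fi; set V := fun i => (\int[mu]_x F i x)%R.
have [V0|V0] := eqVneq (fnorm V) 0%R.
  by rewrite V0; apply: Rintegral_ge0 => x _; exact: fnorm_ge0.
have Vp : (0 < fnorm V)%R by rewrite lt_def V0 fnorm_ge0.
rewrite -(ler_pM2l Vp) -expr2 fnorm_sqr.
under eq_bigr do rewrite expr2 {2}/V -RintegralZl//.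
rewrite -Rintegral_sum; last by move=> i; exact: integrable_RZl.
rewrite -RintegralZl//; last exact: integrable_fnorm.
apply: le_Rintegral => //.
- by apply: integrable_Rsum => i; exact: integrable_RZl.
- by apply: integrable_RZl; exact: integrable_fnorm.
- by move=> x _; exact: (cauchy_schwarz V (F ^~ x)).
Qed.

End fnorm_integral.

(** * The Fourier transform of the Gaussian *)

Section gauss_fourier.
Context {R : realType}.
Local Notation mR := (measurableTypeR R).
Local Notation leb := (@lebesgue_measure R).

(** The fundamental theorem of calculus on [-n, n], in the limit: it replaces
    the integration by parts on the whole line. *)
Lemma integral_derive_vanishing (f F : R -> R) :
  (forall x : R, is_derive x (1%R : R) F (f x)) -> continuous f ->
  leb.-integrable setT (EFin \o f) ->
  F n%:R%R @[n --> \oo] --> (0:R)%R -> F (- n%:R)%R @[n --> \oo] --> (0:R)%R ->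
  (\int[leb]_x f x = 0)%R.
Proof.
move=> dF cf intf F1 F2.
pose fn (n : nat) (x : R) : \bar R := (f \_ [set` `[(- n%:R)%R, (n%:R)%R]] x)%:E.
have mf : measurable_fun setT f by exact: continuous_measurable_fun.
have cvg1 : \int[leb]_x fn n x @[n --> \oo] --> \int[leb]_x (f x)%:E.
  apply: (@dominated_cvg _ _ _ leb setT measurableT fn (EFin \o f) (fun x => `|f x|%:E)) => //.
  - move=> n; apply/measurable_EFinP.
    by apply/(measurable_restrictT _ _).1 => //; exact: measurable_funTS.
  - move=> x _; apply: cvg_near_cst; near=> n.
    rewrite /fn/= patchE ifT// inE/= in_itv/= -ler_norml.
    by near: n; exact: nbhs_infty_ger.
  - exact: integrable_norm.
  - by move=> n x _; rewrite /fn/= patchE; case: ifPn => _; rewrite lee_fin// normr0.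
have cvg2 : \int[leb]_x fn n x @[n --> \oo] --> (0:R)%:E.
  apply: (@cvg_trans _ ((F n%:R - F (- n%:R))%:E @[n --> \oo])); last first.
    by apply: cvg_EFin; [exact: nearW|rewrite -[X in _ --> X]subr0; exact: cvgB].
  apply: near_eq_cvg; near=> n.
  have n0 : (- n%:R < n%:R :> R)%R.
    have : (0 < n%:R :> R)%R by rewrite ltr0n; near: n; exact: nbhs_infty_gt.
    by lra.
  have -> : \int[leb]_x fn n x = \int[leb]_(x in [set` `[(- n%:R)%R, (n%:R)%R]]) (f x)%:E.
    by rewrite [RHS]integral_mkcond restrict_EFin.
  have cF x : {for x, continuous F}.
    by apply: differentiable_continuous; apply/derivable1_diffP; have [] := dF x.
  rewrite (continuous_FTC2 n0 (continuous_subspaceT cf) (F := F))//.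
  - split=> [x _| |]; first by have [] := dF x.
    + exact: cvg_at_right_filter (cF _).
    + exact: cvg_at_left_filter (cF _).
  - by move=> x _; rewrite derive1E; have := dF x => -[_ ->].
have := cvg_unique _ cvg1 cvg2 => /(_ (@ereal_hausdorff _)) h.
by rewrite /Rintegral h.
Unshelve. all: end_near. Qed.

Definition gaussf (a y : R) : R := expR (- (a * y ^+ 2))%R.

Lemma continuous_gaussf a : continuous (gaussf a).
Proof.
move=> x; apply: continuous_comp; last exact: continuous_expR.
apply: continuousN; apply: continuousM; first exact: cst_continuous.
exact: exprn_continuous.
Qed.

Lemma measurable_gaussf a : measurable_fun setT (gaussf a).
Proof. by apply: continuous_measurable_fun; exact: continuous_gaussf. Qed.

Lemma integral_gaussf (a : R) : (0 < a)%R ->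
  \int[leb]_y (gaussf a y)%:E = (Num.sqrt (pi / a))%:E.
Proof.
move=> a0; have sa : (0 < Num.sqrt a)%R by rewrite sqrtr_gt0.
have := @integralT_gauss R.
rewrite (@ge0_integral_affine _ (Num.sqrt a) 0%R _ sa); last 2 first.
- apply/measurable_EFinP; exact: measurable_gauss_fun.
- by move=> x; rewrite lee_fin gauss_fun_ge0.
under eq_integral do rewrite /gauss_fun addr0 exprMn sqr_sqrtr ?(ltW a0)//.
set I := \int[_]_x _; move=> h.
rewrite -[LHS]/I sqrtrM ?pi_ge0// sqrtrV ?(ltW a0)//.
have -> : I = (Num.sqrt a)^-1%:E * ((Num.sqrt a)%:E * I).
  by rewrite muleA -EFinM mulVf ?mul1e// gt_eqF.
by rewrite h -EFinM mulrC.
Qed.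

Lemma integrable_gaussf (a : R) : (0 < a)%R -> leb.-integrable setT (EFin \o gaussf a).
Proof.
move=> a0; apply: (@integrable_dominated _ mR _ leb _ (EFin \o gaussf a)).
- exact: measurable_gaussf.
- apply/measurable_EFinP; exact: measurable_gaussf.
- by move=> x; rewrite ger0_norm// expR_ge0.
- by rewrite integral_gaussf// ltry.
Qed.

(** Linear growth is absorbed by an arbitrarily small part of the Gaussian
    exponent. *)
Lemma norm_le_expR_sqr (b y : R) : (0 < b)%R -> (`|y| <= (1 + b^-1) * expR (b * y ^+ 2))%R.
Proof.
move=> b0; have h := expR_ge1Dx (b * y ^+ 2)%R.
have c0 : (0 < 1 + b^-1)%R by rewrite addr_gt0 ?invr_gt0.
apply: (@le_trans _ _ ((1 + b^-1) * (1 + b * y ^+ 2))%R); last by rewrite ler_pM2l.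
rewrite mulrDl mulrDr !mulr1 mul1r mulrDr mulr1 mulKf ?gt_eqF//.
have bi : (0 < b^-1)%R by rewrite invr_gt0.
have y2 : (0 <= b * y ^+ 2)%R by rewrite mulr_ge0 ?sqr_ge0// ltW.
have : (0 <= (`|y| - 1) ^+ 2)%R by rewrite sqr_ge0.
by rewrite sqrrB real_normK ?num_real//; nra.
Qed.

Lemma integrable_norm_gaussf (a : R) : (0 < a)%R ->
  leb.-integrable setT (EFin \o (fun y => `|y| * gaussf a y)%R).
Proof.
move=> a0; have a20 : (0 < a / 2)%R by rewrite divr_gt0.
apply: (@integrable_dominated _ mR _ leb _ (fun y => ((1 + (a/2)^-1) * gaussf (a / 2) y)%:E)).
- by apply: measurable_funM; [exact: normr_measurable|exact: measurable_gaussf].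
- by apply/measurable_EFinP; apply: measurable_funM => //; exact: measurable_gaussf.
- move=> y; rewrite lee_fin ger0_norm ?mulr_ge0 ?expR_ge0//.
  rewrite (le_trans (ler_wpM2r (expR_ge0 _) (norm_le_expR_sqr y a20)))//.
  rewrite -[leLHS]mulrA ler_pM2l ?addr_gt0 ?invr_gt0// /gaussf -expRD ler_expR.
  by rewrite le_eqVlt; apply/orP; left; apply/eqP; lra.
- under eq_integral do rewrite EFinM.
  rewrite ge0_integralZl//; last 3 first.
  + by apply/measurable_EFinP; exact: measurable_gaussf.
  + by move=> y _; rewrite lee_fin expR_ge0.
  + by rewrite lee_fin addr_ge0// invr_ge0 ltW.
  by rewrite integral_gaussf// -EFinM ltry.
Qed.

End gauss_fourier.

(** Differentiation under the integral sign with a majorant that does not depend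
    on the parameter; the parameter range is the whole line. *)
Lemma is_derive_under_integral {R : realType} d (Y : measurableType d)
    (mu : {measure set Y -> \bar R}) (f f' : R -> Y -> R) (G : Y -> R) (x : R) :
  (forall x, mu.-integrable setT (EFin \o f x)) ->
  (forall (x : R) y, is_derive x (1%R : R) (f ^~ y) (f' x y)) ->
  (forall x y, `|f' x y| <= G y)%R -> mu.-integrable setT (EFin \o G) ->
  is_derive x (1%R : R) (fun x => \int[mu]_y f x y)%R (\int[mu]_y f' x y)%R.
Proof.
move=> fi df f'G Gi.
have E x1 y : partial1of2 f x1 y = f' x1 y.
  by rewrite /partial1of2 derive1E; have [_ ->] := df x1 y.
have Ix : `](x - 1)%R, (x + 1)%R[%classic x.
  by rewrite /= in_itv/=; apply/andP; split; lra.
have G0 y : (0 <= G y)%R by rewrite (le_trans _ (f'G x y)).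
have dd x1 y : `](x - 1)%R, (x + 1)%R[%classic x1 -> setT y -> derivable (f^~ y) x1 1%R.
  by move=> _ _; have [] := df x1 y.
have fG x1 y : `](x - 1)%R, (x + 1)%R[%classic x1 -> setT y -> (`|partial1of2 f x1 y| <= G y)%R.
  by move=> _ _; rewrite E.
apply: DeriveDef.
  exact: (derivable_under_integral measurableT Ix (fun x _ => fi x) dd G0 Gi fG).
rewrite -derive1E (differentiation_under_integral measurableT Ix (fun x _ => fi x) dd G0 Gi fG).
by apply: eq_Rintegral => y _; rewrite E.
Qed.

Section gauss_fourier.
Context {R : realType}.
Local Notation mR := (measurableTypeR R).
Local Notation leb := (@lebesgue_measure R).

Lemma is_derive_ext (x : R) (f g : R -> R) (d d' : R) :
  is_derive x (1%R : R) f d -> (forall y, f y = g y) -> d = d' ->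
  is_derive x (1%R : R) g d'.
Proof. by move=> df fg <-; rewrite (_ : g = f)//; apply/funext => y; rewrite fg. Qed.

Lemma cvg_gaussf_nat (a : R) : (0 < a)%R -> gaussf a n%:R @[n --> \oo] --> (0 : R)%R.
Proof.
move=> a0; apply: (@squeeze_cvgr _ _ _ _ (cst 0%R) (fun n : nat => a^-1 * n.+1%:R^-1 * 2)%R).
- near=> n; rewrite expR_ge0/= /gaussf expRN.
  have n1 : (1 <= n%:R :> R)%R by rewrite ler1n; near: n; exact: nbhs_infty_gt.
  have e1 := expR_ge1Dx (a * n%:R ^+ 2)%R.
  have an0 : (0 < a * n%:R)%R by rewrite mulr_gt0//; lra.
  have h : (a * n%:R <= expR (a * n%:R ^+ 2))%R.
    apply: le_trans e1; rewrite expr2 mulrA; nra.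
  apply: (@le_trans _ _ (a * n%:R)^-1)%R; first by rewrite lef_pV2// posrE ?expR_gt0.
  rewrite invfM -!mulrA ler_pM2l ?invr_gt0// -natr1.
  by rewrite mulrC ler_pdivlMr ?addr_gt0//; last lra; rewrite mulrC ler_pdivrMr; lra.
- exact: cvg_cst.
- rewrite -[X in _ --> X](mul0r 2%R); apply: cvgM; last exact: cvg_cst.
  rewrite -(mulr0 a^-1%R); apply: cvgM; first exact: cvg_cst.
  exact: cvg_harmonic.
Unshelve. all: end_near. Qed.

Lemma gaussfN (a y : R) : gaussf a (- y) = gaussf a y.
Proof. by rewrite /gaussf sqrrN. Qed.

Lemma is_derive_gaussf (a y : R) :
  is_derive y (1%R : R) (gaussf a) (- (2 * a * y) * gaussf a y)%R.
Proof.
rewrite /gaussf.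
have d1 : is_derive y (1%R : R) (fun y : R => - (a * y ^+ 2))%R (- (2 * a * y))%R.
  apply: is_derive_eq; rewrite ?scaler0 ?addr0.
  rewrite /GRing.scale/=; ring.
apply: (is_derive_ext (is_derive1_comp (is_derive_expR _) d1)) => //.
by rewrite mulrC.
Qed.

Lemma is_derive_affine (th xi y : R) :
  is_derive y (1%R : R) (fun y => th + y * xi)%R xi.
Proof.
by apply: is_derive_eq; rewrite /GRing.scale/=; ring.
Qed.

Lemma integrable_gaussf_bounded (a : R) (g : R -> R) : (0 < a)%R ->
  measurable_fun setT (g : mR -> _) -> (forall y, `|g y| <= 1)%R ->
  leb.-integrable setT (EFin \o (fun y => gaussf a y * g y)%R).
Proof.
move=> a0 mg g1.
apply: (@integrable_dominated _ mR _ leb _ (EFin \o gaussf a)).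
- by apply: measurable_funM => //; exact: measurable_gaussf.
- apply/measurable_EFinP; exact: measurable_gaussf.
- by move=> y; rewrite lee_fin normrM (ger0_norm (expR_ge0 _)) ler_piMr// expR_ge0.
- by rewrite integral_gaussf// ltry.
Qed.

Lemma measurable_trig (th xi : R) : 
  measurable_fun setT (fun y : mR => cos (th + y * xi)%R) /\
  measurable_fun setT (fun y : mR => sin (th + y * xi)%R).
Proof.
split; apply: continuous_measurable_fun => y.
  by apply/differentiable_continuous/derivable1_diffP; have [] :=
    is_derive1_comp (is_derive_cos _) (is_derive_affine th xi y).
by apply/differentiable_continuous/derivable1_diffP; have [] :=
    is_derive1_comp (is_derive_sin _) (is_derive_affine th xi y).
Qed.

Lemma integrable_mul_gaussf_bounded (a : R) (g : R -> R) : (0 < a)%R ->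
  measurable_fun setT (g : mR -> _) -> (forall y, `|g y| <= 1)%R ->
  leb.-integrable setT (EFin \o (fun y => y * gaussf a y * g y)%R).
Proof.
move=> a0 mg g1.
apply: (le_integrable _ _ _ (integrable_norm_gaussf a0)) => //.
- apply/measurable_EFinP; apply: measurable_funM => //.
  by apply: measurable_funM => //; exact: measurable_gaussf.
- move=> y _ /=; rewrite lee_fin !normrM normr_id.
  by rewrite ler_piMr// mulr_ge0.
Qed.

(** The integrand of the difference of the two sides is, up to a constant, the
    derivative of [gaussf a y * sin (th + y * xi)], which vanishes at infinity. *)
Lemma gauss_by_parts (a th xi : R) : (0 < a)%R ->
  (\int[leb]_y (y * gaussf a y * sin (th + y * xi)) =
   (xi / (2 * a)) * \int[leb]_y (gaussf a y * cos (th + y * xi)))%R.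
Proof.
move=> a0.
have [mc ms] := measurable_trig th xi.
have ic := integrable_gaussf_bounded a0 mc (fun y => cos_max _).
have isin := integrable_mul_gaussf_bounded a0 ms (fun y => sin_max _).
pose f y := (xi * (gaussf a y * cos (th + y * xi)) -
             (2 * a) * (y * gaussf a y * sin (th + y * xi)))%R.
have dF (x : R) : is_derive x (1%R : R) (fun y => gaussf a y * sin (th + y * xi))%R (f x).
  have d1 := is_derive_gaussf a x.
  have d2 := is_derive1_comp (is_derive_sin _) (is_derive_affine th xi x).
  apply: (is_derive_ext (is_deriveM d1 d2)) => //.
  rewrite /f /GRing.scale/=; ring.
have if_ : leb.-integrable setT (EFin \o f).
  rewrite /f; have := integrableB measurableT
    (integrable_RZl xi ic) (integrable_RZl (2 * a)%R isin).
  by apply: eq_integrable => // y _ /=; rewrite EFinB.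
have : (\int[leb]_x f x = 0)%R.
  apply: (integral_derive_vanishing dF) => //.
  - move=> x; apply: differentiable_continuous.
    apply/derivable1_diffP; rewrite /f.
    have d1 := is_derive_gaussf a x.
    have d2 := is_derive1_comp (is_derive_sin _) (is_derive_affine th xi x).
    have d3 := is_derive1_comp (is_derive_cos _) (is_derive_affine th xi x).
    have d4 := is_deriveM d1 d3.
    have d5 := is_deriveM (is_deriveM (is_derive_id x (1%R:R)) d1) d2.
    have [] // := is_deriveB (is_deriveZ xi d4) (is_deriveZ (2 * a)%R d5).
  - apply: (@squeeze_cvgr _ _ _ _ (fun n : nat => - gaussf a n%:R)%R (fun n : nat => gaussf a n%:R)); last 2 first.
    + by rewrite -oppr0; apply: cvgN; exact: cvg_gaussf_nat.
    + exact: cvg_gaussf_nat.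
    apply: nearW => n; rewrite -ler_norml normrM (ger0_norm (expR_ge0 _)).
    by rewrite ler_piMr ?expR_ge0// sin_max.
  - apply: (@squeeze_cvgr _ _ _ _ (fun n : nat => - gaussf a n%:R)%R (fun n : nat => gaussf a n%:R)); last 2 first.
    + by rewrite -oppr0; apply: cvgN; exact: cvg_gaussf_nat.
    + exact: cvg_gaussf_nat.
    apply: nearW => n; rewrite -ler_norml normrM gaussfN (ger0_norm (expR_ge0 _)).
    by rewrite ler_piMr ?expR_ge0// sin_max.
rewrite /f RintegralB//; [|exact: integrable_RZl..].
rewrite !RintegralZl// => /eqP; rewrite subr_eq0 => /eqP h.
by rewrite mulrAC h mulrC mulKf// mulf_neq0// gt_eqF.
Qed.

(** As a function of xi the integral solves a linear differential equation, by
    [gauss_by_parts], and its value at xi = 0 is the Gaussian integral.  The phase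
    th allows to treat the real and the imaginary part together, and makes the
    statement stable under the induction on the dimension. *)
Lemma gauss_fourier (a th xi : R) : (0 < a)%R ->
  (\int[leb]_y (gaussf a y * cos (th + y * xi)) =
   Num.sqrt (pi / a) * expR (- (xi ^+ 2 / (4 * a))) * cos th)%R.
Proof.
move=> a0.
pose F (x : R) := (\int[leb]_y (gaussf a y * cos (th + y * x)))%R.
have dfy (x y : R) : is_derive x (1%R : R)
    (fun x => gaussf a y * cos (th + y * x))%R (gaussf a y * (- sin (th + y * x) * y))%R.
  have d1 : is_derive x (1%R : R) (fun x => th + y * x)%R y.
    by apply: is_derive_eq; rewrite /GRing.scale/=; ring.
  exact: (is_derive_ext (is_deriveZ (gaussf a y) (is_derive1_comp (is_derive_cos _) d1))).
have mtr x := measurable_trig th x.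
have int_f x : leb.-integrable setT (EFin \o (fun y => gaussf a y * cos (th + y * x))%R).
  by apply: integrable_gaussf_bounded => //; [exact: (mtr x).1|move=> y; exact: cos_max].
have Gub (x : R) (y : mR) : (`|gaussf a y * (- sin (th + y * x) * y)| <= `|y| * gaussf a y)%R.
  rewrite mulNr mulrN normrN !normrM (ger0_norm (expR_ge0 _)) mulrC -mulrA.
  by rewrite ler_piMl ?mulr_ge0 ?expR_ge0// sin_max.
have dF (x : R) : is_derive x (1%R : R) F (- (x / (2 * a)) * F x)%R.
  have := is_derive_under_integral x int_f dfy Gub (integrable_norm_gaussf a0).
  move=> d; apply: (is_derive_ext d) => //.
  transitivity (\int[leb]_y (-1 * (y * gaussf a y * sin (th + y * x))))%R.
    by apply: eq_Rintegral => y _; ring.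
  rewrite RintegralZl//; first by rewrite gauss_by_parts// mulrA mulN1r.
  by apply: integrable_mul_gaussf_bounded => //; [exact: (mtr x).2|move=> y; exact: sin_max].
have dH (x : R) : is_derive x (1%R : R) (fun x => F x * expR (x ^+ 2 / (4 * a)))%R 0%R.
  have d1 : is_derive x (1%R : R) (fun x => x ^+ 2 / (4 * a))%R (x / (2 * a))%R.
    apply: is_derive_eq; rewrite /GRing.scale/=.
    by field; rewrite gt_eqF.
  have d2 := is_derive1_comp (is_derive_expR _) d1.
  apply: (is_derive_ext (is_deriveM (dF x) d2)) => //.
  rewrite /GRing.scale/=; ring.
have := is_derive_0_is_cst xi 0%R dH; rewrite expr0n/= mul0r expR0 mulr1.
have -> : F 0%R = (Num.sqrt (pi / a) * cos th)%R.
  rewrite /F; under eq_Rintegral do rewrite mulr0 addr0 mulrC.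
  rewrite RintegralZl//; last exact: integrable_gaussf.
  by rewrite /Rintegral integral_gaussf// mulrC.
by move=> h; rewrite -/(F xi) [RHS]mulrAC -h expRN mulfK// gt_eqF// expR_gt0.
Qed.

End gauss_fourier.

(** * The heat kernel *)

Section Rintegral_cons.
Context {R : realType}.
Local Notation mR := (measurableTypeR R).
Local Notation leb := (@lebesgue_measure R).

Lemma integral_transport d1 d2 (X : measurableType d1) (Y : measurableType d2)
    (mu : {measure set X -> \bar R})
    (nu : {measure set Y -> \bar R}) (phi : X -> Y) (f : Y -> \bar R) :
  measurable_fun setT phi ->
  (forall A, measurable A -> nu A = mu (phi @^-1` A)) ->
  measurable_fun setT f ->
  \int[nu]_y f y = \int[mu]_x f (phi x).
Proof.
move=> mphi numu mf; rewrite integralE [RHS]integralE.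
rewrite (ge0_integral_transport mphi numu (measurable_funepos mf))//.
rewrite (ge0_integral_transport mphi numu (measurable_funeneg mf))//.
by congr (_ - _); apply: eq_integral => x _; rewrite ?funeposE ?funenegE.
Qed.

Lemma Rintegral_cons n (f : 'rV[R]_n.+1 -> R) :
  (lebesgue_rV n.+1).-integrable setT (EFin \o f) ->
  (\int[lebesgue_rV n.+1]_x f x =
   \int[leb]_a (\int[lebesgue_rV n]_x f (cons_rV (a, x))))%R.
Proof.
move=> fi.
have mf : measurable_fun setT f by have /integrableP[/measurable_EFinP] := fi.
have mc := @measurable_cons_rV R n.
have mfc : measurable_fun setT (fun z => f (cons_rV z)) by exact: (measurableT_comp mf).
have fi2 : (leb \x lebesgue_rV n)%E.-integrable setT (EFin \o (fun z => f (cons_rV z))).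
  apply/integrableP; split; first exact/measurable_EFinP.
  case/integrableP : fi => _; rewrite (@ge0_integral_transport _ _ _ _ _ (leb \x lebesgue_rV n)%E _ (@cons_rV R n)) //.
  by apply: measurableT_comp => //; exact/measurable_EFinP.
rewrite /Rintegral (Rintegral_fine (integrable_fubini_F fi2)); congr fine.
rewrite (integral12_prod_meas1 fi2).
rewrite (@integral_transport _ _ _ _ (leb \x lebesgue_rV n)%E _ (@cons_rV R n)) //.
exact/measurable_EFinP.
Qed.

End Rintegral_cons.

Section heat_kernel.
Context {R : realType}.
Local Notation mR := (measurableTypeR R).
Local Notation leb := (@lebesgue_measure R).
Local Open Scope ring_scope.

Definition heat1 (t a : R) : R := (4 * pi * t) `^ (- 2^-1) * gaussf (4 * t)^-1 a.

Lemma enorm_cons n (z : mR * 'rV[R]_n) :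
  enorm (cons_rV z) ^+ 2 = z.1 ^+ 2 + enorm z.2 ^+ 2.
Proof.
rewrite !enormE !fnorm_sqr big_ord_recl cons_rV0; congr (_ + _).
by apply: eq_bigr => i _; rewrite cons_rVS.
Qed.

(** The heat kernel is a product over the coordinates, which makes induction on
    the dimension possible. *)
Lemma heat_kernel_cons n t (z : mR * 'rV[R]_n) :
  heat_kernel t (cons_rV z) = heat1 t z.1 * heat_kernel t z.2.
Proof.
have [p0|p0] := eqVneq (4 * pi * t)%R 0%R; last first.
  rewrite /heat_kernel /heat1 /gaussf enorm_cons.
  rewrite (_ : - (n.+1%:R / 2) = - 2^-1 + - (n%:R / 2)); last first.
    by rewrite -natr1; field.
  rewrite powRD; last by rewrite p0 implybT.
  rewrite mulrACA -expRD; congr (_ * expR _).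
  by rewrite (mulrC _^-1) -opprD mulrDl.
have n1 : - (n.+1%:R / 2) != 0 :> R by rewrite oppr_eq0 mulf_neq0// ?invr_neq0.
have n2 : - 2^-1 != 0 :> R by rewrite oppr_eq0 invr_neq0.
rewrite /heat_kernel /heat1 p0 (powR0 n1) (powR0 n2). by rewrite !mul0r.
Qed.

Lemma measurable_heat1 t : measurable_fun setT (heat1 t : mR -> R).
Proof. by apply: measurable_funM => //; exact: measurable_gaussf. Qed.

Lemma heat1_ge0 t a : 0 <= heat1 t a.
Proof. by rewrite mulr_ge0 ?powR_ge0 ?expR_ge0. Qed.

Lemma heat_kernel_ge0 n t (x : 'rV[R]_n) : 0 <= heat_kernel t x.
Proof. by rewrite mulr_ge0 ?powR_ge0 ?expR_ge0. Qed.

Lemma heat1_constE (t : R) : 0 < t -> (4 * pi * t) `^ (- 2^-1) * Num.sqrt (pi / (4 * t)^-1) = 1.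
Proof.
move=> t0; have p0 : 0 < 4 * pi * t by rewrite !mulr_gt0 ?pi_gt0.
rewrite invrK (_ : pi * (4 * t) = 4 * pi * t); last by ring.
by rewrite powRN powR12_sqrt ?(ltW p0)// mulVf// gt_eqF// sqrtr_gt0.
Qed.

Lemma integral_heat1 (t : R) : 0 < t -> (\int[leb]_y (heat1 t y)%:E = 1)%E.
Proof.
move=> t0; under eq_integral do rewrite EFinM.
have c0 : 0 < (4 * t)^-1 by rewrite invr_gt0 mulr_gt0.
rewrite ge0_integralZl//; first last.
- by rewrite lee_fin powR_ge0.
- by move=> y _; rewrite lee_fin expR_ge0.
- by apply/measurable_EFinP; exact: measurable_gaussf.
by rewrite integral_gaussf// -EFinM heat1_constE.
Qed.

Lemma heat1_fourier t th xi : 0 < t ->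
  \int[leb]_y (heat1 t y * cos (th + y * xi)) = expR (- (t * xi ^+ 2)) * cos th.
Proof.
move=> t0; have c0 : 0 < (4 * t)^-1 by rewrite invr_gt0 mulr_gt0.
under eq_Rintegral do rewrite -mulrA.
rewrite RintegralZl//; last first.
  apply: integrable_gaussf_bounded => //; first exact: (measurable_trig th xi).1.
  by move=> y; exact: cos_max.
rewrite gauss_fourier// !mulrA heat1_constE// mul1r; congr (expR _ * _).
by field; rewrite gt_eqF.
Qed.

Lemma measurable_heat_kernel n t : measurable_fun setT (heat_kernel t : 'rV[R]_n -> R).
Proof.
apply: measurable_funM => //; apply: measurableT_comp => //.
apply: measurableT_comp => //; apply: measurable_funM => //.
by apply: measurable_funX; exact: measurable_enorm.
Qed.

Lemma integral_heat_kernel n (t : R) : 0 < t ->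
  (\int[lebesgue_rV n]_y (heat_kernel t y)%:E = 1)%E.
Proof.
move=> t0; elim: n => [|n IH].
  rewrite /= integral_dirac//; last by apply/measurable_EFinP; exact: measurable_heat_kernel.
  rewrite diracT mul1e /heat_kernel /enorm big_ord0 sqrtr0 expr0n/= !mul0r !oppr0.
  by rewrite powRr0 expR0 mul1r.
rewrite ge0_integral_cons; last 2 first.
- by apply/measurable_EFinP; exact: measurable_heat_kernel.
- by move=> x; rewrite lee_fin heat_kernel_ge0.
rewrite -(integral_heat1 t0); apply: eq_integral => a _.
transitivity (\int[lebesgue_rV n]_x ((heat1 t a)%:E * (heat_kernel t x)%:E))%E.
  by apply: eq_integral => x _; rewrite heat_kernel_cons EFinM.
rewrite ge0_integralZl//.
- by rewrite IH mule1.
- by apply/measurable_EFinP; exact: measurable_heat_kernel.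
- by move=> x _; rewrite lee_fin heat_kernel_ge0.
- by rewrite lee_fin heat1_ge0.
Qed.

Lemma measurable_dot n (xi : 'rV[R]_n) (th : R) :
  measurable_fun setT (fun y : 'rV[R]_n => th + \sum_(l < n) y 0 l * xi 0 l).
Proof.
apply: measurable_funD => //; apply: measurable_sum => i.
by apply: measurable_funM => //; exact: measurable_coordT.
Qed.

Lemma integrable_heat_kernel_bounded n t (g : 'rV[R]_n -> R) : 0 < t ->
  measurable_fun setT g -> (forall y, `|g y| <= 1) ->
  (lebesgue_rV n).-integrable setT (EFin \o (fun y => heat_kernel t y * g y)).
Proof.
move=> t0 mg g1.
apply: (@integrable_dominated _ _ _ _ _ (EFin \o heat_kernel t)).
- by apply: measurable_funM => //; exact: measurable_heat_kernel.
- by apply/measurable_EFinP; exact: measurable_heat_kernel.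
- by move=> y; rewrite lee_fin normrM (ger0_norm (heat_kernel_ge0 _ _)) ler_piMr// heat_kernel_ge0.
- by rewrite integral_heat_kernel// ltry.
Qed.

Lemma measurable_cosR : measurable_fun setT (@cos R).
Proof. by apply: continuous_measurable_fun; exact: continuous_cos. Qed.

(** By induction on the dimension: the last n coordinates only shift the phase of
    the one-dimensional integral. *)
Lemma heat_fourier n t (th : R) (xi : 'rV[R]_n) : 0 < t ->
  \int[lebesgue_rV n]_y (heat_kernel t y * cos (th + \sum_(l < n) y 0 l * xi 0 l)) =
  expR (- (t * enorm xi ^+ 2)) * cos th.
Proof.
move=> t0; elim: n th xi => [|n IH] th xi.
  rewrite /Rintegral/= integral_dirac//; last first.
    apply/measurable_EFinP; apply: measurable_funM; first exact: measurable_heat_kernel.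
    by apply: (measurableT_comp measurable_cosR); exact: measurable_dot.
  rewrite diracT mul1e/= /heat_kernel /enorm !big_ord0 sqrtr0 expr0n/= !mul0r mulr0 !oppr0.
  by rewrite powRr0 expR0 mul1r addr0.
rewrite Rintegral_cons; last first.
  apply: integrable_heat_kernel_bounded => //.
    by apply: (measurableT_comp measurable_cosR); exact: measurable_dot.
  by move=> y; exact: cos_max.
pose xi' : 'rV[R]_n := \row_i xi 0 (lift ord0 i).
transitivity (\int[leb]_a (expR (- (t * enorm xi' ^+ 2)) * (heat1 t a * cos (th + a * xi 0 ord0)))).
  apply: eq_Rintegral => a _.
  rewrite mulrCA -IH -RintegralZl//; last first.
    apply: integrable_heat_kernel_bounded => //.
      by apply: (measurableT_comp measurable_cosR); exact: measurable_dot.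
    by move=> y; exact: cos_max.
  apply: eq_Rintegral => x _; rewrite heat_kernel_cons/= mulrA; congr (_ * cos _).
  rewrite big_ord_recl cons_rV0/= addrA; congr (_ + _).
  by apply: eq_bigr => i _; rewrite cons_rVS mxE.
rewrite RintegralZl//; last first.
  apply: (@integrable_dominated _ mR _ leb _ (EFin \o heat1 t)).
  - by apply: measurable_funM => //; [exact: measurable_heat1|exact: (measurable_trig _ _).1].
  - by apply/measurable_EFinP; exact: measurable_heat1.
  - by move=> y; rewrite lee_fin normrM (ger0_norm (heat1_ge0 _ _)) ler_piMr ?heat1_ge0 ?cos_max.
  - by rewrite integral_heat1// ltry.
rewrite heat1_fourier// mulrA -expRD; congr (expR _ * _).
rewrite -opprD -mulrDr !enormE !fnorm_sqr [in RHS]big_ord_recl addrC; congr (- (t * (_ + _))).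
by apply: eq_bigr => i _; rewrite mxE.
Qed.

End heat_kernel.

Section reflect.
Context {R : realType}.

Lemma measurable_reflect_rV n (a : 'rV[R]_n) :
  measurable_fun setT (fun x : 'rV[R]_n => a - x)%R.
Proof. exact: measurable_funB_rV. Qed.

Lemma lebesgue_rV_reflect n (a : 'rV[R]_n) (A : set 'rV[R]_n) : measurable A ->
  lebesgue_rV n A = lebesgue_rV n ((fun x => a - x)%R @^-1` A).
Proof.
move=> mA; transitivity (\int[lebesgue_rV n]_x (\1_A x)%:E).
  by rewrite integral_indic// setIT.
rewrite -(@ge0_integral_reflect_rV _ n a)//; last by apply/measurable_EFinP.
set B := _ @^-1` A; have mB : measurable B.
  by rewrite -[X in measurable X]setTI; exact: measurable_reflect_rV.
by rewrite -[in RHS](setIT B) -integral_indic.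
Qed.

Lemma Rintegral_reflect_rV n (a : 'rV[R]_n) (f : 'rV[R]_n -> R) :
  measurable_fun setT f ->
  (\int[lebesgue_rV n]_x f (a - x) = \int[lebesgue_rV n]_x f x)%R.
Proof.
move=> mf; congr fine; apply/esym.
rewrite (@integral_transport _ _ _ _ _ (lebesgue_rV n) _ (fun x => a - x)%R)//.
- exact: measurable_reflect_rV.
- by move=> A mA; exact: lebesgue_rV_reflect.
- exact/measurable_EFinP.
Qed.

End reflect.

Section fourier_kernels.
Context {R : realType} (n : nat).
Local Notation mR := (measurableTypeR R).
Local Notation mu := (@lebesgue_rV R n).
Local Open Scope ring_scope.

Definition dot (x xi : 'rV[R]_n) : R := \sum_(l < n) x 0 l * xi 0 l.

Lemma measurable_fun_dot d (T : measurableType d) (f g : T -> 'rV[R]_n) :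
  measurable_fun setT f -> measurable_fun setT g ->
  measurable_fun setT (fun z => dot (f z) (g z)).
Proof.
move=> mf mg; apply: measurable_sum => i.
by apply: measurable_funM; exact: measurable_fun_coord.
Qed.

Lemma dotBl x y xi : dot (x - y) xi = dot x xi - dot y xi.
Proof. by rewrite /dot -sumrB; apply: eq_bigr => i _; rewrite !mxE mulrBl. Qed.

Lemma dotC x y : dot x y = dot y x.
Proof. by apply: eq_bigr => i _; rewrite mulrC. Qed.

Lemma measurable_fun_cos d (T : measurableType d) (f : T -> R) :
  measurable_fun setT f -> measurable_fun setT (fun z => cos (f z)).
Proof. by move=> mf; exact: (measurableT_comp measurable_cosR mf). Qed.

Lemma measurable_fun_expR d (T : measurableType d) (f : T -> R) :
  measurable_fun setT f -> measurable_fun setT (fun z => expR (f z)).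
Proof. by move=> mf; exact: (measurableT_comp (@measurable_expR R) mf). Qed.

(** Exchange the two integrals; the inner one is the Fourier transform of the
    heat kernel, which multiplies the integrand by a Gaussian. *)
Lemma conv_fourier (M : 'rV[R]_n -> R) t th x : 0 < t ->
  mu.-integrable setT (EFin \o M) ->
  \int[mu]_y (heat_kernel t y * \int[mu]_xi (M xi * cos (th + dot (x - y) xi))) =
  \int[mu]_xi (M xi * expR (- (t * enorm xi ^+ 2)) * cos (th + dot x xi)).
Proof.
move=> t0 iM; have mM : measurable_fun setT M by have /integrableP[/measurable_EFinP] := iM.
pose f (z : 'rV[R]_n * 'rV[R]_n) := heat_kernel t z.1 * (M z.2 * cos (th + dot (x - z.1) z.2)).
have mf : measurable_fun setT f.
  apply: measurable_funM; first exact: (measurableT_comp (@measurable_heat_kernel R n t) measurable_fst).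
  apply: measurable_funM; first exact: (measurableT_comp mM measurable_snd).
  apply: measurable_fun_cos; apply: measurable_funD => //.
  apply: measurable_fun_dot => //; apply: measurable_funB_rV => //.
have Moo : (\int[mu]_x `|M x|%:E < +oo)%E by case/integrableP : iM.
have mMe : measurable_fun setT (fun x => `|M x|%:E) by apply/measurable_EFinP; exact: measurableT_comp.
have mh := @measurable_heat_kernel R n t.
have iMc y : mu.-integrable setT (EFin \o (fun xi => M xi * cos (th + dot (x - y) xi))).
  apply: (@integrable_dominated _ _ _ _ _ (fun xi => `|M xi|%:E)) => //.
    by apply: measurable_funM => //; apply: measurable_fun_cos; apply: measurable_funD => //;
       exact: measurable_fun_dot.
  by move=> z; rewrite lee_fin normrM ler_piMr// cos_max.
transitivity (\int[mu]_y \int[mu]_xi f (y, xi)).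
  by apply: eq_Rintegral => y _; rewrite /f/= RintegralZl.
rewrite Rfubini//.
  apply: eq_Rintegral => xi _; rewrite /f/=.
  under eq_Rintegral do rewrite mulrCA.
  rewrite RintegralZl//; last first.
    apply: integrable_heat_kernel_bounded => //; last by move=> y; exact: cos_max.
    apply: measurable_fun_cos; apply: measurable_funD => //.
    by apply: measurable_fun_dot => //; exact: measurable_funB_rV.
  rewrite -mulrA; congr (_ * _).
  rewrite -[cos (th + dot x xi)]cosN -heat_fourier//.
  apply: eq_Rintegral => y _; rewrite -cosN dotBl; congr (_ * cos _).
  by rewrite -/(dot y xi); ring.
apply: (@le_lt_trans _ _ (\int[mu]_y ((heat_kernel t y)%:E * \int[mu]_xi `|M xi|%:E))%E).
  apply: ge0_le_integral => //.
  - by move=> y _; apply: integral_ge0.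
  - apply: (@measurable_fun_fubini_tonelli_F _ _ _ _ _ _ (fun z => `|f z|%:E)) => //.
    by apply/measurable_EFinP; exact: measurableT_comp.
  - by apply: emeasurable_funM => //; exact/measurable_EFinP.
  - move=> y _; rewrite -ge0_integralZl//; last by rewrite lee_fin heat_kernel_ge0.
    apply: ge0_le_integral => //.
    + apply/measurable_EFinP; apply: measurableT_comp => //.
      exact: (measurableT_comp mf (pair1_measurable y)).
    + exact: measurable_funeM.
    + move=> xi _; rewrite -EFinM lee_fin /f/= normrM (ger0_norm (heat_kernel_ge0 _ _)).
      by rewrite ler_wpM2l ?heat_kernel_ge0// normrM ler_piMr// cos_max.
rewrite ge0_integralZr//; last 3 first.
- exact/measurable_EFinP.
- by move=> y _; rewrite lee_fin heat_kernel_ge0.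
- by apply: integral_ge0.
by rewrite integral_heat_kernel// mul1e.
Qed.

Lemma heat_kernel_cst t (x : 'rV[R]_n) : 0 < t ->
  expR (- (t * enorm x ^+ 2)) = (pi / t) `^ (n%:R / 2) * heat_kernel (4 * t)^-1 x.
Proof.
move=> t0; rewrite /heat_kernel (_ : 4 * pi / (4 * t) = pi / t); last first.
  by field; rewrite gt_eqF.
rewrite mulrA -powRD; last by apply/implyP => _; rewrite gt_eqF// divr_gt0// pi_gt0.
rewrite subrr powRr0 mul1r; congr (expR (- _)); field; by rewrite gt_eqF.
Qed.

Lemma integral_expR_enorm t : 0 < t ->
  (\int[mu]_x (expR (- (t * enorm x ^+ 2)))%:E = ((pi / t) `^ (n%:R / 2))%:E)%E.
Proof.
move=> t0; under eq_integral do rewrite heat_kernel_cst// EFinM.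
rewrite ge0_integralZl//; last 3 first.
- by apply/measurable_EFinP; exact: measurable_heat_kernel.
- by move=> x _; rewrite lee_fin heat_kernel_ge0.
- by rewrite lee_fin powR_ge0.
by rewrite integral_heat_kernel ?mule1// invr_gt0 mulr_gt0.
Qed.

Lemma measurable_expR_enorm t :
  measurable_fun setT (fun x : 'rV[R]_n => expR (- (t * enorm x ^+ 2))).
Proof.
apply: measurable_fun_expR; apply: measurableT_comp => //; apply: measurable_funM => //.
by apply: measurable_funX; exact: measurable_enorm.
Qed.

(** A Gaussian in xi is, up to a constant, a heat kernel, hence integrable; half of
    its exponent absorbs the linear growth of the other factor. *)
Lemma integrable_expR_enorm_bounded t (g : 'rV[R]_n -> R) c : 0 < t ->
  measurable_fun setT g -> (forall x, `|g x| <= c * enorm x + c) ->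
  mu.-integrable setT (EFin \o (fun x => g x * expR (- (t * enorm x ^+ 2)))).
Proof.
move=> t0 mg gc.
have c0 : 0 <= c by have := le_trans (normr_ge0 _) (gc 0); rewrite enorm0 mulr0 add0r.
have t20 : 0 < t / 2 by rewrite divr_gt0.
pose C := (c * (1 + (t / 2)^-1) + c).
apply: (@integrable_dominated _ _ _ _ _ (fun x => (C * expR (- ((t / 2) * enorm x ^+ 2)))%:E)).
- by apply: measurable_funM => //; exact: measurable_expR_enorm.
- apply/measurable_EFinP; apply: measurable_funM => //; exact: measurable_expR_enorm.
- move=> x; rewrite lee_fin normrM (ger0_norm (expR_ge0 _)).
  rewrite (_ : - (t * _) = t / 2 * enorm x ^+ 2 * -1 - (t / 2) * enorm x ^+ 2); last by lra.
  rewrite expRD mulrA ler_wpM2r ?expR_ge0// mulrN1 expRN ler_pdivrMr ?expR_gt0//.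
  apply: le_trans (gc x) _; rewrite mulrDl lerD//.
    have := norm_le_expR_sqr (enorm x) t20; rewrite (ger0_norm (enorm_ge0 _)) => h.
    by rewrite -[leRHS]mulrA ler_wpM2l.
  by rewrite ler_peMr// (le_trans _ (expR_ge1Dx _))// lerDl mulr_ge0 ?sqr_ge0// ltW.
- under eq_integral do rewrite EFinM.
  rewrite ge0_integralZl//.
  + by rewrite integral_expR_enorm// -EFinM ltry.
  + by apply/measurable_EFinP; exact: measurable_expR_enorm.
  + by rewrite lee_fin addr_ge0 ?mulr_ge0 ?addr_ge0 ?invr_ge0// ltW.
Qed.

End fourier_kernels.

(** * The gradient of the Oseen kernel *)

Section kernels.
Context {R : realType} (n : nat).
Local Notation mR := (measurableTypeR R).
Local Notation mu := (@lebesgue_rV R n).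
Local Open Scope ring_scope.

(** The symbol of the Leray projection onto divergence-free fields. *)
Definition leray (i j : 'I_n) (xi : 'rV[R]_n) : R :=
  (i == j)%:R - xi 0 i * xi 0 j / enorm xi ^+ 2.

Lemma ler_enorm (x : 'rV[R]_n) i : `|x 0 i| <= enorm x.
Proof. exact: (ler_fnorm (fun i => x 0 i)). Qed.

Lemma norm_leray i j xi : `|leray i j xi| <= 2.
Proof.
rewrite /leray (le_trans (ler_normB _ _))// (_ : 2 = 1 + 1 :> R)// lerD//.
  by case: (i == j); rewrite ?normr1 ?normr0.
have [->|x0] := eqVneq (enorm xi) 0; first by rewrite expr0n/= invr0 mulr0 normr0.
have xp : 0 < enorm xi by rewrite lt_def x0 enorm_ge0.
rewrite normrM normfV (ger0_norm (sqr_ge0 _)) ler_pdivrMr ?exprn_gt0// mul1r.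
by rewrite normrM expr2 ler_pM// ler_enorm.
Qed.

Lemma measurable_invr : measurable_fun setT (fun x : R => x^-1).
Proof.
rewrite (_ : (fun x => _) = (fun x => Num.sg x * powR `|x| (-1))); last first.
  apply/funext => x; have [->|x0] := eqVneq x 0; first by rewrite invr0 sgr0 mul0r.
  by rewrite powR_inv1// -normfV [LHS]numEsg sgrV.
apply: measurable_funM; last by apply: (measurableT_comp (measurable_powR _)); exact: normr_measurable.
rewrite (_ : Num.sg = (fun x : R => if x < 0 then -1 else if 0 < x then 1 else 0)); last first.
  by apply/funext => x; case: sgrP.
apply: measurable_fun_ifT; [exact: measurable_fun_ltr|exact: measurable_cst|].
by apply: measurable_fun_ifT; [exact: measurable_fun_ltr|exact: measurable_cst|exact: measurable_cst].
Qed.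

Lemma measurable_leray i j : measurable_fun setT (leray i j).
Proof.
apply: measurable_funB => //; apply: measurable_funM.
  by apply: measurable_funM; exact: measurable_coordT.
apply: (measurableT_comp measurable_invr); apply: measurable_funX; exact: measurable_enorm.
Qed.

Definition oseen_symbol (k i j : 'I_n) (t : R) (xi : 'rV[R]_n) : R :=
  (xi 0 k * leray i j xi) * expR (- (t * enorm xi ^+ 2)).

Definition grad_oseen_fourier (k i j : 'I_n) (t : R) (x : 'rV[R]_n) : R :=
  (2 * pi) ^- n * \int[mu]_xi (oseen_symbol k i j t xi * cos (pi / 2 + dot x xi)).

Lemma measurable_oseen_symbol0 k i j :
  measurable_fun setT (fun xi : 'rV[R]_n => xi 0 k * leray i j xi).
Proof. by apply: measurable_funM; [exact: measurable_coordT|exact: measurable_leray]. Qed.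

Lemma norm_oseen_symbol0 k i j (xi : 'rV[R]_n) : `|xi 0 k * leray i j xi| <= 2 * enorm xi + 2.
Proof.
rewrite normrM mulrC (@le_trans _ _ (2 * enorm xi))//; last by rewrite lerDl.
by rewrite ler_pM// ?norm_leray ?ler_enorm.
Qed.

Lemma integrable_oseen_symbol k i j t : 0 < t ->
  mu.-integrable setT (EFin \o oseen_symbol k i j t).
Proof.
move=> t0; apply: (@integrable_expR_enorm_bounded _ _ _ _ 2) => //.
  exact: measurable_oseen_symbol0.
exact: norm_oseen_symbol0.
Qed.

Lemma derive_line (f : 'rV[R]_n -> R) (v x : 'rV[R]_n) (d : R) :
  is_derive (0 : R) (1 : R) (fun h => f (h *: v + x)) d -> 'D_v f x = d.
Proof.
move=> [_ <-]; rewrite /derive.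
rewrite (_ : (fun h : R => h^-1 *: ((f \o shift x) (h *: v) - f x)) =
  (fun h : R => h^-1 *: (((fun h : R => f (h *: v + x)) \o shift 0) (h *: (1 : R)) -
                         f (0 *: v + x)))) //.
by apply/funext => h /=; rewrite addr0 scale0r add0r /GRing.scale/= mulr1.
Qed.

(** Differentiation under the Fourier integral.  The factor [-sin] is written as a
    cosine with phase pi / 2, so that [conv_fourier] applies. *)
Lemma grad_oseenE k i j (t : R) x : 0 < t ->
  grad_oseen k i j t x = grad_oseen_fourier k i j t x.
Proof.
move=> t0; apply: derive_line; rewrite /oseen_kernel /grad_oseen_fourier.
pose f (h : R) (xi : 'rV[R]_n) := cos (dot (h *: delta_mx 0 k + x) xi) *
   expR (- (t * enorm xi ^+ 2)) * leray i j xi.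
pose f' (h : R) (xi : 'rV[R]_n) := - sin (dot (h *: delta_mx 0 k + x) xi) * xi 0 k *
   expR (- (t * enorm xi ^+ 2)) * leray i j xi.
have dotE (h : R) xi : dot (h *: delta_mx 0 k + x) xi = h * xi 0 k + dot x xi.
  rewrite /dot; under eq_bigr do rewrite !mxE mulrDl.
  rewrite big_split/=; congr (_ + _).
  rewrite (bigD1 k)//= eqxx mulr1 big1 ?addr0// => l /negbTE lk.
  by rewrite lk mulr0 mul0r.
have mdot h : measurable_fun setT (fun xi : 'rV[R]_n => dot (h *: delta_mx 0 k + x) xi).
  exact: measurable_fun_dot.
have fi h : mu.-integrable setT (EFin \o f h).
  rewrite (_ : f h = fun xi => (cos (dot (h *: delta_mx 0 k + x) xi) * leray i j xi) * expR (- (t * enorm xi ^+ 2))); last first.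
    by apply/funext => xi; rewrite /f mulrAC.
  apply: (@integrable_expR_enorm_bounded _ _ _ _ 2) => //.
    by apply: measurable_funM; [exact: measurable_fun_cos|exact: measurable_leray].
  move=> xi; rewrite normrM (@le_trans _ _ (1 * 2))//.
    by rewrite ler_pM// ?cos_max ?norm_leray.
  by rewrite mul1r lerDr mulr_ge0 ?enorm_ge0.
have df (h : R) xi : is_derive h (1 : R) (f ^~ xi) (f' h xi).
  rewrite /f /f'.
  have d1 : is_derive h (1 : R) (fun h => dot (h *: delta_mx 0 k + x) xi) (xi 0 k).
    apply: (is_derive_ext (is_derive_affine (dot x xi) (xi 0 k) h)) => // y.
    by rewrite dotE addrC.
  have d2 := is_derive1_comp (is_derive_cos _) d1.
  apply: (is_derive_ext (is_deriveZ (expR (- (t * enorm xi ^+ 2)) * leray i j xi) d2)).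
    move=> y; transitivity ((expR (- (t * enorm xi ^+ 2)) * leray i j xi) * cos (dot (y *: delta_mx 0 k + x) xi)) => //; ring.
  by rewrite /GRing.scale/=; ring.
have bf' h xi : `|f' h xi| <= (1 + enorm xi) * 2 * expR (- (t * enorm xi ^+ 2)).
  rewrite /f' !normrM (ger0_norm (expR_ge0 _)) mulrAC ler_wpM2r ?expR_ge0//.
  rewrite ler_pM ?mulr_ge0// ?norm_leray//.
  rewrite -[leRHS]mul1r ler_pM// ?normrN ?sin_max// ler_wpDl//.
  exact: ler_enorm.
have iG : mu.-integrable setT (EFin \o (fun xi : 'rV[R]_n => (1 + enorm xi) * 2 * expR (- (t * enorm xi ^+ 2)))).
  apply: (@integrable_expR_enorm_bounded _ _ _ _ 2) => //.
    by apply: measurable_funM => //; apply: measurable_funD => //; exact: measurable_enorm.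
  move=> xi; rewrite ger0_norm ?mulr_ge0 ?addr_ge0 ?enorm_ge0//.
  by rewrite mulrDl mul1r addrC (mulrC 2).
have := is_derive_under_integral 0 fi df bf' iG.
move=> d; apply: (is_derive_ext (is_deriveZ ((2 * pi) ^- n) d)) => //.
congr (_ *: _); apply: eq_Rintegral => xi _; rewrite /f' dotE mul0r add0r /oseen_symbol.
have -> : cos (pi / 2 + dot x xi) = - sin (dot x xi).
  by rewrite cosD cos_pihalf sin_pihalf mul0r mul1r sub0r.
ring.
Qed.

(** Joint measurability in time and space is clear for the Fourier integral but
    not for the directional derivative. *)
Lemma measurable_grad_oseen_fourier k i j :
  measurable_fun setT (fun z : mR * 'rV[R]_n => grad_oseen_fourier k i j z.1 z.2).
Proof.
apply: measurable_funM => //.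
apply: (@measurable_fun_Rintegral _ _ _ _ _ mu (fun z : (mR * 'rV[R]_n) * 'rV[R]_n =>
  oseen_symbol k i j z.1.1 z.2 * cos (pi / 2 + dot z.1.2 z.2))).
have m11 : measurable_fun setT (fun z : (mR * 'rV[R]_n) * 'rV[R]_n => z.1.1).
  exact: (measurableT_comp measurable_fst measurable_fst).
have m12 : measurable_fun setT (fun z : (mR * 'rV[R]_n) * 'rV[R]_n => z.1.2).
  exact: (measurableT_comp measurable_snd measurable_fst).
apply: measurable_funM; last first.
  by apply: measurable_fun_cos; apply: measurable_funD => //; exact: measurable_fun_dot.
apply: measurable_funM.
  exact: (measurableT_comp (measurable_oseen_symbol0 k i j) measurable_snd).
apply: measurable_fun_expR; apply: measurableT_comp => //; apply: measurable_funM => //.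
by apply: measurable_funX; exact: (measurableT_comp (@measurable_enorm R n) measurable_snd).
Qed.

(** Convolution with the heat kernel at time t multiplies the symbol at time s by
    exp(-t |xi|^2), which is the symbol at time t + s. *)
Lemma conv_grad_oseen k i j (t s : R) x : 0 < t -> 0 < s ->
  \int[mu]_y (heat_kernel t y * grad_oseen_fourier k i j s (x - y)) =
  grad_oseen_fourier k i j (t + s) x.
Proof.
move=> t0 s0; rewrite /grad_oseen_fourier.
under eq_Rintegral do rewrite mulrCA.
rewrite RintegralZl//; last first.
  pose M := \int[mu]_xi `|oseen_symbol k i j s xi|.
  apply: (@integrable_dominated _ _ _ _ _ (fun y => (heat_kernel t y * M)%:E)).
  - apply: measurable_funM; first exact: measurable_heat_kernel.
    apply: (@measurable_fun_Rintegral _ _ _ _ _ mu (fun z : 'rV[R]_n * 'rV[R]_n =>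
        oseen_symbol k i j s z.2 * cos (pi / 2 + dot (x - z.1) z.2))).
    have ms : measurable_fun setT (oseen_symbol k i j s).
      by have /integrableP[/measurable_EFinP] := integrable_oseen_symbol k i j s0.
    apply: measurable_funM; first exact: (measurableT_comp ms measurable_snd).
    apply: measurable_fun_cos; apply: measurable_funD => //; apply: measurable_fun_dot => //.
    exact: measurable_funB_rV.
  - by apply/measurable_EFinP; apply: measurable_funM => //; exact: measurable_heat_kernel.
  - move=> y; rewrite lee_fin normrM (ger0_norm (heat_kernel_ge0 _ _)).
    rewrite ler_wpM2l ?heat_kernel_ge0//.
    have is1 := integrable_oseen_symbol k i j s0.
    have ic : mu.-integrable setT (EFin \o (fun xi => oseen_symbol k i j s xi * cos (pi / 2 + dot (x - y) xi))).
      apply: (le_integrable _ _ _ is1) => //.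
        apply/measurable_EFinP; apply: measurable_funM.
          by have /integrableP[/measurable_EFinP] := is1.
        by apply: measurable_fun_cos; apply: measurable_funD => //; exact: measurable_fun_dot.
      by move=> xi _; rewrite /= lee_fin normrM ler_piMr// cos_max.
    apply: le_trans (le_normr_Rintegral _ ic) _ => //.
    apply: le_Rintegral => //; [exact: integrable_norm|exact: integrable_norm|].
    by move=> xi _; rewrite normrM ler_piMr// cos_max.
  - under eq_integral do rewrite EFinM.
    rewrite ge0_integralZr//.
    + by rewrite integral_heat_kernel// mul1e ltry.
    + by apply/measurable_EFinP; exact: measurable_heat_kernel.
    + by move=> y _; rewrite lee_fin heat_kernel_ge0.
    + by rewrite lee_fin; apply: Rintegral_ge0.
rewrite conv_fourier; [|exact: t0|exact: integrable_oseen_symbol].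
congr (_ * _); apply: eq_Rintegral => xi _; congr (_ * _).
by rewrite /oseen_symbol -mulrA -expRD -opprD -mulrDl (addrC s).
Qed.

Lemma heat_kernel_fourier (s : R) (x : 'rV[R]_n) : 0 < s ->
  heat_kernel s x = (4 * pi ^+ 2) `^ (- (n%:R / 2)) *
     \int[mu]_xi (expR (- (s * enorm xi ^+ 2)) * cos (0 + dot x xi)).
Proof.
move=> s0; have c0 : 0 < (4 * s)^-1 by rewrite invr_gt0 mulr_gt0.
under eq_Rintegral do rewrite heat_kernel_cst// -mulrA dotC.
rewrite RintegralZl//; last first.
  apply: integrable_heat_kernel_bounded => //; last by move=> y; exact: cos_max.
  by apply: measurable_fun_cos; apply: measurable_funD => //; exact: measurable_fun_dot.
rewrite heat_fourier// cos0 mulr1 mulrA /heat_kernel; congr (_ * expR (- _)); last first.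
  by rewrite mulrC.
have -> : (4 * pi ^+ 2) `^ (- (n%:R / 2)) =
    (4 * pi * s) `^ (- (n%:R / 2)) * (pi / s) `^ (- (n%:R / 2)).
  rewrite -powRM ?mulr_ge0 ?invr_ge0 ?pi_ge0 ?(ltW s0)//; congr powR.
  by field; rewrite gt_eqF.
rewrite -[RHS]mulrA.
by rewrite (powRN (pi / s)) mulVf ?mulr1// gt_eqF// powR_gt0// divr_gt0// pi_gt0.
Qed.

(** The semigroup identity is proved as in [conv_grad_oseen], after writing the
    heat kernel as the Fourier transform of a Gaussian. *)
Lemma conv_heat_kernel (t s : R) (x : 'rV[R]_n) : 0 < t -> 0 < s ->
  \int[mu]_y (heat_kernel t y * heat_kernel s (x - y)) = heat_kernel (t + s) x.
Proof.
move=> t0 s0; rewrite (heat_kernel_fourier x (addr_gt0 t0 s0)).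
have is1 : mu.-integrable setT (EFin \o (fun xi : 'rV[R]_n => expR (- (s * enorm xi ^+ 2)))).
  have := @integrable_expR_enorm_bounded R n s (cst 1) 1 s0.
  under [X in _ -> _ -> _.-integrable _ (_ \o X)]eq_fun do rewrite mul1r.
  apply => //.
  by move=> y; rewrite normr1 mul1r lerDr enorm_ge0.
under eq_Rintegral do rewrite (heat_kernel_fourier _ s0) mulrCA.
rewrite RintegralZl//; last first.
  apply: (@le_integrable _ _ _ _ _ measurableT _ (EFin \o (fun y => (4 * pi ^+ 2) `^ (n%:R / 2) * (heat_kernel t y * (4 * pi * s) `^ (- (n%:R / 2)))))).
  - apply/measurable_EFinP; apply: measurable_funM; first exact: measurable_heat_kernel.
    apply: (@measurable_fun_Rintegral _ _ _ _ _ mu (fun z : 'rV[R]_n * 'rV[R]_n =>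
        expR (- (s * enorm z.2 ^+ 2)) * cos (0 + dot (x - z.1) z.2))).
    apply: measurable_funM; first exact: (measurableT_comp (@measurable_expR_enorm R n s) measurable_snd).
    apply: measurable_fun_cos; apply: measurable_funD => //; apply: measurable_fun_dot => //.
    exact: measurable_funB_rV.
  - move=> y _; rewrite /= lee_fin.
    have p0 : 0 < (4 * pi ^+ 2) `^ (n%:R / 2) :> R by rewrite powR_gt0// mulr_gt0 ?exprn_gt0 ?pi_gt0.
    have -> : \int[mu]_xi (expR (- (s * enorm xi ^+ 2)) * cos (0 + dot (x - y) xi)) =
      (4 * pi ^+ 2) `^ (n%:R / 2) * heat_kernel s (x - y).
      by rewrite (heat_kernel_fourier _ s0) powRN mulrA mulfV ?mul1r ?gt_eqF.
    rewrite mulrCA !normrM ler_wpM2l//  ler_wpM2l//.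
    rewrite (ger0_norm (powR_ge0 _ _)) (ger0_norm (expR_ge0 _)) ler_piMr ?powR_ge0//.
    by rewrite -expR0 ler_expR oppr_le0 divr_ge0 ?sqr_ge0 ?mulr_ge0 ?(ltW s0).
  - apply: integrable_RZl; under eq_fun do rewrite mulrC.
    apply: integrable_RZl.
    have := @integrable_heat_kernel_bounded R n t (cst 1) t0.
    under [X in _ -> _ -> _.-integrable _ (_ \o X)]eq_fun do rewrite mulr1.
    by apply => // y; rewrite normr1.
rewrite conv_fourier//.
congr (_ * _); apply: eq_Rintegral => xi _; congr (_ * _).
by rewrite -expRD -opprD -mulrDl (addrC s).
Qed.

End kernels.

(** * Rearrangements *)

Section indicators.
Context {R : realType}.
Local Notation mR := (measurableTypeR R).
Local Notation leb := (@lebesgue_measure R).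

(** Indicators of boolean conditions with extended real values: multiplying by
    them replaces restrictions of the domain of integration. *)
Definition ind (b : bool) : \bar R := (b%:R)%:E.

Lemma ind_ge0 b : 0 <= ind b. Proof. by rewrite lee_fin ler0n. Qed.

Lemma measurable_ind d (T : measurableType d) (b : T -> bool) :
  measurable_fun setT b -> measurable_fun setT (fun x => ind (b x)).
Proof.
move=> mb; rewrite (_ : (fun _ => _) = fun x => if b x then 1 else 0).
  by apply: measurable_fun_ifT.
by apply/funext => x; rewrite /ind; case: (b x).
Qed.

Lemma measurable_bool_set d (T : measurableType d) (b : T -> bool) :
  measurable_fun setT b -> measurable [set x | b x].
Proof.
move=> mb; rewrite (_ : [set x | b x] = setT `&` b @^-1` [set true]).
  exact: mb.
by apply/seteqP; split => x //= [].
Qed.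

Lemma integral_ind d (T : measurableType d) (mu : {measure set T -> \bar R}) (b : T -> bool) :
  measurable_fun setT b -> \int[mu]_x ind (b x) = mu [set x | b x].
Proof.
move=> mb.
have mB := measurable_bool_set mb.
rewrite -[in RHS](setIT [set x | b x]) -integral_indic//.
by apply: eq_integral => x _; rewrite indicE mem_setE.
Qed.

(** The layer-cake formula for one number. *)
Lemma ind_layer (e : \bar R) : 0 <= e ->
  \int[leb]_t ind ((0 < t)%R && (t%:E < e)) = e.
Proof.
move=> e0; rewrite integral_ind; last first.
  apply: measurable_and; first exact: measurable_fun_ltr.
  by apply: measurable_fun_lte => //; exact: EFin_measurable.
case: e e0 => [r r0| _|//].
  have -> : [set x | ((0 < x)%R && (x%:E < r%:E))] = `]0%R, r[%classic.
    by apply/seteqP; split => x /=; rewrite in_itv/= lte_fin.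
  rewrite /= lebesgue_measure_itv/= lte_fin; case: ltP => [_|]; first by rewrite oppr0 adde0.
  by move=> h; congr EFin; apply/eqP; rewrite eq_le h andbT -lee_fin.
have -> : [set x : R | ((0 < x)%R && (x%:E < +oo))] = `]0%R, +oo[%classic.
  by apply/seteqP; split => x /=; rewrite in_itv/= ltry ?andbT.
by rewrite /= lebesgue_measure_itv/= ltry.
Qed.

End indicators.

Section rearrangement.
Context {R : realType} (n : nat).
Local Notation mR := (measurableTypeR R).
Local Notation leb := (@lebesgue_measure R).
Local Notation mu := (@lebesgue_rV R n).
Implicit Types g h : 'rV[R]_n -> R.

Lemma measurable_gt_norm g : measurable_fun setT g ->
  measurable_fun setT (fun z : mR * 'rV[R]_n => (z.1 < `|g z.2|)%R).
Proof.
move=> mg; apply: measurable_fun_ltr; first exact: measurable_fst.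
by apply: measurableT_comp => //; exact: (measurableT_comp mg measurable_snd).
Qed.

Lemma distr_funE g y : measurable_fun setT g ->
  distr_fun g y = \int[mu]_x ind (y < `|g x|)%R.
Proof.
move=> mg; rewrite integral_ind//.
by apply: measurable_fun_ltr => //; exact: measurableT_comp.
Qed.

Lemma measurable_distr_fun g : measurable_fun setT g ->
  measurable_fun setT (distr_fun g : mR -> _).
Proof.
move=> mg; rewrite (_ : distr_fun g = fun y => \int[mu]_x ind (y < `|g x|)%R); last first.
  by apply/funext => y; rewrite distr_funE.
apply: (@measurable_fun_fubini_tonelli_F _ _ _ _ _ mu (fun z : mR * 'rV[R]_n => ind (z.1 < `|g z.2|)%R)).
  by apply: measurable_ind; exact: measurable_gt_norm.
by move=> z; exact: ind_ge0.
Qed.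

Lemma measurable_superlevel g y : measurable_fun setT g ->
  measurable [set x | (y < `|g x|)%R].
Proof.
move=> mg; apply: measurable_bool_set.
by apply: measurable_fun_ltr => //; exact: measurableT_comp.
Qed.

Lemma distr_fun_ge0 g y : 0 <= distr_fun g y.
Proof. exact: measure_ge0. Qed.

Lemma le_distr_fun g y z : measurable_fun setT g -> (y <= z)%R ->
  distr_fun g z <= distr_fun g y.
Proof.
move=> mg yz; apply: le_measure; rewrite ?inE; try exact: measurable_superlevel.
by move=> x /=; exact: le_lt_trans.
Qed.

Lemma rearr_ge0 g t : 0 <= rearr g t.
Proof. by apply: ereal_sup_ubound; left. Qed.

Lemma le_rearr g t y : (0 < y)%R -> t%:E < distr_fun g y -> y%:E <= rearr g t.
Proof. by move=> y0 ty; apply: ereal_sup_ubound; right; exists y. Qed.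

(** Together with [le_rearr] this says that [rearr g] is the generalised inverse
    of [distr_fun g]. *)
Lemma lt_rearr g t y : measurable_fun setT g -> (0 <= y)%R ->
  y%:E < rearr g t -> t%:E < distr_fun g y.
Proof.
move=> mg y0 /ereal_sup_gt[_ [->|[z [z0 tz] <-]]]; rewrite lte_fin.
  by rewrite ltNge y0.
by move=> yz; apply: lt_le_trans tz _; exact: le_distr_fun (ltW yz).
Qed.

Lemma measurable_layer g : measurable_fun setT g ->
  measurable_fun setT (fun z : mR * mR => (0 < z.2)%R && (z.1%:E < distr_fun g z.2)).
Proof.
move=> mg; apply: measurable_and; first exact: measurable_fun_ltr.
apply: measurable_fun_lte.
  by apply/measurable_EFinP; exact: measurable_fst.
exact: (measurableT_comp (measurable_distr_fun mg) measurable_snd).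
Qed.

(** The set of heights y with t < d(y) is an interval starting at 0, so its length
    is its supremum.  In this form rearrangements enter Tonelli's theorem. *)
Lemma rearrE g t : measurable_fun setT g ->
  rearr g t = \int[leb]_y ind ((0 < y)%R && (t%:E < distr_fun g y)).
Proof.
move=> mg.
have ml : measurable_fun setT (fun y : mR => (0 < y)%R && (t%:E < distr_fun g y)).
  exact: (measurableT_comp (measurable_layer mg) (pair1_measurable (t : mR))).
apply/eqP; rewrite eq_le; apply/andP; split.
  rewrite -[leLHS](ind_layer (rearr_ge0 g t)); apply: ge0_le_integral => //.
  - by move=> y _; exact: ind_ge0.
  - apply: measurable_ind; apply: measurable_and; first exact: measurable_fun_ltr.
    by apply: measurable_fun_lte => //; exact: EFin_measurable.
  - exact: measurable_ind.
  - move=> y _; rewrite lee_fin ler_nat; case: (ltP 0%R y) => //= y0.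
    case: (ltP y%:E) => //= yr; rewrite (lt_rearr mg (ltW y0) yr)//.
have -> : rearr g t = leb [set y | (0 < y)%R && (y%:E <= rearr g t)].
  have := rearr_ge0 g t; case: (rearr g t) => [r r0| _|//].
    have -> : [set x | ((0 < x)%R && (x%:E <= r%:E))] = `]0%R, r]%classic.
      by apply/seteqP; split => x /=; rewrite in_itv/= lee_fin.
    rewrite /= lebesgue_measure_itv/= lte_fin; case: ltP => [_|]; first by rewrite oppr0 adde0.
    by move=> h; congr EFin; apply/eqP; rewrite eq_le h -lee_fin.
  have -> : [set x : R | ((0 < x)%R && (x%:E <= +oo))] = `]0%R, +oo[%classic.
    by apply/seteqP; split => x /=; rewrite in_itv/= leey ?andbT.
  by rewrite /= lebesgue_measure_itv/= ltry.
have m2 : measurable_fun setT (fun y : mR => (0 < y)%R && (y%:E <= rearr g t)).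
  apply: measurable_and; first exact: measurable_fun_ltr.
  by apply: measurable_fun_lee => //; exact: EFin_measurable.
rewrite -integral_ind//; apply: ge0_le_integral => //.
- by move=> y _; exact: ind_ge0.
- exact: measurable_ind.
- exact: measurable_ind.
- move=> y _; rewrite lee_fin ler_nat; case: (ltP 0%R y) => //= y0.
  by case: (ltP t%:E) => //= ty; rewrite le_rearr.
Qed.

Lemma measurable_rearr g : measurable_fun setT g ->
  measurable_fun setT (rearr g : mR -> _).
Proof.
move=> mg; rewrite (_ : rearr g = fun t => \int[leb]_y ind ((0 < y)%R && (t%:E < distr_fun g y))); last first.
  by apply/funext => t; rewrite rearrE.
apply: (@measurable_fun_fubini_tonelli_F _ _ _ _ _ leb (fun z : mR * mR => ind ((0 < z.2)%R && (z.1%:E < distr_fun g z.2)))).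
  by apply: measurable_ind; exact: measurable_layer.
by move=> z; exact: ind_ge0.
Qed.

Lemma le_rearr_anti g s t : measurable_fun setT g -> (s <= t)%R -> rearr g t <= rearr g s.
Proof.
move=> mg st; apply: ge_ereal_sup => _ [->|[y [y0 ty] <-]]; first exact: rearr_ge0.
by apply: le_rearr => //; apply: le_lt_trans ty; rewrite lee_fin.
Qed.

(** Among the functions with a given rearrangement, the integral over a set of
    given measure is largest when the largest values sit on that set. *)
Lemma integral_set_le_rearr g (F : 'rV[R]_n -> bool) : measurable_fun setT g ->
  measurable_fun setT F ->
  \int[mu]_x (ind (F x) * `|g x|%:E) <=
  \int[leb]_t (ind ((0 < t)%R && (t%:E < mu [set x | F x])) * rearr g t).
Proof.
move=> mg mF.
pose E := mu [set x | F x].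
have mlt : measurable_fun setT (fun z : 'rV[R]_n * mR => (z.2 < `|g z.1|)%R).
  exact: (measurableT_comp (measurable_gt_norm mg) (@measurable_swap _ _ _ _)).
have mb : measurable_fun setT (fun z : 'rV[R]_n * mR =>
    F z.1 && ((0 < z.2)%R && (z.2 < `|g z.1|)%R)).
  apply: measurable_and; first exact: (measurableT_comp mF measurable_fst).
  apply: measurable_and; [exact: measurable_fun_ltr|exact: mlt].
have -> : \int[mu]_x (ind (F x) * `|g x|%:E) =
    \int[mu]_x \int[leb]_y ind (F x && ((0 < y)%R && (y < `|g x|)%R)).
  apply: eq_integral => x _; case: (F x) => /=.
    by rewrite mul1e -[LHS]ind_layer ?lee_fin//.
  by rewrite mul0e integral0.
rewrite (@fubini_tonelli _ _ _ _ _ mu leb (fun z => ind (F z.1 && ((0 < z.2)%R && (z.2 < `|g z.1|)%R))))//;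
  [|exact: measurable_ind|by move=> z; exact: ind_ge0].
have mc : measurable_fun setT (fun z : mR * mR =>
    ((0 < z.2)%R && (z.2%:E < E)) && ((0 < z.1)%R && (z.2%:E < distr_fun g z.1))).
  apply: measurable_and; last exact: (measurableT_comp (measurable_layer mg) (@measurable_swap _ _ _ _)).
  apply: measurable_and; first exact: measurable_fun_ltr.
  by apply: measurable_fun_lte => //; apply/measurable_EFinP; exact: measurable_snd.
apply: (@le_trans _ _ (\int[leb]_y \int[leb]_t
    ind (((0 < t)%R && (t%:E < E)) && ((0 < y)%R && (t%:E < distr_fun g y))))).
  apply: ge0_le_integral => //.
  - by move=> y _; apply: integral_ge0 => x _; exact: ind_ge0.
  - apply: (@measurable_fun_fubini_tonelli_G _ _ _ _ _ mu (fun z : 'rV[R]_n * mR => ind (F z.1 && ((0 < z.2)%R && (z.2 < `|g z.1|)%R)))).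
      exact: measurable_ind.
    by move=> z; exact: ind_ge0.
  - apply: (@measurable_fun_fubini_tonelli_F _ _ _ _ _ leb (fun z : mR * mR =>
      ind (((0 < z.2)%R && (z.2%:E < E)) && ((0 < z.1)%R && (z.2%:E < distr_fun g z.1))))).
      exact: measurable_ind.
    by move=> z; exact: ind_ge0.
  - move=> y _; rewrite /=.
    have [y0|y0] := ltP 0%R y; last first.
      rewrite (eq_integral (cst 0)) ?integral_cst// ?mul0e; last by move=> x _; rewrite andbF.
      by apply: integral_ge0 => t _; exact: ind_ge0.
    rewrite /= integral_ind; last first.
      apply: measurable_and => //.
      by apply: measurable_fun_ltr => //; exact: measurableT_comp.
    set e := (X in X <= _); have e0 : 0 <= e by exact: measure_ge0.
    rewrite -[leLHS](ind_layer e0); apply: ge0_le_integral => //.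
    + by move=> t _; exact: ind_ge0.
    + apply: measurable_ind; apply: measurable_and; first exact: measurable_fun_ltr.
      by apply: measurable_fun_lte => //; exact: EFin_measurable.
    + apply: measurable_ind; apply: measurable_and; first apply: measurable_and.
      * exact: measurable_fun_ltr.
      * by apply: measurable_fun_lte => //; exact: EFin_measurable.
      * by apply: measurable_fun_lte => //; exact: EFin_measurable.
    + move=> t _; rewrite lee_fin ler_nat; case: (ltP 0%R t) => //= t0.
      case: (ltP t%:E e) => //= te.
      have mFs := measurable_bool_set mF.
      have ms := measurable_superlevel y mg.
      have me : measurable [set x | F x && (y < `|g x|)%R].
        rewrite (_ : [set x | _] = [set x | F x] `&` [set x | (y < `|g x|)%R]); last first.
          by apply/seteqP; split => x /= /andP.
        exact: measurableI.
      have -> : t%:E < E.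
        by apply: lt_le_trans te _; apply: le_measure; rewrite ?inE// => x /= /andP[].
      suff -> : t%:E < distr_fun g y by [].
      by apply: lt_le_trans te _; apply: le_measure; rewrite ?inE// => x /= /andP[].
rewrite (@fubini_tonelli _ _ _ _ _ leb leb (fun z : mR * mR =>
      ind (((0 < z.2)%R && (z.2%:E < E)) && ((0 < z.1)%R && (z.2%:E < distr_fun g z.1)))))//;
  [|exact: measurable_ind|by move=> z; exact: ind_ge0].
rewrite le_eqVlt; apply/orP; left; apply/eqP; apply: eq_integral => t _ /=.
rewrite rearrE// -/E; case: (_ && (t%:E < E)) => /=; first by rewrite mul1e.
by rewrite mul0e integral0.
Qed.

(** The layer-cake formula for h reduces the claim to the indicators of its
    superlevel sets, which is [integral_set_le_rearr]. *)
Lemma hardy_littlewood g h : measurable_fun setT g -> measurable_fun setT h ->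
  (forall x, 0 <= h x)%R ->
  \int[mu]_x (h x * `|g x|)%:E <=
  \int[leb]_t (ind (0 < t)%R * (rearr h t * rearr g t)).
Proof.
move=> mg mh h0.
have mgE : measurable_fun setT (fun x => `|g x|%:E).
  by apply/measurable_EFinP; exact: measurableT_comp.
have mb : measurable_fun setT (fun z : 'rV[R]_n * mR => (0 < z.2)%R && (z.2 < `|h z.1|)%R).
  apply: measurable_and; first exact: measurable_fun_ltr.
  exact: (measurableT_comp (measurable_gt_norm mh) (@measurable_swap _ _ _ _)).
have mf : measurable_fun setT (fun z : 'rV[R]_n * mR =>
    ind ((0 < z.2)%R && (z.2 < `|h z.1|)%R) * `|g z.1|%:E).
  apply: emeasurable_funM; first exact: measurable_ind.
  exact: (measurableT_comp mgE measurable_fst).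
have -> : \int[mu]_x (h x * `|g x|)%:E =
    \int[mu]_x \int[leb]_y (ind ((0 < y)%R && (y < `|h x|)%R) * `|g x|%:E).
  apply: eq_integral => x _; rewrite ge0_integralZr//.
  - rewrite EFinM -{1}(ger0_norm (h0 x)); congr (_ * _).
    by rewrite -[LHS]ind_layer ?lee_fin.
  - apply: measurable_ind; apply: measurable_and; exact: measurable_fun_ltr.
  - by move=> y _; exact: ind_ge0.
rewrite (@fubini_tonelli _ _ _ _ _ mu leb (fun z => ind ((0 < z.2)%R && (z.2 < `|h z.1|)%R) * `|g z.1|%:E))//;
  last by move=> z; rewrite mule_ge0// ?ind_ge0// lee_fin.
have mc : measurable_fun setT (fun z : mR * mR =>
    ind ((0 < z.1)%R && ((0 < z.2)%R && (z.2%:E < distr_fun h z.1))) * rearr g z.2).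
  apply: emeasurable_funM; last exact: (measurableT_comp (measurable_rearr mg) measurable_snd).
  apply: measurable_ind; apply: measurable_and; first exact: measurable_fun_ltr.
  apply: measurable_and; first exact: measurable_fun_ltr.
  apply: measurable_fun_lte; first by apply/measurable_EFinP; exact: measurable_snd.
  exact: (measurableT_comp (measurable_distr_fun mh) measurable_fst).
apply: (@le_trans _ _ (\int[leb]_y \int[leb]_t
    (ind ((0 < y)%R && ((0 < t)%R && (t%:E < distr_fun h y))) * rearr g t))).
  apply: ge0_le_integral => //.
  - by move=> y _; apply: integral_ge0 => x _; rewrite mule_ge0// ?ind_ge0// lee_fin.
  - apply: (@measurable_fun_fubini_tonelli_G _ _ _ _ _ mu (fun z : 'rV[R]_n * mR => ind ((0 < z.2)%R && (z.2 < `|h z.1|)%R) * `|g z.1|%:E)) => //.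
    by move=> z; rewrite mule_ge0// ?ind_ge0// lee_fin.
  - apply: (@measurable_fun_fubini_tonelli_F _ _ _ _ _ leb (fun z : mR * mR =>
    ind ((0 < z.1)%R && ((0 < z.2)%R && (z.2%:E < distr_fun h z.1))) * rearr g z.2)) => //.
    by move=> z; rewrite mule_ge0// ?ind_ge0// rearr_ge0.
  - move=> y _; have [y0|y0] /= := ltP 0%R y; last first.
      rewrite (eq_integral (cst 0)) ?integral_cst// ?mul0e; last by move=> x _; rewrite mul0e.
      by apply: integral_ge0 => t _; rewrite mul0e.
    apply: integral_set_le_rearr => //.
    by apply: measurable_fun_ltr => //; exact: measurableT_comp.
rewrite (@fubini_tonelli _ _ _ _ _ leb leb (fun z : mR * mR =>
    ind ((0 < z.1)%R && ((0 < z.2)%R && (z.2%:E < distr_fun h z.1))) * rearr g z.2))//;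
  last by move=> z; rewrite mule_ge0// ?ind_ge0// rearr_ge0.
rewrite le_eqVlt; apply/orP; left; apply/eqP; apply: eq_integral => t _ /=.
have [t0|t0] /= := ltP 0%R t; last first.
  rewrite mul0e (eq_integral (cst 0)) ?integral_cst// ?mul0e// => y _.
  by rewrite andbF mul0e.
rewrite mul1e ge0_integralZr ?rearr_ge0//; first by rewrite -rearrE.
by apply: measurable_ind; exact: (measurableT_comp (measurable_layer mh) (pair1_measurable (t : mR))).
by move=> y _; exact: ind_ge0.
Qed.

End rearrangement.

(** * Time integrals with two singularities *)

Section time_integrals.
Context {R : realType}.
Local Notation mR := (measurableTypeR R).
Local Notation leb := (@lebesgue_measure R).

Lemma measurable_powRl (c : R) : measurable_fun setT (fun s : mR => s `^ c)%R.
Proof. exact: measurable_powR. Qed.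

Lemma measurable_oc (t : R) : measurable_fun setT (fun s : mR => (0 < s <= t)%R).
Proof. by apply: measurable_and; [exact: measurable_fun_ltr|exact: measurable_fun_ler]. Qed.

Lemma measurable_oo (t : R) : measurable_fun setT (fun s : mR => (0 < s < t)%R).
Proof. by apply: measurable_and; exact: measurable_fun_ltr. Qed.

(** The fundamental theorem of calculus away from the singularity at 0, and
    monotone convergence. *)
Lemma integral_powR01 (c : R) : (0 < c)%R ->
  \int[leb]_s (ind (0 < s <= 1)%R * (s `^ (c - 1))%:E) = (c^-1)%:E.
Proof.
move=> c0.
pose f (k : nat) (s : R) : \bar R := ind (k.+1%:R^-1 <= s <= 1)%R * (s `^ (c - 1))%:E.
have k0 (k : nat) : (0 < k.+1%:R^-1 :> R)%R by rewrite invr_gt0.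
have mf k : measurable_fun setT (f k : mR -> _).
  apply: emeasurable_funM; last by apply/measurable_EFinP; exact: measurable_powRl.
  by apply: measurable_ind; apply: measurable_and; exact: measurable_fun_ler.
have f0 k s : 0 <= f k s by rewrite mule_ge0 ?ind_ge0// lee_fin powR_ge0.
have ndf s : nondecreasing_seq (f ^~ s).
  move=> k m km; rewrite /f lee_wpmul2r ?lee_fin ?powR_ge0// ler_nat.
  case: (lerP k.+1%:R^-1 s) => //= ks.
  by rewrite (le_trans _ ks)// lef_pV2 ?posrE// ler_nat ltnS.
have flim s : f ^~ s @ \oo --> ind (0 < s <= 1)%R * (s `^ (c - 1))%:E.
  have [s0|s0] := ltP 0%R s.
    have hs : \forall k \near \oo, (k.+1%:R^-1 <= s)%R.
      have [N _ hN] := near_infty_natSinv_lt (PosNum s0).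
      by exists N => // k Nk; apply: ltW; exact: hN.
    by apply: cvg_near_cst; apply: filterS hs => k ks; rewrite /f ks.
  apply: cvg_near_cst; apply: nearW => k; rewrite /f.
  by have -> : (k.+1%:R^-1 <= s)%R = false by apply/negbTE; rewrite -ltNge (le_lt_trans s0).
have fint k : \int[leb]_s f k s = ((1 - (k.+1%:R^-1) `^ c) / c)%:E.
  have [k1|k1] := leP 1%N k; last first.
    have -> : k = 0%N by case: k k1.
    rewrite invr1 powR1 subrr mul0r (_ : \int[leb]_s f 0%N s = \int[leb]_(s in [set (1 : R)%R]) (1 : \bar R)).
      by rewrite integral_set1.
    rewrite [RHS]integral_mkcond; apply: eq_integral => s _; rewrite /f invr1 -eq_le eq_sym.
    rewrite patchE in_set1 /ind; case: eqP => [->|]; last by rewrite mul0e.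
    by rewrite powR1 mul1e.
  have kl : (k.+1%:R^-1 < 1 :> R)%R by rewrite invf_lt1// ltr1n ltnS.
  transitivity (\int[leb]_(s in [set` `[(k.+1%:R^-1)%R, 1%R]]) (s `^ (c - 1))%:E).
    rewrite [RHS]integral_mkcond; apply: eq_integral => s _; rewrite patchE /f mem_setE in_itv/=.
    by rewrite /ind; case: ifPn => _; rewrite ?mul1e ?mul0e.
  have dF (x : R) : (0 < x)%R -> is_derive x (1%R : R) (fun s => s `^ c / c)%R (x `^ (c - 1))%R.
    move=> x0.
    have d1 := is_derive1_powR c x0.
    apply: (is_derive_ext (is_deriveZ (c^-1)%R d1)).
      by move=> y; rewrite [RHS]mulrC.
    by rewrite /GRing.scale/= mulKf// gt_eqF.
  have cF (x : R) : (0 < x)%R -> {for x, continuous (fun s => s `^ c / c)%R}.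
    by move=> x0; apply/differentiable_continuous/derivable1_diffP; have [] := dF x x0.
  rewrite (@continuous_FTC2 _ _ (fun s => s `^ c / c)%R)//.
  - by rewrite powR1 -EFinB -mulrBl.
  - apply: continuous_in_subspaceT => x; rewrite inE/= in_itv/= => /andP[kx _].
    have x0 : (0 < x)%R by exact: lt_le_trans kx.
    apply/differentiable_continuous/derivable1_diffP.
    by have [] := is_derive1_powR (c - 1)%R x0.
  - split.
    + move=> x; rewrite in_itv/= => /andP[kx _].
      by have [] := dF x (lt_trans (k0 k) kx).
    + exact: cvg_at_right_filter (cF _ _).
    + exact: cvg_at_left_filter (cF _ _).
  - move=> x; rewrite in_itv/= => /andP[kx _]; rewrite derive1E.
    by have [_ ->] := dF x (lt_trans (k0 k) kx).
have c1 := cvg_monotone_convergence (mu := leb) measurableT mf (fun k s _ => f0 k s)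
   (fun s _ => ndf s).
have {c1} : \int[leb]_s f k s @[k --> \oo] --> \int[leb]_s (ind (0 < s <= 1)%R * (s `^ (c - 1))%:E).
  rewrite (_ : \int[leb]_s (_ * _) = \int[leb]_x limn (f ^~ x)); first exact: c1.
  by apply: eq_integral => s _; apply/esym/cvg_lim => //; exact: flim.
under eq_fun do rewrite fint.
move=> c1.
have c2 : ((1 - (k.+1%:R^-1) `^ c) / c)%:E @[k --> \oo] --> (c^-1)%:E.
  apply: cvg_EFin; first exact: nearW.
  rewrite -[X in _ --> X]mul1r; apply: cvgM; last exact: cvg_cst.
  rewrite -[X in _ --> X]subr0; apply: cvgB; first exact: cvg_cst.
  apply/cvgr0Pnorm_lt => e e0.
  have ec0 : (0 < e `^ c^-1)%R by rewrite powR_gt0.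
  have [N _ hN] := near_infty_natSinv_lt (PosNum ec0).
  exists N => // k Nk /=; rewrite ger0_norm ?powR_ge0//.
  have -> : e = ((e `^ c^-1) `^ c)%R by rewrite -powRrM mulVf ?gt_eqF// powRr1 ?ltW.
  by rewrite gt0_ltr_powR ?nnegrE ?powR_ge0 ?(ltW (k0 k))//; exact: hN.
exact: (cvg_unique _ c1 c2).
Qed.


Lemma integral_powR0t (c t : R) : (0 < c)%R -> (0 < t)%R ->
  \int[leb]_s (ind (0 < s <= t)%R * (s `^ (c - 1))%:E) = (t `^ c / c)%:E.
Proof.
move=> c0 t0; rewrite (@ge0_integral_affine _ t 0%R _ t0); last 2 first.
- apply: emeasurable_funM; last by apply/measurable_EFinP; exact: measurable_powRl.
  by apply: measurable_ind; exact: measurable_oc.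
- by move=> s; rewrite mule_ge0 ?ind_ge0// lee_fin powR_ge0.
transitivity (t%:E * \int[leb]_s ((t `^ (c - 1))%:E * (ind (0 < s <= 1)%R * (s `^ (c - 1))%:E))).
  congr (_ * _); apply: eq_integral => s _.
  rewrite addr0 pmulr_rgt0// -[X in (_ <= X)%R](mulr1 t) ler_pM2l//.
  case: (ltP 0%R s) => s0 /=; last by rewrite !mul0e mule0.
  by rewrite powRM ?(ltW t0) ?(ltW s0)// EFinM muleCA.
rewrite ge0_integralZl//.
- rewrite integral_powR01// -!EFinM mulrA; congr (_ / _)%:E.
  rewrite -[X in (X * _)%R](powRr1 (ltW t0)) -powRD; first by congr powR; ring.
  by apply/implyP => _; rewrite gt_eqF.
- apply: emeasurable_funM; last by apply/measurable_EFinP; exact: measurable_powRl.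
  by apply: measurable_ind; exact: measurable_oc.
- by move=> s _; rewrite mule_ge0 ?ind_ge0// lee_fin powR_ge0.
- by rewrite lee_fin powR_ge0.
Qed.

(** Euler's Beta integral, with exponents parametrised as the singularities *)
Definition betaI (d c : R) : \bar R :=
  \int[leb]_s (ind (0 < s < 1)%R * ((1 - s) `^ (- d) * s `^ (- c))%:E).

Lemma measurable_kernel_time (d c t : R) :
  measurable_fun setT (fun s : mR => ind (0 < s < t)%R * ((t - s) `^ (- d) * s `^ (- c))%:E).
Proof.
apply: emeasurable_funM; first by apply: measurable_ind; exact: measurable_oo.
apply/measurable_EFinP; apply: measurable_funM; last exact: measurable_powRl.
apply: (measurableT_comp (measurable_powRl _)); exact: measurable_funB.
Qed.

Lemma ge0_kernel_time (d c t s : R) :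
  0 <= ind (0 < s < t)%R * ((t - s) `^ (- d) * s `^ (- c))%:E.
Proof. by rewrite mule_ge0 ?ind_ge0// lee_fin mulr_ge0 ?powR_ge0. Qed.

Lemma betaI_ge0 d c : 0 <= betaI d c.
Proof. by apply: integral_ge0 => s _; exact: ge0_kernel_time. Qed.

Lemma powRN_le_half (d x : R) : (0 <= d)%R -> (2^-1 <= x)%R -> (x `^ (- d) <= 2 `^ d)%R.
Proof.
move=> d0 x2; have x0 : (0 < x)%R by rewrite (lt_le_trans _ x2)// invr_gt0.
rewrite powRN -[leLHS]mul1r ler_pdivrMr ?powR_gt0// -powRM ?(ltW x0)//.
apply: (@le_trans _ _ (1 `^ d)%R); first by rewrite powR1.
rewrite ge0_ler_powR// ?nnegrE ?mulr_ge0 ?(ltW x0)//; lra.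
Qed.

(** Each of the two singularities is integrable on its own half of the interval,
    where the other factor is bounded. *)
Lemma betaI_lty d c : (0 <= d < 1)%R -> (0 <= c < 1)%R -> betaI d c < +oo.
Proof.
move=> /andP[d0 d1] /andP[c0 c1].
pose g (e : R) (s : R) : \bar R := ind (0 < s <= 1)%R * (s `^ ((1 - e) - 1))%:E.
have mg e : measurable_fun setT (g e : mR -> _).
  apply: emeasurable_funM; last by apply/measurable_EFinP; exact: measurable_powRl.
  by apply: measurable_ind; exact: measurable_oc.
have g0 e s : 0 <= g e s by rewrite mule_ge0 ?ind_ge0// lee_fin powR_ge0.
have mgr e : measurable_fun setT (fun s : mR => g e (1 - s)%R).
  by apply: (measurableT_comp (mg e)); exact: measurable_funB.
have b0 : (0 <= 2 `^ d :> R)%R by exact: powR_ge0.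
have b1 : (0 <= 2 `^ c :> R)%R by exact: powR_ge0.
have G0 s : 0 <= (2 `^ d)%:E * g c s + (2 `^ c)%:E * g d (1 - s)%R.
  by rewrite adde_ge0// mule_ge0.
apply: (@le_lt_trans _ _ (\int[leb]_s ((2 `^ d)%:E * g c s + (2 `^ c)%:E * g d (1 - s)%R))).
  apply: ge0_le_integral => //.
  - by move=> s _; exact: ge0_kernel_time.
  - exact: measurable_kernel_time.
  - by apply: emeasurable_funD; exact: measurable_funeM.
  - move=> s _; case: (ltP 0%R s) => s0 /=; last by rewrite mul0e G0.
    case: (ltP s 1%R) => s1 /=; last by rewrite mul0e G0.
    rewrite mul1e; have [sh|sh] := leP s (2^-1)%R.
      apply: le_trans (leeDl _ _); last by rewrite mule_ge0.
      rewrite /g s0 (ltW s1) mul1e lee_fin (_ : 1 - c - 1 = - c)%R; last by lra.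
      by rewrite ler_wpM2r ?powR_ge0// powRN_le_half//; lra.
    apply: le_trans (leeDr _ _); last by rewrite mule_ge0.
    rewrite /g (_ : 0 < 1 - s <= 1)%R; last by apply/andP; split; lra.
    rewrite mul1e lee_fin (_ : 1 - d - 1 = - d)%R; last by lra.
    by rewrite mulrC ler_wpM2r ?powR_ge0// powRN_le_half//; lra.
rewrite ge0_integralD//; last 4 first.
- by move=> s _; rewrite mule_ge0.
- exact: measurable_funeM.
- by move=> s _; rewrite mule_ge0.
- exact: measurable_funeM.
rewrite !ge0_integralZl//.
rewrite (@ge0_integral_reflect _ 1%R (g d))// /g !integral_powR01 ?subr_gt0//.
by rewrite -!EFinM -EFinD ltry.
Qed.

(** The substitution s = t s' brings the time integral to the unit interval. *)
Lemma kernel_time_scale (d c t : R) : (0 < t)%R ->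
  \int[leb]_s (ind (0 < s < t)%R * ((t - s) `^ (- d) * s `^ (- c))%:E) =
  (t `^ (1 - d - c))%:E * betaI d c.
Proof.
move=> t0; rewrite (@ge0_integral_affine _ t 0%R _ t0); last 2 first.
- exact: measurable_kernel_time.
- by move=> s; exact: ge0_kernel_time.
rewrite -ge0_integralZl//; last 3 first.
- exact: (measurableT_comp (measurable_kernel_time d c t) (measurable_affine t 0%R)).
- by move=> s _; exact: ge0_kernel_time.
- by rewrite lee_fin ltW.
rewrite /betaI -[RHS]ge0_integralZl; last 4 first.
- exact: measurableT.
- exact: measurable_kernel_time.
- by move=> s _; exact: ge0_kernel_time.
- by rewrite lee_fin powR_ge0.
apply: eq_integral => s _.
rewrite addr0 pmulr_rgt0//.
have -> : (t * s < t)%R = (s < 1)%R by rewrite -[X in (_ < X)%R]mulr1 ltr_pM2l.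
case: (ltP 0%R s) => s0 /=; last by rewrite !mul0e !mule0.
case: (ltP s 1%R) => s1 /=; last by rewrite !mul0e !mule0.
have s1' : (0 < 1 - s)%R by rewrite subr_gt0.
have -> : (t - t * s = t * (1 - s))%R by ring.
rewrite !powRM ?(ltW t0) ?(ltW s1') ?(ltW s0)//.
rewrite !mul1e -!EFinM; congr EFin.
have -> : (t `^ (1 - d - c) = t * t `^ (- d) * t `^ (- c))%R.
  have tn : (t != 0)%R by rewrite gt_eqF.
  rewrite -[X in (X * _ * _)%R](powRr1 (ltW t0)) -!powRD ?tn ?implybT//.
ring.
Qed.

(** Since exp(-x) <= x^(-del), the exponential weight yields a power of lam at the
    price of a slightly stronger singularity at s = t. *)
Lemma kernel_time_expR (d del c t lam : R) : (0 < t)%R -> (0 <= del <= 1)%R -> (0 < lam)%R ->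
  \int[leb]_s (ind (0 < s < t)%R * ((t - s) `^ (- d) * s `^ (- c) * expR (- (lam * (t - s))))%:E) <=
  (lam `^ (- del) * t `^ (1 - (d + del) - c))%:E * betaI (d + del) c.
Proof.
move=> t0 /andP[del0 del1] lam0.
have -> : (lam `^ (- del) * t `^ (1 - (d + del) - c))%:E * betaI (d + del) c =
   \int[leb]_s ((lam `^ (- del))%:E *
      (ind (0 < s < t)%R * ((t - s) `^ (- (d + del)) * s `^ (- c))%:E)).
  rewrite ge0_integralZl.
  - by rewrite (kernel_time_scale _ _ t0) muleA EFinM.
  - exact: measurableT.
  - exact: measurable_kernel_time.
  - by move=> s _; exact: ge0_kernel_time.
  - by rewrite lee_fin powR_ge0.
apply: ge0_le_integral => //.
- by move=> s _; rewrite mule_ge0 ?ind_ge0// lee_fin !mulr_ge0 ?powR_ge0 ?expR_ge0.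
- apply: emeasurable_funM; first by apply: measurable_ind; exact: measurable_oo.
  apply/measurable_EFinP; apply: measurable_funM.
    apply: measurable_funM; last exact: measurable_powRl.
    apply: (measurableT_comp (measurable_powRl _)); exact: measurable_funB.
  apply: measurable_fun_expR; apply: measurableT_comp => //.
  by apply: measurable_funM => //; exact: measurable_funB.
- by apply: measurable_funeM; exact: measurable_kernel_time.
- move=> s _; case: (ltP 0%R s) => s0 /=; last by rewrite !mul0e mule0.
  case: (ltP s t) => st /=; last by rewrite !mul0e mule0.
  rewrite !mul1e -EFinM lee_fin.
  have ts : (0 < t - s)%R by rewrite subr_gt0.
  rewrite opprD powRD; last by apply/implyP => _; rewrite gt_eqF.
  rewrite (_ : lam `^ (- del) * _ = (t - s) `^ (- d) * s `^ (- c) * (lam `^ (- del) * (t - s) `^ (- del)))%R; last by ring.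
  rewrite ler_wpM2l ?mulr_ge0 ?powR_ge0// -powRM ?(ltW lam0) ?(ltW ts)//.
  have ls : (0 < lam * (t - s))%R by rewrite mulr_gt0.
  rewrite expRN powRN lef_pV2 ?posrE ?expR_gt0 ?powR_gt0//.
  apply: le_trans (expR_ge1Dx _).
  have [l1|l1] := leP (lam * (t - s))%R 1%R.
    apply: (@le_trans _ _ 1%R); last by rewrite lerDl (ltW ls).
    apply: (@le_trans _ _ (1 `^ del)%R); last by rewrite powR1.
    by rewrite ge0_ler_powR// ?nnegrE ?(ltW ls).
  apply: (@le_trans _ _ (lam * (t - s))%R); last by rewrite lerDr.
  by rewrite -[leRHS](powRr1 (ltW ls)) ler_powR// (ltW l1).
Qed.

Lemma beta_constE (c : R) : (0 <= c < 1)%R ->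
  ((beta_const c)%:E = betaI 2^-1 c :> \bar R).
Proof.
move=> c01; rewrite /beta_const /Rintegral.
have -> : \int[leb]_(s in `]0%R, 1%R[) ((1 - s) `^ (- 2^-1) * s `^ (- c))%:E = betaI 2^-1 c.
  rewrite integral_mkcond; apply: eq_integral => s _.
  rewrite patchE mem_setE in_itv/= /ind; case: ifPn => _; rewrite ?mul1e ?mul0e//.
rewrite fineK// ge0_fin_numE ?betaI_ge0// betaI_lty//; lra.
Qed.

Lemma beta_const_ge0 (c : R) : (0 <= beta_const c)%R.
Proof. by apply: Rintegral_ge0 => s _; rewrite mulr_ge0 ?powR_ge0. Qed.

End time_integrals.

(** * Weak Lorentz norms and the heat flow *)

Section lorentz_bounds.
Context {R : realType} (n : nat).
Local Notation mR := (measurableTypeR R).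
Local Notation leb := (@lebesgue_measure R).
Local Notation mu := (@lebesgue_rV R n).
Implicit Types g h : 'rV[R]_n -> R.

Lemma powRDp (x r s : R) : (0 < x)%R -> (x `^ (r + s) = x `^ r * x `^ s)%R.
Proof. by move=> x0; rewrite powRD//; apply/implyP => _; rewrite gt_eqF. Qed.

Lemma rinv_bounds (r : \bar R) : (1 <= n)%N -> n%:R%:E < r ->
  (0 <= rinv r /\ n%:R * rinv r < 1 /\ rinv r < 1)%R.
Proof.
move=> n1; have n1' : (1 <= n%:R :> R)%R by rewrite ler1n.
case: r => [r|_|//]; rewrite /rinv; last by rewrite invey /= mulr0.
rewrite lte_fin => nr; have r0 : (0 < r)%R by lra.
rewrite inver gt_eqF//=; split; first by rewrite invr_ge0 ltW.
by split; [rewrite ltr_pdivrMr// mul1r|rewrite invf_lt1//; lra].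
Qed.

Lemma hoelder_conjugateE (r : \bar R) : (1 <= n)%N -> n%:R%:E < r ->
  hoelder_conjugate r = ((1 - rinv r)^-1)%:E.
Proof.
move=> n1; have n1' : (1 <= n%:R :> R)%R by rewrite ler1n.
case: r => [r|_|//]; rewrite /rinv; last by rewrite invey /= subr0 invr1.
rewrite lte_fin => nr; have r1 : (1 < r)%R by lra.
rewrite /hoelder_conjugate/= inver !gt_eqF ?lte_fin//=; last by lra.
rewrite inver gt_eqF/=; last by lra.
rewrite -EFinM; congr EFin; field.
by apply/andP; split; rewrite gt_eqF//; lra.
by rewrite subr_gt0.
Qed.

Lemma lorentz_norm_yE (r : \bar R) g : 1 < r ->
  lorentz_norm r +oo g =
  ereal_sup [set (t `^ rinv r)%:E * rearr g t | t in `]0%R, +oo[].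
Proof. by case: r. Qed.

Lemma rearr_weak (r : \bar R) g (M t : R) : 1 < r -> (0 < t)%R ->
  lorentz_norm r +oo g <= M%:E -> rearr g t <= (M * t `^ (- rinv r))%:E.
Proof.
move=> r1 t0 gM.
have h : (t `^ rinv r)%:E * rearr g t <= M%:E.
  apply: le_trans gM; rewrite lorentz_norm_yE//; apply: ereal_sup_ubound.
  by exists t => //; rewrite /= in_itv/= t0.
have p0 : (0 < t `^ rinv r)%R by rewrite powR_gt0.
rewrite powRN EFinM -lee_pdivlMl// in h *.
by rewrite muleC.
Qed.

Lemma distr_fun_reflect g y (x : 'rV[R]_n) : measurable_fun setT g ->
  distr_fun (fun z => g (x - z)%R) y = distr_fun g y.
Proof. by move=> mg; rewrite /distr_fun [RHS](lebesgue_rV_reflect x)//; exact: measurable_superlevel. Qed.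

Lemma rearr_eq g h t : (forall y, distr_fun g y = distr_fun h y) -> rearr g t = rearr h t.
Proof.
move=> gh; rewrite /rearr; congr (ereal_sup (_ |` (EFin @` _))).
by apply/seteqP; split => y /= [y0]; rewrite gh.
Qed.

(** Hardy-Littlewood against the heat kernel: the weak norm of f bounds f* by
    M t^(-1/r), and what remains is the L^{r',1} norm of the kernel, up to the
    factor r' of its normalisation. *)
Lemma heat_bound (alpha M : R) (r : \bar R) (f : 'rV[R]_n -> 'rV[R]_n) (t : R) x :
  (1 <= n)%N -> n%:R%:E < r -> (0 < t)%R -> (0 <= alpha)%R -> (0 <= M)%R ->
  lorentz_norm (hoelder_conjugate r) 1 (@heat_kernel R n t)
         <= (alpha * t `^ (- (n%:R * rinv r / 2)))%:E ->
  measurable_fun setT f -> lorentz_norm r +oo (enorm \o f) <= M%:E ->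
  \int[mu]_y (heat_kernel t (x - y)%R * enorm (f y))%:E <=
  (fine (hoelder_conjugate r) * alpha * M * t `^ (- (n%:R * rinv r / 2)))%:E.
Proof.
move=> n1 nr t0 a0 M0 ha mf fM; have [b0 [nb1 b1]] := rinv_bounds n1 nr.
have r1 : 1 < r by apply: le_lt_trans nr; rewrite lee_fin ler1n.
set b := rinv r in b0 b1 nb1 ha *.
rewrite hoelder_conjugateE// -/b in ha *; set rho := ((1 - b)^-1)%R.
have rho0 : (0 < rho)%R by rewrite invr_gt0 subr_gt0.
have irho0 : (0 < rho^-1)%R by rewrite invr_gt0.
have me : measurable_fun setT (enorm \o f) by exact: (measurableT_comp (@measurable_enorm R n) mf).
have mh := @measurable_heat_kernel R n t.
have mhr : measurable_fun setT (fun y : 'rV[R]_n => heat_kernel t (x - y)%R).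
  by apply: (measurableT_comp mh); exact: measurable_reflect_rV.
have := hardy_littlewood me mhr (fun=> heat_kernel_ge0 _ _).
under eq_integral do rewrite /= (ger0_norm (enorm_ge0 _)).
move=> /le_trans; apply.
have mrh := measurable_rearr mh.
pose I := \int[leb]_s (ind (0 < s)%R * ((s `^ (- b))%:E * rearr (@heat_kernel R n t) s)).
have mI : measurable_fun setT (fun s : mR => ind (0 < s)%R * ((s `^ (- b))%:E * rearr (@heat_kernel R n t) s)).
  apply: emeasurable_funM; first by apply: measurable_ind; exact: measurable_fun_ltr.
  by apply: emeasurable_funM => //; apply/measurable_EFinP; exact: measurable_powRl.
apply: (@le_trans _ _ (M%:E * I)).
  have -> : M%:E * I = \int[leb]_s (M%:E * (ind (0 < s)%R * ((s `^ (- b))%:E * rearr (@heat_kernel R n t) s))).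
    rewrite ge0_integralZl//.
    by move=> s _; rewrite !mule_ge0 ?ind_ge0 ?rearr_ge0// lee_fin powR_ge0.
  apply: ge0_le_integral => //.
  - by move=> s _; rewrite !mule_ge0 ?ind_ge0 ?rearr_ge0.
  - apply: emeasurable_funM; first by apply: measurable_ind; exact: measurable_fun_ltr.
    apply: emeasurable_funM; last exact: measurable_rearr.
    exact: measurable_rearr.
  - exact: measurable_funeM.
  - move=> s _; case: (ltP 0%R s) => s0; last by rewrite !mul0e mule0.
    rewrite !mul1e muleA -EFinM.
    rewrite (@rearr_eq (fun y : 'rV[R]_n => heat_kernel t (x - y)%R) (heat_kernel t)); last first.
      by move=> y; exact: distr_fun_reflect.
    by rewrite muleC lee_wpmul2r ?rearr_ge0// rearr_weak.
have hI : lorentz_norm (rho%:E) 1 (heat_kernel t : 'rV[R]_n -> R) = (rho^-1)%:E * I.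
  rewrite /lorentz_norm invr1 div1r poweRe1; last first.
    rewrite mule_ge0 ?lee_fin ?(ltW irho0)//; apply: integral_ge0 => s.
    by rewrite /= in_itv/= andbT => s0; rewrite mule_ge0 ?poweR_ge0// lee_fin invr_ge0 ltW.
  congr (_ * _); rewrite integral_mkcond; apply: eq_integral => s _.
  rewrite patchE mem_setE in_itv/= andbT /ind; case: (ltP 0%R s) => s0; last by rewrite mul0e.
  rewrite mul1e poweRe1; last by rewrite mule_ge0 ?rearr_ge0// lee_fin powR_ge0.
  rewrite muleAC -EFinM; congr ((_)%:E * _).
  rewrite -(powR_inv1 (ltW s0)) -powRDp//.
  by congr (_ `^ _)%R; rewrite /rho invrK; ring.
rewrite hI lee_pdivrMl// in ha.
rewrite (_ : (rho * alpha * M * _)%R = (M * (rho * (alpha * t `^ (- (n%:R * b / 2)))))%R); last by ring.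
by rewrite [in leRHS]EFinM lee_wpmul2l// EFinM.
Qed.

Lemma measurable_poweR_fun d (T : measurableType d) (g : T -> \bar R) (a : R) :
  measurable_fun setT g -> measurable_fun setT (fun s => g s `^ a).
Proof. by move=> mg; exact: (measurableT_comp (measurable_poweR a) mg). Qed.

(** For t fixed, f* >= f*(t) on (0, t), and the normalisation q/p of the Lorentz
    functional makes the integral of s^(q/p - 1) over (0, t) equal to t^(q/p). *)
Lemma lorentz_weak_le (r q : \bar R) g : 1 < r -> 1 <= q -> (r = +oo -> q = +oo) ->
  measurable_fun setT g -> lorentz_norm r +oo g <= lorentz_norm r q g.
Proof.
case: r => [r|_ _ /(_ erefl) ->//|//] r1; case: q => [q|//|//] q1 _ mg.
have r0 : (0 < r)%R by move: r1; rewrite lte_fin; lra.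
have q0 : (0 < q)%R by move: q1; rewrite lee_fin; lra.
apply: ge_ereal_sup => z [t]; rewrite /= in_itv/= andbT => t0 <-.
rewrite /rinv inver gt_eqF//=.
set A := (t `^ r^-1)%:E * rearr g t.
have A0 : 0 <= A by rewrite mule_ge0 ?rearr_ge0// lee_fin powR_ge0.
have -> : A = (A `^ q) `^ q^-1 by rewrite -poweRrM mulfV ?gt_eqF// poweRe1.
apply: gt0_ler_poweR; rewrite ?in_itv/= ?invr_ge0 ?(ltW q0) ?poweR_ge0 ?leey//.
  rewrite andbT mule_ge0 ?lee_fin ?divr_ge0 ?(ltW r0) ?(ltW q0)//.
  by apply: integral_ge0 => s; rewrite /= in_itv/= andbT => s0; rewrite mule_ge0 ?poweR_ge0// lee_fin invr_ge0 ltW.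
have c0 : (0 < q / r)%R by rewrite divr_gt0.
rewrite -lee_pdivrMl//.
apply: (@le_trans _ _ (\int[leb]_s ((ind (0 < s <= t)%R * (s `^ (q / r - 1))%:E) * rearr g t `^ q))).
  rewrite ge0_integralZr ?poweR_ge0//; last 2 first.
  - apply: emeasurable_funM; last by apply/measurable_EFinP; exact: measurable_powRl.
    by apply: measurable_ind; exact: measurable_oc.
  - by move=> s _; rewrite mule_ge0 ?ind_ge0// lee_fin powR_ge0.
  rewrite integral_powR0t// /A poweRM ?rearr_ge0 ?lee_fin ?powR_ge0// muleA poweR_EFin -EFinM.
  by rewrite -powRrM (mulrC r^-1%R) [((q / r)^-1 * _)%R]mulrC.
rewrite [leRHS]integral_mkcond; apply: ge0_le_integral => //.
- by move=> s _; rewrite !mule_ge0 ?ind_ge0 ?poweR_ge0// lee_fin powR_ge0.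
- apply: emeasurable_funM => //; apply: emeasurable_funM; last by apply/measurable_EFinP; exact: measurable_powRl.
  by apply: measurable_ind; exact: measurable_oc.
- apply/(measurable_restrictT _ _).1 => //; apply: measurable_funTS.
  apply: emeasurable_funM; last by apply/measurable_EFinP; exact: measurable_invr.
  apply: measurable_poweR_fun; apply: emeasurable_funM; last exact: measurable_rearr.
  by apply/measurable_EFinP; exact: measurable_powRl.
- move=> s _; rewrite patchE mem_setE in_itv/= andbT /ind.
  case: (ltP 0%R s) => s0 /=; last by rewrite !mul0e.
  case: (leP s t) => st /=; last by rewrite !mul0e mule_ge0 ?poweR_ge0// lee_fin invr_ge0 ltW.
  rewrite mul1e poweRM ?rearr_ge0 ?lee_fin ?powR_ge0// muleAC poweR_EFin -EFinM.
  rewrite -powRrM -(powR_inv1 (ltW s0)) -powRDp//.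
  rewrite (mulrC r^-1%R) lee_wpmul2l ?lee_fin ?powR_ge0//.
  apply: gt0_ler_poweR; rewrite ?in_itv/= ?(ltW q0) ?rearr_ge0 ?leey//.
  exact: le_rearr_anti.
Qed.

End lorentz_bounds.

(** * Translation-invariant norms *)

Section good_norm.
Context {R : realType} (n : nat).
Local Notation mR := (measurableTypeR R).
Local Notation leb := (@lebesgue_measure R).
Local Notation mu := (@lebesgue_rV R n).

(** What is needed of a norm in order to propagate it along the evolution.  It acts
    on nonnegative functions with extended real values, so that integrals may be
    substituted before they are known to converge. *)
Record good_norm (N : ('rV[R]_n -> \bar R) -> \bar R) : Prop := GoodNorm {
  gn_mono : forall g h : 'rV[R]_n -> \bar R, measurable_fun setT g -> measurable_fun setT h ->
    (forall x, 0 <= g x) -> (forall x, g x <= h x) -> N g <= N h ;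
  gn_add : forall g h : 'rV[R]_n -> \bar R, measurable_fun setT g -> measurable_fun setT h ->
    (forall x, 0 <= g x) -> (forall x, 0 <= h x) -> N (fun x => g x + h x) <= N g + N h ;
  gn_scale : forall (c : R) (g : 'rV[R]_n -> \bar R), measurable_fun setT g ->
    (forall x, 0 <= g x) -> (0 <= c)%R -> N (fun x => c%:E * g x) <= c%:E * N g ;
  gn_shift : forall (g : 'rV[R]_n -> \bar R) (y : 'rV[R]_n), measurable_fun setT g ->
    (forall x, 0 <= g x) -> N (fun x => g (x - y)%R) <= N g ;
  gn_mink : forall d (Z : measurableType d) (nu : {sigma_finite_measure set Z -> \bar R})
    (w : Z * 'rV[R]_n -> \bar R) (ub : Z -> \bar R),
    measurable_fun setT w -> (forall z, 0 <= w z) -> measurable_fun setT ub ->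
    (forall z, N (fun x => w (z, x)) <= ub z) ->
    N (fun x => \int[nu]_z w (z, x)) <= \int[nu]_z ub z ;
  gn_fatou : forall (g_ : nat -> 'rV[R]_n -> R) (g : 'rV[R]_n -> R) (C : \bar R),
    (forall k, measurable_fun setT (g_ k)) -> (forall k x, 0 <= g_ k x)%R ->
    (forall x, g_ ^~ x @ \oo --> g x) -> (forall k, N (EFin \o g_ k) <= C) ->
    N (EFin \o g) <= C }.

(** The supremum norm, over all points rather than up to null sets. *)
Definition supN (g : 'rV[R]_n -> \bar R) : \bar R := ereal_sup (range g).

Lemma supN_ge g x : g x <= supN g.
Proof. by apply: ereal_sup_ubound; exists x. Qed.

Lemma supN_le g C : (forall x, g x <= C) -> supN g <= C.
Proof. by move=> gC; apply: ge_ereal_sup => _ [x _ <-]. Qed.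

Lemma good_norm_supN : good_norm supN.
Proof.
split.
- by move=> g h _ _ _ gh; apply: supN_le => x; apply: le_trans (gh x) (supN_ge h x).
- by move=> g h _ _ _ _; apply: supN_le => x; apply: leeD; exact: supN_ge.
- by move=> c g _ g0 c0; apply: supN_le => x; apply: lee_wpmul2l; [rewrite lee_fin|exact: supN_ge].
- by move=> g y _ _; apply: supN_le => x; exact: supN_ge.
- move=> d Z nu w ub mw w0 mub wub; apply: supN_le => x.
  apply: ge0_le_integral => //; first exact: (measurableT_comp mw (pair2_measurable x)).
  by move=> z _; exact: le_trans (supN_ge _ x) (wub z).
- move=> g_ g C mg g0 gl gC; apply: supN_le => x.
  have gx k : (g_ k x)%:E <= C by apply: le_trans (gC k); exact: (supN_ge (EFin \o g_ k)).
  have cv : (EFin (g_ k x)) @[k --> \oo] --> (g x)%:E by apply: cvg_EFin; [exact: nearW|exact: gl].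
  rewrite /= -(cvg_lim _ cv)//.
  by apply: lime_le; [apply/cvg_ex; exists (g x)%:E|exact: nearW].
Qed.

(** A supremum of integrals inherits Minkowski's inequality and the Fatou property
    from the integral, whatever the class of test functions is. *)
Definition dualN (H : set ('rV[R]_n -> \bar R)) (g : 'rV[R]_n -> \bar R) : \bar R :=
  ereal_sup [set \int[mu]_x (g x * h x) | h in H].

Lemma dualN_ge (H : set ('rV[R]_n -> \bar R)) h g : H h ->
  \int[mu]_x (g x * h x) <= dualN H g.
Proof. by move=> Hh; apply: ereal_sup_ubound; exists h. Qed.

Lemma dualN_le (H : set ('rV[R]_n -> \bar R)) g C :
  (forall h, H h -> \int[mu]_x (g x * h x) <= C) -> dualN H g <= C.
Proof. by move=> gC; apply: ge_ereal_sup => _ [h Hh <-]; exact: gC. Qed.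

(** Translation invariance is the only property that depends on H: the class of
    test functions has to be invariant under translations. *)
Lemma good_norm_dualN (H : set ('rV[R]_n -> \bar R)) :
  (forall h, H h -> measurable_fun setT h) -> (forall h, H h -> forall x, 0 <= h x) ->
  (forall h y, H h -> H (fun x => h (x - y)%R)) -> good_norm (dualN H).
Proof.
move=> mH H0 Hs; split.
- move=> g h mg mh g0 gh; apply: dualN_le => k Hk; apply: le_trans (dualN_ge h Hk).
  apply: ge0_le_integral => //.
  + by move=> x _; rewrite mule_ge0// H0.
  + by apply: emeasurable_funM => //; exact: mH.
  + by apply: emeasurable_funM => //; exact: mH.
  + by move=> x _; rewrite lee_wpmul2r// H0.
- move=> g h mg mh g0 h0; apply: dualN_le => k Hk.
  under eq_integral do rewrite ge0_muleDl//.
  rewrite ge0_integralD//.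
  + by rewrite leeD// dualN_ge.
  + by move=> x _; rewrite mule_ge0// H0.
  + by apply: emeasurable_funM => //; exact: mH.
  + by move=> x _; rewrite mule_ge0// H0.
  + by apply: emeasurable_funM => //; exact: mH.
- move=> c g mg g0 c0; apply: dualN_le => k Hk.
  under eq_integral do rewrite -muleA.
  rewrite ge0_integralZl//.
  + by rewrite lee_wpmul2l// ?lee_fin// dualN_ge.
  + by apply: emeasurable_funM => //; exact: mH.
  + by move=> x _; rewrite mule_ge0// H0.
- move=> g y mg g0; apply: dualN_le => k Hk.
  have Hky := Hs k (- y)%R Hk.
  apply: le_trans (dualN_ge g Hky).
  rewrite -[leRHS](@ge0_integral_shift_rV _ _ y).
  + rewrite le_eqVlt; apply/orP; left; apply/eqP; apply: eq_integral => x _.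
    by rewrite opprK subrK.
  + by apply: emeasurable_funM => //; exact: mH.
  + by move=> x; rewrite mule_ge0// (H0 _ Hky).
- move=> d Z nu w ub mw w0 mub wub; apply: dualN_le => k Hk.
  have mk := mH _ Hk.
  have mwk : measurable_fun setT (fun z : Z * 'rV[R]_n => w z * k z.2).
    by apply: emeasurable_funM => //; exact: (measurableT_comp mk measurable_snd).
  have wk0 z : 0 <= w z * k z.2 by rewrite mule_ge0// H0.
  have -> : \int[mu]_x (\int[nu]_z w (z, x) * k x) = \int[mu]_x \int[nu]_z (w (z, x) * k x).
    apply: eq_integral => x _; rewrite ge0_integralZr//; last exact: H0.
    exact: (measurableT_comp mw (pair2_measurable x)).
  rewrite -(@fubini_tonelli _ _ _ _ _ nu mu (fun z => w z * k z.2))//.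
  apply: ge0_le_integral => //.
  + by move=> z _; apply: integral_ge0 => x _; exact: (wk0 (z, x)).
  + exact: (@measurable_fun_fubini_tonelli_F _ _ _ _ _ mu (fun z => w z * k z.2)).
  + by move=> z _; apply: le_trans (wub z); exact: (dualN_ge (fun x => w (z, x))).
- move=> g_ g C mg g0 gl gC; apply: dualN_le => k Hk.
  have mk := mH _ Hk; have k0 := H0 _ Hk.
  have gx0 x : (0 <= g x)%R.
    by have /cvg_lim <- := gl x => //; apply: limr_ge; [apply/cvg_ex; exists (g x)|exact: nearW].
  pose f m x := if g x == 0%R then 0 else (g_ m x)%:E * k x.
  have mgl : measurable_fun setT g by apply: (measurable_fun_cvg mg) => x _; exact: gl.
  have mf0 m : measurable_fun setT (fun x => (g_ m x)%:E * k x).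
    by apply: emeasurable_funM => //; exact/measurable_EFinP.
  have mf m : measurable_fun setT (f m).
    by apply: measurable_fun_ifT => //; exact: measurable_fun_eqr.
  have f00 m x : 0 <= (g_ m x)%:E * k x by rewrite mule_ge0 ?lee_fin.
  have f0 m x : 0 <= f m x by rewrite /f; case: ifPn.
  have fl x : f ^~ x @ \oo --> (g x)%:E * k x.
    rewrite /f; case: eqVneq => [->|gx]; first by rewrite mul0e; exact: cvg_cst.
    apply: cvgeM.
    - by rewrite /mule_def; case: (k x) => [r||]; rewrite ?gx.
    - by apply: cvg_EFin; [exact: nearW|exact: gl].
    - exact: cvg_cst.
  rewrite (_ : \int[mu]_x _ = \int[mu]_x limn_einf (f ^~ x)); last first.
    by apply: eq_integral => x _; have [-> _] := cvg_limn_einf_sup (fl x).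
  apply: le_trans (fatou _ _ _ _) _ => //.
  rewrite limn_einf_lim; apply: lime_le; first exact: is_cvg_einfs.
  apply: nearW => m; apply: (@le_trans _ _ (\int[mu]_x f m x)).
    by apply: ereal_inf_lbound; exists m => //=.
  apply: le_trans (gC m); apply: le_trans (dualN_ge _ Hk).
  apply: ge0_le_integral => //; first exact: mf0.
  by move=> x _; rewrite /f; case: ifPn => // _; exact: f00.
Qed.

End good_norm.

(** * The norm dual to the Lorentz functional *)

Section lorentz_dual.
Context {R : realType} (n : nat).
Local Notation mR := (measurableTypeR R).
Local Notation leb := (@lebesgue_measure R).
Local Notation mu := (@lebesgue_rV R n).
Implicit Types (g h G : 'rV[R]_n -> R) (F : 'rV[R]_n -> bool).

Lemma measurable_ind_rearr (b : R -> bool) G : measurable_fun setT G ->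
  measurable_fun setT (b : mR -> _) ->
  measurable_fun setT (fun t : mR => ind (b t) * rearr G t).
Proof.
by move=> mG mb; apply: emeasurable_funM; [exact: measurable_ind|exact: measurable_rearr].
Qed.

(** The elementary admissible test function is the indicator of F weighted by
    th <= 1 so that its mass is at most s.  The part of the rearrangement beyond s
    is at most G*(s), whence the last term. *)
Lemma integral_tester_le G F (th s : R) : measurable_fun setT G -> measurable_fun setT F ->
  (0 <= th <= 1)%R -> (0 < s)%R -> th%:E * mu [set x | F x] <= s%:E ->
  th%:E * \int[mu]_x (ind (F x) * `|G x|%:E) <=
  \int[leb]_t (ind (0 < t <= s)%R * rearr G t) + s%:E * rearr G s.
Proof.
move=> mG mF /andP[th0 th1] s0 ths.
set e := mu _ in ths *; have e0 : 0 <= e by exact: measure_ge0.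
have mlt : measurable_fun setT (fun t : mR => (0 < t)%R && (t%:E < e)).
  apply: measurable_and; first exact: measurable_fun_ltr.
  by apply: measurable_fun_lte => //; exact: EFin_measurable.
apply: (@le_trans _ _ (th%:E * \int[leb]_t (ind ((0 < t)%R && (t%:E < e)) * rearr G t))).
  by apply: lee_wpmul2l; [rewrite lee_fin|exact: integral_set_le_rearr].
rewrite -ge0_integralZl//; last 2 first.
- exact: measurable_ind_rearr.
- by move=> t _; rewrite mule_ge0 ?ind_ge0 ?rearr_ge0.
apply: (@le_trans _ _ (\int[leb]_t ((ind (0 < t <= s)%R * rearr G t) +
    (th%:E * rearr G s) * ind ((0 < t)%R && (t%:E < e))))).
  apply: ge0_le_integral => //.
  - by move=> t _; rewrite !mule_ge0 ?ind_ge0 ?rearr_ge0// lee_fin.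
  - by apply: measurable_funeM; exact: measurable_ind_rearr.
  - apply: emeasurable_funD; first by apply: measurable_ind_rearr => //; exact: measurable_oc.
    by apply: measurable_funeM; exact: measurable_ind.
  - move=> t _; case: (ltP 0%R t) => t0 /=; last by rewrite !mul0e !mule0 adde0.
    case: (leP t s) => ts.
      rewrite mul1e; apply: le_trans (leeDl _ _).
        rewrite /ind; case: (_ < _); rewrite ?mul0e ?mule0 ?rearr_ge0// mul1e.
        by rewrite -[leRHS]mul1e lee_wpmul2r ?rearr_ge0// lee_fin.
      by rewrite !mule_ge0 ?ind_ge0 ?rearr_ge0// lee_fin.
    rewrite mul0e add0e [X in th%:E * X]muleC muleA.
    by rewrite lee_wpmul2r ?ind_ge0// lee_wpmul2l ?lee_fin// le_rearr_anti// ltW.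
rewrite ge0_integralD//; last 4 first.
- by move=> t _; rewrite mule_ge0 ?ind_ge0 ?rearr_ge0.
- by apply: measurable_ind_rearr => //; exact: measurable_oc.
- by move=> t _; rewrite !mule_ge0 ?ind_ge0 ?rearr_ge0// lee_fin.
- by apply: measurable_funeM; exact: measurable_ind.
apply: leeD => //; rewrite ge0_integralZl//; last 3 first.
- exact: measurable_ind.
- by move=> t _; exact: ind_ge0.
- by rewrite mule_ge0 ?lee_fin ?rearr_ge0.
by rewrite ind_layer// muleAC lee_wpmul2r ?rearr_ge0.
Qed.

(** The weight for which the Lorentz functional is an L^q norm with respect to
    ds/s; it is bounded exactly on weak L^p. *)
Definition Bfun (p : R) G (s : R) : \bar R := (s `^ p^-1)%:E * rearr G s.

Lemma Bfun_ge0 p G s : 0 <= Bfun p G s.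
Proof. by rewrite mule_ge0 ?rearr_ge0// lee_fin powR_ge0. Qed.

Lemma rearr_Bfun (p : R) G s : (0 < s)%R -> rearr G s = (s `^ (- p^-1))%:E * Bfun p G s.
Proof. by move=> s0; rewrite /Bfun muleA -EFinM -powRDp// addNr powRr0 mul1e. Qed.

Lemma measurable_Bfun p G : measurable_fun setT G ->
  measurable_fun setT (Bfun p G : mR -> _).
Proof.
move=> mG; apply: emeasurable_funM; last exact: measurable_rearr.
by apply/measurable_EFinP; exact: measurable_powRl.
Qed.

Lemma Bfun_le_weak (p : R) G s : (1 < p)%R -> (0 < s)%R -> Bfun p G s <= lorentz_norm p%:E +oo G.
Proof.
move=> p1 s0; rewrite lorentz_norm_yE ?lte_fin//; apply: ereal_sup_ubound.
exists s; first by rewrite /= in_itv/= s0.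
by rewrite /rinv inver gt_eqF//=; lra.
Qed.

Lemma integral_tester_weak (p : R) G (s : R) : (1 < p)%R -> measurable_fun setT G -> (0 < s)%R ->
  \int[leb]_t (ind (0 < t <= s)%R * rearr G t) + s%:E * rearr G s <=
  (((1 - p^-1)^-1 + 1) * s `^ (1 - p^-1))%:E * lorentz_norm p%:E +oo G.
Proof.
move=> p1 mG s0; set L := lorentz_norm _ _ _.
have L0 : 0 <= L by apply: le_trans (Bfun_le_weak G p1 s0); exact: Bfun_ge0.
have q0 : (0 < 1 - p^-1)%R by rewrite subr_gt0 invf_lt1//; lra.
have rL t : (0 < t)%R -> rearr G t <= (t `^ (- p^-1))%:E * L.
  by move=> t0; rewrite (rearr_Bfun p)// lee_wpmul2l ?lee_fin ?powR_ge0// Bfun_le_weak.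
rewrite mulrDl mul1r EFinD ge0_muleDl ?lee_fin ?mulr_ge0 ?powR_ge0 ?invr_ge0 ?(ltW q0)//.
apply: leeD.
  apply: (@le_trans _ _ (\int[leb]_t ((ind (0 < t <= s)%R * (t `^ ((1 - p^-1) - 1))%:E) * L))).
    apply: ge0_le_integral => //.
    - by move=> t _; rewrite mule_ge0 ?ind_ge0 ?rearr_ge0.
    - by apply: measurable_ind_rearr => //; exact: measurable_oc.
    - apply: emeasurable_funM => //; apply: emeasurable_funM.
        by apply: measurable_ind; exact: measurable_oc.
      by apply/measurable_EFinP; exact: measurable_powRl.
    - move=> t _; rewrite -muleA; case: (ltP 0%R t) => t0 /=; last by rewrite !mul0e.
      rewrite lee_wpmul2l ?ind_ge0// (le_trans (rL t t0))//.
      by rewrite (_ : 1 - p^-1 - 1 = - p^-1)%R//; ring.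
  rewrite ge0_integralZr//.
  - by rewrite integral_powR0t// mulrC.
  - apply: emeasurable_funM; first by apply: measurable_ind; exact: measurable_oc.
    by apply/measurable_EFinP; exact: measurable_powRl.
  - by move=> t _; rewrite mule_ge0 ?ind_ge0// lee_fin powR_ge0.
rewrite powRDp// powRr1 ?(ltW s0)// EFinM -muleA.
by rewrite lee_wpmul2l ?lee_fin ?(ltW s0)// rL.
Qed.

(** The q-th power of the Lorentz functional without its normalisation. *)
Definition Yint (p q : R) G : \bar R :=
  \int[leb]_s (ind (0 < s)%R * (Bfun p G s `^ q * (s^-1)%:E)).

(** For q = +oo the weak functional alone controls the test functions. *)
Definition Yterm (p : R) (q : \bar R) G : \bar R := if q is q'%:E then Yint p q' G else 0.

Lemma ge0_Yint_fun p q G s : 0 <= ind (0 < s)%R * (Bfun p G s `^ q * (s^-1)%:E).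
Proof.
have [s0|s0] := ltP 0%R s; last by rewrite mul0e.
by rewrite !mule_ge0 ?ind_ge0 ?poweR_ge0// lee_fin invr_ge0 ltW.
Qed.

Lemma Yint_ge0 p q G : 0 <= Yint p q G.
Proof. by apply: integral_ge0 => s _; exact: ge0_Yint_fun. Qed.

Lemma Yterm_ge0 p q G : 0 <= Yterm p q G.
Proof. by case: q => //= q; exact: Yint_ge0. Qed.

Lemma measurable_Yint_fun p q G : measurable_fun setT G ->
  measurable_fun setT (fun s : mR => ind (0 < s)%R * (Bfun p G s `^ q * (s^-1)%:E)).
Proof.
move=> mG; apply: emeasurable_funM; first by apply: measurable_ind; exact: measurable_fun_ltr.
apply: emeasurable_funM; last by apply/measurable_EFinP; exact: measurable_invr.
by apply: measurable_poweR_fun; exact: measurable_Bfun.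
Qed.

Lemma lorentz_normE (p q : R) G : lorentz_norm p%:E q%:E G = ((q / p)%:E * Yint p q G) `^ q^-1.
Proof.
rewrite /lorentz_norm; congr ((_ * _) `^ _); rewrite [LHS]integral_mkcond.
apply: eq_integral => s _; rewrite patchE mem_setE in_itv/= andbT /ind.
by case: (ltP 0%R s) => s0; rewrite ?mul1e ?mul0e.
Qed.

Lemma lorentz_norm_ge0 (p q : \bar R) G : 1 < p -> 1 <= q -> (p = +oo -> q = +oo) ->
  measurable_fun setT G -> 0 <= lorentz_norm p q G.
Proof.
move=> p1 q1 pq mG; apply: le_trans (lorentz_weak_le p1 q1 pq mG).
rewrite lorentz_norm_yE//; apply: (@le_trans _ _ ((1 `^ rinv p)%:E * rearr G 1)).
  by rewrite mule_ge0 ?rearr_ge0// lee_fin powR_ge0.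
by apply: ereal_sup_ubound; exists 1%R; rewrite ?/= ?in_itv/= ?ltr01.
Qed.

(** The right-hand side is not homogeneous in G.  This is harmless: the class only
    has to be invariant under translations, and the sum of a norm and a q-th
    power is what Young's inequality provides for the explicit test functions. *)
Definition Hset (p : R) (q : \bar R) : set ('rV[R]_n -> \bar R) :=
  [set h | [/\ measurable_fun setT h, forall x, 0 <= h x &
    forall G, measurable_fun setT G ->
      \int[mu]_x (`|G x|%:E * h x) <= 1 + lorentz_norm p%:E q G + Yterm p q G]].

Definition lorN (p : R) (q : \bar R) := dualN (Hset p q).

Lemma rearr_shift G (y : 'rV[R]_n) : measurable_fun setT G ->
  rearr (fun x => G (x + y)%R) = rearr G.
Proof.
move=> mG; apply/funext => t; apply: rearr_eq => z.
have mG' : measurable_fun setT (fun w : 'rV[R]_n => G (y - w)%R).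
  by apply: (measurableT_comp mG); exact: measurable_reflect_rV.
rewrite -(distr_fun_reflect z y mG) -(distr_fun_reflect z 0%R mG').
by congr distr_fun; apply/funext => w; rewrite sub0r opprK addrC.
Qed.

Lemma good_norm_lorN p q : good_norm (lorN p q).
Proof.
apply: good_norm_dualN; [by move=> h []|by move=> h []|].
move=> h y [mh h0 hG]; split.
- by apply: (measurableT_comp mh); exact: measurable_funB_rV.
- by move=> x; exact: h0.
- move=> G mG.
  have mGy : measurable_fun setT (fun x : 'rV[R]_n => G (x + y)%R).
    apply: (measurableT_comp mG).
    have := @measurable_funB_rV R _ _ n id (fun=> - y)%R (@measurable_id _ _ _) (measurable_cst _).
    by under eq_fun do rewrite opprK.
  have := hG _ mGy.
  rewrite -[in X in X -> _](@ge0_integral_shift_rV _ _ y).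
  + under eq_integral do rewrite subrK.
    have -> : lorentz_norm p%:E q (fun x : 'rV[R]_n => G (x + y)%R) = lorentz_norm p%:E q G.
      by rewrite /lorentz_norm rearr_shift.
    suff -> : Yterm p q (fun x : 'rV[R]_n => G (x + y)%R) = Yterm p q G by [].
    by case: q {hG} => [q'| |]; rewrite /Yterm// /Yint /Bfun rearr_shift.
  + by apply: emeasurable_funM => //; apply/measurable_EFinP; exact: measurableT_comp.
  + by move=> x; rewrite mule_ge0.
Qed.

Lemma lorN_le (p : R) q G : measurable_fun setT G ->
  lorN p q (fun x => `|G x|%:E) <= 1 + lorentz_norm p%:E q G + Yterm p q G.
Proof. by move=> mG; apply: dualN_le => h [_ _]; exact. Qed.

End lorentz_dual.

Section lorentz_lower.
Context {R : realType} (n : nat).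
Local Notation mR := (measurableTypeR R).
Local Notation leb := (@lebesgue_measure R).
Local Notation mu := (@lebesgue_rV R n).
Implicit Types (g h G : 'rV[R]_n -> R) (F : 'rV[R]_n -> bool).

(** Superlevel sets of g may have infinite measure; a subset of finite measure,
    still larger than t, is what can be normalised into a test function. *)
Lemma finite_superlevel_subset g (y t : R) : measurable_fun setT g ->
  t%:E < distr_fun g y -> exists F, [/\ measurable_fun setT F,
    forall x, F x -> (y < `|g x|)%R, t%:E < mu [set x | F x] & mu [set x | F x] < +oo].
Proof.
move=> mg ty.
have /sigma_finiteP[S [ST ndS mS]] := sigma_finiteT mu.
pose A := [set x : 'rV[R]_n | (y < `|g x|)%R].
have mA : measurable A by exact: measurable_superlevel.
have mAS k : measurable (A `&` S k) by apply: measurableI => //; exact: (mS k).1.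
have cv : (mu \o (fun k => A `&` S k)) @ \oo --> mu (\bigcup_k (A `&` S k)).
  apply: nondecreasing_cvg_mu => //; first exact: bigcup_measurable.
  by move=> i j ij; apply/subsetPset; apply: setIS; exact/subsetPset/ndS.
have eA : \bigcup_k (A `&` S k) = A by rewrite -setI_bigcupr -ST setIT.
rewrite eA in cv.
have [k tk] : exists k, t%:E < mu (A `&` S k).
  apply: contrapT => /forallNP h.
  suff : mu A <= t%:E by rewrite leNgt ty.
  rewrite -(cvg_lim _ cv)//; apply: lime_le; first by apply/cvg_ex; exists (mu A).
  by apply: nearW => k; rewrite leNgt; apply/negP; exact: h.
have eF : [set x | (x \in A `&` S k)] = A `&` S k by apply/seteqP; split => x /=; rewrite inE.
exists (fun x => x \in A `&` S k); rewrite eF; split => //.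
- apply: (measurable_fun_bool true).
  by rewrite setTI (_ : _ @^-1` _ = A `&` S k)//; apply/seteqP; split => x /=; rewrite inE.
- by move=> x; rewrite inE => -[].
- by apply: le_lt_trans (mS k).2; apply: le_measure; rewrite ?inE//; exact: (mS k).1.
Qed.

(** If y < g*(s), the superlevel set of height y has measure larger than s; its
    indicator, weighted to mass s and scaled by s^(1/p - 1), is an admissible test
    function up to a constant, and its pairing with g is at least s^(1/p) y. *)
Lemma lorN_weak (p : R) (q : \bar R) g : (1 < p)%R -> 1 <= q -> measurable_fun setT g ->
  lorentz_norm p%:E +oo g <= ((1 - p^-1)^-1 + 1)%:E * lorN p q (fun x => `|g x|%:E).
Proof.
move=> p1 q1 mg; have p1e : 1 < p%:E by rewrite lte_fin.
have q0 : (0 < 1 - p^-1)%R by rewrite subr_gt0 invf_lt1//; lra.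
set C := ((1 - p^-1)^-1 + 1)%R; have C0 : (0 < C)%R by rewrite addr_gt0 ?invr_gt0.
set N := lorN _ _ _.
have N0 : 0 <= N.
  have H0 : @Hset R n p q (fun=> 0).
    split => // G mG.
    rewrite (eq_integral (cst 0)) ?integral_cst ?mul0e//; last by move=> x _; rewrite mule0.
    by rewrite !adde_ge0 ?Yterm_ge0// lorentz_norm_ge0.
  by apply: le_trans (dualN_ge _ H0); apply: integral_ge0 => x _; rewrite mule0.
rewrite lorentz_norm_yE//; apply: ge_ereal_sup => z [t]; rewrite /= in_itv/= andbT => t0 <-.
rewrite /rinv inver gt_eqF//=; last by lra.
have tp0 : (0 < t `^ p^-1)%R by rewrite powR_gt0.
rewrite -lee_pdivlMl//; apply: ge_ereal_sup => _ [->|[y [y0 ty] <-]].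
  by rewrite !mule_ge0 ?lee_fin ?invr_ge0 ?(ltW tp0) ?(ltW C0).
have [F [mF Fy tF Foo]] := finite_superlevel_subset mg ty.
set e := mu _ in tF Foo.
have efin : e \is a fin_num by rewrite ge0_fin_numE// measure_ge0.
have e0 : (0 < fine e)%R by rewrite -lte_fin fineK//; apply: lt_trans tF; rewrite lte_fin.
pose th := (t / fine e)%R.
have th01 : (0 <= th <= 1)%R.
  rewrite divr_ge0 ?(ltW t0) ?(ltW e0)//= ler_pdivrMr// mul1r.
  by rewrite -lee_fin fineK// ltW.
have the : th%:E * e = t%:E.
  by rewrite -(fineK efin) -EFinM /th mulfVK// gt_eqF.
pose c := (t `^ (p^-1 - 1) / C)%R.
have c0 : (0 <= c)%R by rewrite divr_ge0 ?powR_ge0 ?(ltW C0).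
have th0 : (0 <= th)%R by case/andP: th01.
have mI : measurable_fun setT (fun x => ind (F x) : \bar R) by exact: measurable_ind.
have IZ G : measurable_fun setT G ->
    \int[mu]_x (`|G x|%:E * ((c * th)%:E * ind (F x))) =
    c%:E * (th%:E * \int[mu]_x (ind (F x) * `|G x|%:E)).
  move=> mG; rewrite muleA -EFinM -ge0_integralZl//.
  - by apply: eq_integral => x _; rewrite muleCA [X in _ = _ * X]muleC.
  - by apply: emeasurable_funM => //; apply/measurable_EFinP; exact: measurableT_comp.
  - by move=> x _; rewrite mule_ge0 ?ind_ge0.
  - by rewrite lee_fin mulr_ge0.
have Hh : Hset p q (fun x => (c * th)%:E * ind (F x)).
  split; first exact: measurable_funeM.
    by move=> x; rewrite mule_ge0 ?ind_ge0// lee_fin mulr_ge0.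
  move=> G mG; rewrite IZ//.
  apply: (@le_trans _ _ (lorentz_norm p%:E +oo G)); last first.
    apply: le_trans (lorentz_weak_le p1e q1 _ mG) _ => //.
    by rewrite -addeA addeCA leeDl// adde_ge0 ?Yterm_ge0.
  have := integral_tester_le mG mF th01 t0; rewrite the lexx => /(_ erefl) h.
  apply: (@le_trans _ _ (c%:E * ((C * t `^ (1 - p^-1))%:E * lorentz_norm p%:E +oo G))).
    rewrite lee_wpmul2l ?lee_fin//; apply: le_trans h _.
    exact: integral_tester_weak.
  rewrite muleA -EFinM /c (_ : _ * _ = 1)%R ?mul1e//.
  rewrite mulrA mulfVK ?gt_eqF// -powRDp//.
  by rewrite (_ : _ + _ = 0)%R ?powRr0//; ring.
have := dualN_ge (fun x => `|g x|%:E) Hh; rewrite IZ// -/(lorN p q _) -/N => hN.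
have h2 : y%:E * t%:E <= th%:E * \int[mu]_x (ind (F x) * `|g x|%:E).
  rewrite -the muleCA lee_wpmul2l ?lee_fin//.
  have -> : e = \int[mu]_x ind (F x) by rewrite integral_ind.
  rewrite -ge0_integralZl//; [|by move=> x _; exact: ind_ge0|by rewrite lee_fin ltW].
  apply: ge0_le_integral => //.
  - by move=> x _; rewrite mule_ge0 ?ind_ge0// lee_fin ltW.
  - exact: measurable_funeM.
  - by apply: emeasurable_funM => //; apply/measurable_EFinP; exact: measurableT_comp.
  - move=> x _; case E: (F x); last by rewrite mule0 mul0e.
    by rewrite mule1 mul1e lee_fin ltW// Fy.
have h3 : c%:E * (y%:E * t%:E) <= N.
  by apply: le_trans hN; rewrite lee_wpmul2l ?lee_fin.
apply: (@le_trans _ _ ((t `^ p^-1)^-1%:E * (C%:E * (c%:E * (y%:E * t%:E))))).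
  rewrite -!EFinM lee_fin /c powRDp// powRN powRr1 ?(ltW t0)//.
  rewrite le_eqVlt; apply/orP; left; apply/eqP.
  move: (t `^ p^-1)%R tp0 (C) C0 => u u0 C' C'0; field.
  by rewrite !gt_eqF.
rewrite lee_wpmul2l ?lee_fin ?invr_ge0 ?(ltW tp0)//.
by rewrite lee_wpmul2l ?lee_fin ?(ltW C0).
Qed.

End lorentz_lower.

(** * Hardy inequality *)

Section hardy.
Context {R : realType} (n : nat).
Local Notation mR := (measurableTypeR R).
Local Notation leb := (@lebesgue_measure R).
Local Notation mu := (@lebesgue_rV R n).
Implicit Types (g h G : 'rV[R]_n -> R).

(** A form of Young's inequality without constants: compare a and b. *)
Lemma powR_young (q a : R) (b : \bar R) : (1 <= q)%R -> (0 <= a)%R -> 0 <= b ->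
  (a `^ (q - 1))%:E * b <= (a `^ q)%:E + b `^ q.
Proof.
move=> q1 a0; have q0 : (0 < q)%R by lra.
case: b => [b b0|_|//]; last first.
  by rewrite poweRyr ?gt_eqF// addey// leey.
rewrite lee_fin in b0; rewrite poweR_EFin -EFinM -EFinD lee_fin.
have powS x : (0 <= x)%R -> (x `^ (q - 1) * x = x `^ q)%R.
  rewrite le_eqVlt => /orP[/eqP <-|x0]; first by rewrite mulr0 powR0// gt_eqF.
  by rewrite -[X in (_ * X)%R](powRr1 (ltW x0)) -powRDp// subrK.
have [ba|ab] := leP b a.
  apply: (@le_trans _ _ (a `^ q)%R); last by rewrite lerDl powR_ge0.
  by rewrite -powS// ler_wpM2l ?powR_ge0.
apply: (@le_trans _ _ (b `^ q)%R); last by rewrite lerDr powR_ge0.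
by rewrite -powS// ler_wpM2r// ge0_ler_powR ?nnegrE ?(ltW ab)// subr_ge0.
Qed.

Variables (p q : R) (p1 : (1 < p)%R) (q1 : (1 <= q)%R).
Variables (J : R -> bool) (w : R -> R).
Hypotheses (mJ : measurable_fun setT (J : mR -> bool)) (mw : measurable_fun setT (w : mR -> R)).
Hypotheses (J0 : forall s, J s -> (0 < s)%R) (w0 : forall s, (0 <= w s)%R).
Hypothesis w1 : \int[leb]_s (ind (J s) * (w s `^ q * s^-1)%:E) <= 1.

Let c0 : (0 < 1 - p^-1)%R.
Proof. by rewrite subr_gt0 invf_lt1// (lt_trans _ p1). Qed.

(** The measure ds/s is invariant under dilations. *)
Lemma Yint_dilate (sg : R) G : (0 < sg)%R -> measurable_fun setT G ->
  \int[leb]_s (ind (0 < s)%R * (Bfun p G (sg * s)%R `^ q * (s^-1)%:E)) = Yint p q G.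
Proof.
move=> s0 mG; rewrite /Yint [RHS](@ge0_integral_affine _ sg 0%R _ s0); last 2 first.
- exact: measurable_Yint_fun.
- by move=> s; exact: ge0_Yint_fun.
rewrite -[RHS]ge0_integralZl; last 4 first.
- exact: measurableT.
- exact: (measurableT_comp (measurable_Yint_fun p q mG) (measurable_affine sg 0%R)).
- by move=> s _; exact: ge0_Yint_fun.
- by rewrite lee_fin ltW.
apply: eq_integral => s _; rewrite addr0 pmulr_rgt0//.
case: (ltP 0%R s) => s1; last by rewrite !mul0e mule0.
rewrite !mul1e muleCA; congr (_ * _); rewrite -EFinM; congr EFin.
by field; rewrite !gt_eqF.
Qed.

(** The weight against the rearrangement of G dilated by sg: averages of G* over
    (0, s) are averages of its dilations over sg in (0, 1). *)
Definition hardyW G (sg s : R) : \bar R :=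
  ind (J s) * ((w s `^ (q - 1))%:E * Bfun p G (sg * s)%R * (s^-1)%:E).

Lemma hardyW_ge0 G sg s : 0 <= hardyW G sg s.
Proof.
rewrite /hardyW; case: (boolP (J s)) => [/J0 s0|_]; last by rewrite mul0e.
rewrite mule_ge0 ?ind_ge0// mule_ge0 ?lee_fin ?invr_ge0 ?(ltW s0)//.
by rewrite mule_ge0 ?Bfun_ge0// lee_fin powR_ge0.
Qed.

Lemma measurable_hardyW G : measurable_fun setT G ->
  measurable_fun setT (fun z : mR * mR => hardyW G z.1 z.2).
Proof.
move=> mG; apply: emeasurable_funM.
  by apply: measurable_ind; exact: (measurableT_comp mJ measurable_snd).
apply: emeasurable_funM; last first.
  apply/measurable_EFinP.
  exact: (measurableT_comp (@measurable_invr R) (@measurable_snd _ _ mR mR)).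
apply: emeasurable_funM.
  apply/measurable_EFinP; apply: (measurableT_comp (measurable_powRl (q - 1))).
  exact: (measurableT_comp mw measurable_snd).
apply: (measurableT_comp (measurable_Bfun p mG)).
by apply: measurable_funM; [exact: measurable_fst|exact: measurable_snd].
Qed.

Lemma integral_hardyW_le G sg : (0 < sg)%R -> measurable_fun setT G ->
  \int[leb]_s hardyW G sg s <= 1 + Yint p q G.
Proof.
move=> s0 mG; rewrite -(Yint_dilate s0 mG).
have mW : measurable_fun setT (fun s : mR => ind (J s) * (w s `^ q * s^-1)%:E).
  apply: emeasurable_funM; first exact: measurable_ind.
  apply/measurable_EFinP; apply: measurable_funM; last exact: measurable_invr.
  exact: (measurableT_comp (measurable_powRl q) mw).
have W0 s : 0 <= ind (J s) * (w s `^ q * s^-1)%:E.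
  rewrite /ind; case: (boolP (J s)) => [/J0 ss|_]; last by rewrite mul0e.
  by rewrite mul1e lee_fin mulr_ge0 ?powR_ge0// invr_ge0 ltW.
have mB : measurable_fun setT (fun s : mR => ind (0 < s)%R * (Bfun p G (sg * s)%R `^ q * (s^-1)%:E)).
  apply: emeasurable_funM; first by apply: measurable_ind; exact: measurable_fun_ltr.
  apply: emeasurable_funM; last by apply/measurable_EFinP; exact: measurable_invr.
  apply: measurable_poweR_fun; apply: (measurableT_comp (measurable_Bfun p mG)).
  exact: measurable_funM.
have B0 s : 0 <= ind (0 < s)%R * (Bfun p G (sg * s)%R `^ q * (s^-1)%:E).
  have [ss|ss] := ltP 0%R s; last by rewrite mul0e.
  by rewrite !mule_ge0 ?ind_ge0 ?poweR_ge0// lee_fin invr_ge0 ltW.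
apply: (@le_trans _ _ (\int[leb]_s (ind (J s) * (w s `^ q * s^-1)%:E +
    ind (0 < s)%R * (Bfun p G (sg * s)%R `^ q * (s^-1)%:E)))).
  apply: ge0_le_integral => //.
  - by move=> s _; exact: hardyW_ge0.
  - exact: (measurableT_comp (measurable_hardyW mG) (pair1_measurable (sg : mR))).
  - exact: emeasurable_funD.
  - move=> s _; rewrite /hardyW; case: (boolP (J s)) => [/J0 ss|_]; last by rewrite !mul0e add0e B0.
    rewrite ss !mul1e [X in _ <= X + _]EFinM -ge0_muleDl ?poweR_ge0// ?lee_fin ?powR_ge0//.
    by rewrite lee_wpmul2r ?lee_fin ?invr_ge0 ?(ltW ss)// powR_young// Bfun_ge0.
by rewrite ge0_integralD// leeD2r.
Qed.

(** The density of the superposition of test functions that recovers the norm of w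
    in L^q(ds/s): a test function of mass s pairs with g to about s g*(s), which is
    s^(1 - 1/p) times [Bfun]. *)
Definition hardy_weight (s : R) : R := (((J s)%:R : R) * (w s `^ (q - 1) * s `^ (p^-1 - 2)))%R.

Lemma hardy_weight_ge0 s : (0 <= hardy_weight s)%R.
Proof. by rewrite /hardy_weight !mulr_ge0 ?powR_ge0 ?ler0n. Qed.

Lemma measurable_hardy_weight : measurable_fun setT (hardy_weight : mR -> R).
Proof.
apply: measurable_funM.
  rewrite (_ : (fun _ => _) = fun s => if J s then 1%R else 0%R : R).
    exact: measurable_fun_ifT.
  by apply/funext => s; case: (J s).
apply: measurable_funM; last exact: measurable_powRl.
exact: (measurableT_comp (measurable_powRl (q - 1)) mw).
Qed.

Lemma hardy_weight_rearr G sg s : (0 < sg)%R ->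
  (hardy_weight s)%:E * (s%:E * rearr G (sg * s)%R) = (sg `^ (- p^-1))%:E * hardyW G sg s.
Proof.
move=> s0; rewrite /hardy_weight /hardyW /ind; case: (boolP (J s)) => [/J0 ss|_]; last first.
  by rewrite mul0r !mul0e mule0.
rewrite mul1r mul1e (rearr_Bfun p G (mulr_gt0 s0 ss)) powRM ?(ltW s0) ?(ltW ss)//.
move: (Bfun p G (sg * s)%R) => B.
rewrite [in RHS]muleAC ![in RHS]muleA [in LHS]muleA [in LHS]muleA -!EFinM; congr (_%:E * _).
rewrite (_ : (p^-1 - 2 = p^-1 - 1 - 1)%R); last by ring.
move: (w s `^ (q - 1))%R => W; rewrite !powRDp// !powRN powRr1 ?(ltW ss)//.
have : (0 < s `^ p^-1)%R by rewrite powR_gt0.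
have : (0 < sg `^ p^-1)%R by rewrite powR_gt0.
move: (s `^ p^-1)%R (sg `^ p^-1)%R => u v v0 u0; field.
by rewrite !gt_eqF.
Qed.

(** The average of G* over (0, s) is written as an integral over dilations
    sg in (0, 1] with weight sg^(-1/p), which is integrable since p > 1.  Each
    dilation is estimated by Young's inequality, and [Yint_dilate] removes the
    dilation. *)
Lemma hardy_inequality G : measurable_fun setT G ->
  \int[leb]_s ((hardy_weight s)%:E *
     (\int[leb]_t (ind (0 < t <= s)%R * rearr G t) + s%:E * rearr G s)) <=
  ((1 - p^-1)^-1 + 1)%:E * (1 + Yint p q G).
Proof.
move=> mG; have Y0 := Yint_ge0 p q G.
have mhw : measurable_fun setT (fun s : mR => (hardy_weight s)%:E).
  by apply/measurable_EFinP; exact: measurable_hardy_weight.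
have mr := measurable_rearr mG.
pose f1 (z : mR * mR) := ind (0 < z.2 <= 1)%R * ((z.2 `^ (- p^-1))%:E * hardyW G z.2 z.1).
have mf1 : measurable_fun setT f1.
  apply: emeasurable_funM.
    by apply: measurable_ind; exact: (measurableT_comp (measurable_oc (1:R)) measurable_snd).
  apply: emeasurable_funM.
    apply/measurable_EFinP; exact: (measurableT_comp (measurable_powRl (- p^-1)) (@measurable_snd _ _ mR mR)).
  exact: (measurableT_comp (measurable_hardyW mG) (@measurable_swap _ _ mR mR)).
have f10 z : 0 <= f1 z.
  by rewrite /f1 mule_ge0 ?ind_ge0// mule_ge0 ?hardyW_ge0// lee_fin powR_ge0.
have E1 s : (hardy_weight s)%:E * \int[leb]_t (ind (0 < t <= s)%R * rearr G t) =
    \int[leb]_sg f1 (s, sg).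
  have [Js|Js] := boolP (J s); last first.
    rewrite /hardy_weight (negbTE Js) mul0r mul0e (eq_integral (cst 0)) ?integral_cst ?mul0e//.
    by move=> sg _; rewrite /f1/= /hardyW (negbTE Js) mul0e !mule0.
  have s0 := J0 Js.
  rewrite (@ge0_integral_affine _ s 0%R _ s0); last 2 first.
  - by apply: measurable_ind_rearr => //; exact: measurable_oc.
  - by move=> t; rewrite mule_ge0 ?ind_ge0 ?rearr_ge0.
  rewrite muleA -ge0_integralZl//; last 3 first.
  - apply: emeasurable_funM.
      by apply: measurable_ind; exact: (measurableT_comp (measurable_oc s) (measurable_affine s 0%R)).
    exact: (measurableT_comp mr (measurable_affine s 0%R)).
  - by move=> t _; rewrite mule_ge0 ?ind_ge0 ?rearr_ge0.
  - by rewrite mule_ge0 ?lee_fin ?hardy_weight_ge0 ?ltW.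
  apply: eq_integral => sg _; rewrite /f1/= addr0 pmulr_rgt0//.
  have -> : (s * sg <= s)%R = (sg <= 1)%R by rewrite -[X in (_ <= X)%R]mulr1 ler_pM2l.
  case: (ltP 0%R sg) => sg0 /=; last by rewrite !mul0e mule0.
  by rewrite -(hardy_weight_rearr _ _ sg0) muleCA (mulrC s) -muleA.
have mf2 : measurable_fun setT (fun s : mR => (hardy_weight s)%:E * (s%:E * rearr G s)).
  by apply: emeasurable_funM => //; apply: emeasurable_funM => //; exact: EFin_measurable.
have f20 s : 0 <= (hardy_weight s)%:E * (s%:E * rearr G s).
  rewrite /hardy_weight; case: (boolP (J s)) => [/J0 s0|_]; last by rewrite mul0r mul0e.
  by rewrite !mule_ge0 ?rearr_ge0 ?lee_fin ?mulr_ge0 ?powR_ge0 ?ltW.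
have E s : (hardy_weight s)%:E *
     (\int[leb]_t (ind (0 < t <= s)%R * rearr G t) + s%:E * rearr G s) =
   \int[leb]_sg f1 (s, sg) + (hardy_weight s)%:E * (s%:E * rearr G s).
  rewrite -E1; have [Js|Js] := boolP (J s); last first.
    by rewrite /hardy_weight (negbTE Js) mul0r !mul0e adde0.
  rewrite ge0_muleDr//.
    by apply: integral_ge0 => t _; rewrite mule_ge0 ?ind_ge0 ?rearr_ge0.
  by rewrite mule_ge0 ?rearr_ge0// lee_fin ltW// J0.
under eq_integral do rewrite E.
rewrite ge0_integralD//; last 2 first.
- by move=> s _; apply: integral_ge0 => sg _; exact: f10.
- exact: measurable_fun_fubini_tonelli_F.
rewrite EFinD ge0_muleDl ?lee_fin ?invr_ge0 ?(ltW c0)//; apply: leeD; last first.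
  rewrite mul1e; apply: le_trans (integral_hardyW_le ltr01 mG).
  rewrite le_eqVlt; apply/orP; left; apply/eqP; apply: eq_integral => s _.
  by have := hardy_weight_rearr G s ltr01; rewrite mul1r powR1 mul1e.
rewrite (@fubini_tonelli _ _ _ _ _ leb leb f1)//.
apply: (@le_trans _ _ (\int[leb]_sg ((ind (0 < sg <= 1)%R * (sg `^ ((1 - p^-1) - 1))%:E) * (1 + Yint p q G)))).
  apply: ge0_le_integral => //.
  - by move=> sg _; apply: integral_ge0 => s _; exact: f10.
  - exact: (@measurable_fun_fubini_tonelli_G _ _ _ _ _ leb f1).
  - apply: emeasurable_funM => //; apply: emeasurable_funM.
      by apply: measurable_ind; exact: measurable_oc.
    by apply/measurable_EFinP; exact: measurable_powRl.
  - move=> sg _; rewrite /f1/=; case: (ltP 0%R sg) => sg0 /=; last first.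
      by rewrite !mul0e (eq_integral (cst 0)) ?integral_cst ?mul0e// => s _; rewrite mul0e.
    rewrite (_ : 1 - p^-1 - 1 = - p^-1)%R; last by ring.
    have mWs : measurable_fun setT (fun s : mR => hardyW G sg s).
      exact: (measurableT_comp (measurable_hardyW mG) (pair1_measurable (sg : mR))).
    under eq_integral do rewrite muleA.
    rewrite ge0_integralZl//.
    + rewrite lee_wpmul2l ?mule_ge0 ?ind_ge0 ?lee_fin ?powR_ge0//.
      exact: integral_hardyW_le.
    + by move=> s _; exact: hardyW_ge0.
    + by rewrite mule_ge0 ?ind_ge0 ?lee_fin ?powR_ge0.
rewrite ge0_integralZr//.
- by rewrite integral_powR01.
- apply: emeasurable_funM; first by apply: measurable_ind; exact: measurable_oc.
  by apply/measurable_EFinP; exact: measurable_powRl.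
- by move=> t _; rewrite mule_ge0 ?ind_ge0// lee_fin powR_ge0.
- by rewrite adde_ge0.
Qed.

End hardy.

(** * Recovering the Lorentz functional from the dual norm *)

Section lorentz_strong.
Context {R : realType} (n : nat).
Local Notation mR := (measurableTypeR R).
Local Notation leb := (@lebesgue_measure R).
Local Notation mu := (@lebesgue_rV R n).
Variables (p q : R) (p1 : (1 < p)%R) (q1 : (1 <= q)%R).
Variables (g : 'rV[R]_n -> R) (mg : measurable_fun setT g).
Variables (K0 : R) (gK0 : lorentz_norm p%:E +oo g <= K0%:E).

Let C : R := ((1 - p^-1)^-1 + 1)%R.
Let q0 : (0 < q)%R. Proof. exact: lt_le_trans q1. Qed.
Let p0 : (0 < p)%R. Proof. exact: lt_trans p1. Qed.
Let C0 : (0 < C)%R.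
Proof. by rewrite addr_gt0// invr_gt0 subr_gt0 invf_lt1. Qed.
Let K00 : (0 <= K0)%R.
Proof.
rewrite -lee_fin; apply: le_trans gK0; apply: lorentz_norm_ge0 => //.
by rewrite leey.
Qed.

(** A function in weak L^p has superlevel sets of finite measure, so they can be
    normalised. *)
Lemma distr_fun_lty (y : R) : (0 < y)%R -> distr_fun g y < +oo.
Proof.
move=> y0; rewrite ltNge; apply/negP => dy.
pose t := ((K0 / y + 1) `^ p)%R.
have k1 : (0 < K0 / y + 1)%R by rewrite ltr_wpDl// divr_ge0// ltW.
have t0 : (0 < t)%R by rewrite powR_gt0.
have ty : t%:E < distr_fun g y by apply: lt_le_trans dy; rewrite ltry.
have := le_trans (le_rearr y0 ty) (@rearr_weak _ _ p%:E g K0 t _ t0 gK0).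
rewrite lte_fin lee_fin => /(_ p1); rewrite /rinv inver gt_eqF//=.
rewrite powRN -powRrM mulfV ?gt_eqF// powRr1 ?(ltW k1)// ler_pdivlMr//.
by rewrite mulrDr mulr1 mulrCA mulfV ?gt_eqF// mulr1 leNgt ltrDl y0.
Qed.

Let b (s : R) : R := fine (Bfun p g s).

Let b0 s : (0 <= b s)%R. Proof. by rewrite fine_ge0// Bfun_ge0. Qed.

Let bE s : (0 < s)%R -> (b s)%:E = Bfun p g s.
Proof.
move=> s0; rewrite fineK// ge0_fin_numE ?Bfun_ge0//.
by apply: le_lt_trans (Bfun_le_weak g p1 s0) _; apply: le_lt_trans gK0 _; rewrite ltry.
Qed.

Let bK s : (0 < s)%R -> (b s <= K0)%R.
Proof. by move=> s0; rewrite -lee_fin bE// (le_trans (Bfun_le_weak g p1 s0)). Qed.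

Let mb : measurable_fun setT (b : mR -> R).
Proof. exact: (measurableT_comp (@fine_measurable R setT measurableT) (measurable_Bfun p mg)). Qed.

Let rE s : (0 < s)%R -> rearr g s = (s `^ (- p^-1) * b s)%:E.
Proof. by move=> s0; rewrite (rearr_Bfun p g s0) -bE// EFinM. Qed.

Variable m : R.
Hypothesis m1 : (1 <= m)%R.
Let Jm (s : R) : bool := (m^-1 <= s <= m)%R.
Let m0 : (0 < m)%R. Proof. exact: lt_le_trans m1. Qed.
Let Jm0 s : Jm s -> (0 < s)%R.
Proof. by move=> /andP[h _]; apply: lt_le_trans h; rewrite invr_gt0. Qed.
Let mJm : measurable_fun setT (Jm : mR -> bool).
Proof. by apply: measurable_and; exact: measurable_fun_ler. Qed.

(** The Lorentz functional restricted to [1/m, m], where it is finite for a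
    function in weak L^p; finiteness is needed in order to divide by it. *)
Definition truncY : \bar R := \int[leb]_s (ind (m^-1 <= s <= m)%R * (Bfun p g s `^ q * (s^-1)%:E)).

Let X := \int[leb]_s (ind (Jm s) * (b s `^ q * s^-1)%:E).

Let XE : truncY = X.
Proof.
apply: eq_integral => s _; rewrite /Jm.
case: (boolP (m^-1 <= s <= m)%R) => [Js|_]; last by rewrite !mul0e.
by rewrite -bE ?(Jm0 Js)// poweR_EFin -EFinM.
Qed.

Let mX : measurable_fun setT (fun s : mR => ind (Jm s) * (b s `^ q * s^-1)%:E).
Proof.
apply: emeasurable_funM; first exact: measurable_ind.
apply/measurable_EFinP; apply: measurable_funM; last exact: measurable_invr.
exact: (measurableT_comp (measurable_powRl q) mb).
Qed.

Let X0f s : 0 <= ind (Jm s) * (b s `^ q * s^-1)%:E.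
Proof.
case: (boolP (Jm s)) => [/Jm0 s0|_]; last by rewrite mul0e.
by rewrite mule_ge0 ?ind_ge0// lee_fin mulr_ge0 ?powR_ge0// invr_ge0 ltW.
Qed.

Let Xlty : X < +oo.
Proof.
apply: (@le_lt_trans _ _ (\int[leb]_s ((K0 `^ q * m)%:E * ind ((0 < s)%R && (s%:E < (m + 1)%:E))))).
  apply: ge0_le_integral => //.
  - apply: measurable_funeM; apply: measurable_ind; apply: measurable_and.
      exact: measurable_fun_ltr.
    by apply: measurable_fun_lte => //; exact: EFin_measurable.
  - move=> s _; case: (boolP (Jm s)) => [Js|_]; last first.
      by rewrite mul0e mule_ge0 ?ind_ge0// lee_fin mulr_ge0 ?powR_ge0 ?(ltW m0).
    have s0 := Jm0 Js; have /andP[ms sm] := Js.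
    rewrite s0 lte_fin (le_lt_trans sm) ?ltrDl//= mul1e mule1 lee_fin.
    rewrite ler_pM ?powR_ge0 ?invr_ge0 ?(ltW s0)//.
      by rewrite ge0_ler_powR ?nnegrE ?b0 ?bK ?(ltW q0).
    by rewrite invf_ple ?posrE.
rewrite ge0_integralZl//.
- by rewrite ind_layer ?lee_fin ?addr_ge0 ?(ltW m0)// -EFinM ltry.
- apply: measurable_ind; apply: measurable_and; first exact: measurable_fun_ltr.
  by apply: measurable_fun_lte => //; exact: EFin_measurable.
- by move=> s _; exact: ind_ge0.
- by rewrite lee_fin mulr_ge0 ?powR_ge0 ?(ltW m0).
Qed.

Let X0 : 0 <= X. Proof. by apply: integral_ge0 => s _; exact: X0f. Qed.
Let x : R := fine X.
Let Xx : X = x%:E. Proof. by rewrite fineK// ge0_fin_numE. Qed.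

Section positive.
Hypothesis x0 : (0 < x)%R.

Let w (s : R) : R := (b s * x `^ (- q^-1))%R.
Let J (s : R) : bool := Jm s && (0 < b s)%R.
Let w0 s : (0 <= w s)%R. Proof. by rewrite mulr_ge0 ?powR_ge0. Qed.
Let mw : measurable_fun setT (w : mR -> R). Proof. exact: measurable_funM. Qed.
Let mJ : measurable_fun setT (J : mR -> bool).
Proof. by apply: measurable_and => //; exact: measurable_fun_ltr. Qed.
Let J0 s : J s -> (0 < s)%R. Proof. by move=> /andP[/Jm0]. Qed.

(* vanishing values of b do not contribute *)
Let JJm s (u : R) : ind (J s) * (b s `^ q * u)%:E = ind (Jm s) * (b s `^ q * u)%:E.
Proof.
rewrite /J; case: (ltP 0%R (b s)) => [_|bs]; first by rewrite andbT.
have -> : b s = 0%R by apply/eqP; rewrite eq_le bs b0.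
by rewrite powR0 ?gt_eqF// mul0r !mule0.
Qed.

Let w1 : \int[leb]_s (ind (J s) * (w s `^ q * s^-1)%:E) <= 1.
Proof.
rewrite (eq_integral (fun s : mR => (x^-1)%:E * (ind (Jm s) * (b s `^ q * s^-1)%:E))).
  rewrite ge0_integralZl//; last by rewrite lee_fin invr_ge0 ltW.
  by rewrite -/X Xx -EFinM mulVf ?gt_eqF.
move=> s _; rewrite -JJm muleCA; congr (_ * _); rewrite -EFinM; congr (_%:E).
by rewrite /w powRM ?powR_ge0// -powRrM mulNr mulVf ?gt_eqF// powR_inv1 ?(ltW x0)//; ring.
Qed.

Let kap := hardy_weight p q J w.
Let kap0 s : (0 <= kap s)%R. Proof. exact: hardy_weight_ge0. Qed.
Let y (s : R) : R := (fine (rearr g s) / 2)%R.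
Let d (s : R) : \bar R := distr_fun g (y s).
Let th (s : R) : R := (s / fine (d s))%R.

Let yP s : J s -> (0 < y s)%R /\ (y s)%:E < rearr g s.
Proof.
move=> Js; have s0 := J0 Js; have /andP[_ bs] := Js.
have r0 : (0 < s `^ (- p^-1) * b s)%R by rewrite mulr_gt0// powR_gt0.
by rewrite /y rE//= lte_fin; split; lra.
Qed.

Let dP s : J s -> [/\ s%:E < d s, d s < +oo & d s = (fine (d s))%:E].
Proof.
move=> Js; have [y0 yr] := yP Js.
have d1 : d s < +oo by exact: distr_fun_lty.
split => //; first by apply: lt_rearr => //; exact: ltW.
by rewrite fineK// ge0_fin_numE ?distr_fun_ge0.
Qed.

Let thP s : J s -> (0 <= th s <= 1)%R /\ (th s)%:E * d s = s%:E.
Proof.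
move=> Js; have [sd _ dE] := dP Js; have s0 := J0 Js.
have sd' : (s < fine (d s))%R by rewrite -lte_fin -dE.
have d0 : (0 < fine (d s))%R by exact: lt_trans sd'.
split; last by rewrite dE -EFinM /th mulfVK// gt_eqF.
by rewrite divr_ge0 ?(ltW s0) ?(ltW d0)//= ler_pdivrMr// mul1r ltW.
Qed.

Let my : measurable_fun setT (y : mR -> R).
Proof.
apply: measurable_funM => //.
exact: (measurableT_comp (@fine_measurable R setT measurableT) (measurable_rearr mg)).
Qed.

Let md : measurable_fun setT (d : mR -> \bar R).
Proof. exact: (measurableT_comp (measurable_distr_fun mg) my). Qed.

Let mth : measurable_fun setT (th : mR -> R).
Proof.
apply: measurable_funM => //; apply: (measurableT_comp (@measurable_invr R)).
exact: (measurableT_comp (@fine_measurable R setT measurableT) md).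
Qed.

Let mkap : measurable_fun setT (kap : mR -> R).
Proof. exact: measurable_hardy_weight. Qed.

Let kapJ s : ~~ J s -> kap s = 0%R.
Proof. by move=> nJ; rewrite /kap /hardy_weight (negbTE nJ) mul0r. Qed.

Let kapth0 s : (0 <= kap s * th s)%R.
Proof.
have [Js|nJ] := boolP (J s); last by rewrite kapJ// mul0r.
by have [/andP[th0 _] _] := thP Js; rewrite mulr_ge0.
Qed.

Let hfun (z : 'rV[R]_n) : \bar R := \int[leb]_s ((kap s * th s)%:E * ind (y s < `|g z|)%R).

Let mhz : measurable_fun setT (fun z : 'rV[R]_n * mR => (kap z.2 * th z.2)%:E * ind (y z.2 < `|g z.1|)%R).
Proof.
apply: emeasurable_funM.
  apply/measurable_EFinP.
  exact: (measurableT_comp (measurable_funM mkap mth) (@measurable_snd _ _ 'rV[R]_n mR)).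
apply: measurable_ind; apply: measurable_fun_ltr.
  exact: (measurableT_comp my measurable_snd).
by apply: measurableT_comp => //; exact: (measurableT_comp mg measurable_fst).
Qed.

Let hz0 (z : 'rV[R]_n * mR) : 0 <= (kap z.2 * th z.2)%:E * ind (y z.2 < `|g z.1|)%R.
Proof. by rewrite mule_ge0 ?ind_ge0// lee_fin. Qed.

Let mh : measurable_fun setT hfun.
Proof. exact: (measurable_fun_fubini_tonelli_F _ mhz). Qed.

Let h0 z : 0 <= hfun z.
Proof. by apply: integral_ge0 => s _; exact: (hz0 (z, s)). Qed.

Let mFs s : measurable_fun setT (fun z : 'rV[R]_n => (y s < `|g z|)%R).
Proof. by apply: measurable_fun_ltr => //; exact: measurableT_comp. Qed.

Let pairing (G : 'rV[R]_n -> R) : measurable_fun setT G ->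
  \int[mu]_z (`|G z|%:E * hfun z) =
  \int[leb]_s ((kap s)%:E * ((th s)%:E * \int[mu]_z (ind (y s < `|g z|)%R * `|G z|%:E))).
Proof.
move=> mG; have mGE : measurable_fun setT (fun z => `|G z|%:E).
  by apply/measurable_EFinP; exact: measurableT_comp.
have mf : measurable_fun setT (fun z : 'rV[R]_n * mR => `|G z.1|%:E *
    ((kap z.2 * th z.2)%:E * ind (y z.2 < `|g z.1|)%R)).
  by apply: emeasurable_funM => //; exact: (measurableT_comp mGE measurable_fst).
transitivity (\int[mu]_z \int[leb]_s (`|G z|%:E * ((kap s * th s)%:E * ind (y s < `|g z|)%R))).
  apply: eq_integral => z _; rewrite ge0_integralZl//.
  - exact: (measurableT_comp mhz (pair1_measurable z)).
  - by move=> s _; exact: (hz0 (z, s)).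
rewrite (@fubini_tonelli _ _ _ _ _ mu leb (fun z : 'rV[R]_n * mR => `|G z.1|%:E *
    ((kap z.2 * th z.2)%:E * ind (y z.2 < `|g z.1|)%R)))//; last first.
  by move=> z; rewrite mule_ge0.
apply: eq_integral => s _; rewrite muleA -EFinM -ge0_integralZl//.
- by apply: eq_integral => z _ /=; rewrite muleCA [X in _ * X = _]muleC.
- by apply: emeasurable_funM => //; exact: measurable_ind.
- by move=> z _; rewrite mule_ge0 ?ind_ge0.
- by rewrite lee_fin.
Qed.

Let Hh : @Hset R n p q%:E (fun z => (C^-1)%:E * hfun z).
Proof.
have C'0 : (0 <= C^-1)%R by rewrite invr_ge0 ltW.
split; first exact: measurable_funeM.
  by move=> z; rewrite mule_ge0.
move=> G mG; have mGE : measurable_fun setT (fun z => `|G z|%:E).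
  by apply/measurable_EFinP; exact: measurableT_comp.
under eq_integral do rewrite muleCA.
rewrite ge0_integralZl//; last 2 first.
- exact: emeasurable_funM.
- by move=> z _; rewrite mule_ge0.
apply: (@le_trans _ _ (1 + Yint p q G)); last first.
  rewrite leeD2r// leeDl// lorentz_norm_ge0 ?lte_fin ?lee_fin//.
rewrite lee_pdivrMl// pairing//.
apply: le_trans (@hardy_inequality R n p q p1 q1 J w mJ mw J0 w0 w1 G mG).
have mKt : measurable_fun setT (fun s : mR => \int[mu]_z (ind (y s < `|g z|)%R * `|G z|%:E)).
  apply: (@measurable_fun_fubini_tonelli_F _ _ _ _ _ mu (fun z : mR * 'rV[R]_n => ind (y z.1 < `|g z.2|)%R * `|G z.2|%:E)).
    apply: emeasurable_funM; last exact: (measurableT_comp mGE measurable_snd).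
    apply: measurable_ind; apply: measurable_fun_ltr; first exact: (measurableT_comp my measurable_fst).
    by apply: measurableT_comp => //; exact: (measurableT_comp mg measurable_snd).
  by move=> z; rewrite mule_ge0 ?ind_ge0.
have int0 s : 0 <= \int[mu]_z (ind (y s < `|g z|)%R * `|G z|%:E).
  by apply: integral_ge0 => z _; rewrite mule_ge0 ?ind_ge0.
apply: ge0_le_integral => //.
- by move=> s _; rewrite muleA -EFinM mule_ge0 ?lee_fin.
- apply: emeasurable_funM; first by apply/measurable_EFinP.
  by apply: emeasurable_funM => //; apply/measurable_EFinP.
- apply: emeasurable_funM; first by apply/measurable_EFinP.
  apply: emeasurable_funD.
    apply: (@measurable_fun_fubini_tonelli_F _ _ _ _ _ leb (fun z : mR * mR => ind (0 < z.2 <= z.1)%R * rearr G z.2)).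
      apply: emeasurable_funM; last exact: (measurableT_comp (measurable_rearr mG) measurable_snd).
      apply: measurable_ind; apply: measurable_and; first exact: measurable_fun_ltr.
      by apply: measurable_fun_ler; [exact: measurable_snd|exact: measurable_fst].
    by move=> z; rewrite mule_ge0 ?ind_ge0 ?rearr_ge0.
  by apply: emeasurable_funM; [exact: EFin_measurable|exact: measurable_rearr].
- move=> s _; have [Js|nJ] := boolP (J s); last by rewrite kapJ// /hardy_weight (negbTE nJ) mul0r !mul0e.
  rewrite lee_wpmul2l ?lee_fin//.
  have [th01 thd] := thP Js.
  by apply: integral_tester_le => //; [exact: J0|rewrite thd].
Qed.

(** The test function [hfun] superposes the indicators of the sets where |g|
    exceeds half of g*(s), each weighted to mass s.  On such a set |g| is at least
    g*(s) / 2, so the pairing with g recovers the truncated functional. *)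
Lemma truncY_pos_le : (x `^ q^-1)%:E <= (2 * C)%:E * lorN p q%:E (fun z => `|g z|%:E).
Proof.
have C'0 : (0 <= C^-1)%R by rewrite invr_ge0 ltW.
have mgE : measurable_fun setT (fun z => `|g z|%:E).
  by apply/measurable_EFinP; exact: measurableT_comp.
rewrite EFinM -muleA -lee_pdivrMl// -lee_pdivrMl//.
apply: le_trans (dualN_ge _ Hh).
under [leRHS]eq_integral do rewrite muleCA.
rewrite [leRHS]ge0_integralZl//; last 2 first.
- exact: emeasurable_funM.
- by move=> z _; rewrite mule_ge0.
rewrite lee_wpmul2l// pairing//.
apply: (@le_trans _ _ (\int[leb]_s ((2^-1)%:E * ((x `^ (q^-1 - 1))%:E * (ind (Jm s) * (b s `^ q * s^-1)%:E))))).
  rewrite ge0_integralZl//; last 2 first.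
  - exact: measurable_funeM.
  - by move=> s _; rewrite mule_ge0// lee_fin powR_ge0.
  rewrite ge0_integralZl//; last by rewrite lee_fin powR_ge0.
  rewrite -/X Xx -!EFinM lee_fin ler_pM2l ?invr_gt0//.
  by rewrite powRDp// powRN powRr1 ?(ltW x0)// mulfVK// gt_eqF.
have int0 s : 0 <= \int[mu]_z (ind (y s < `|g z|)%R * `|g z|%:E).
  by apply: integral_ge0 => z _; rewrite mule_ge0 ?ind_ge0.
apply: ge0_le_integral => //.
- move=> s _; apply: mule_ge0; first by rewrite lee_fin.
  by apply: mule_ge0; [rewrite lee_fin powR_ge0|exact: X0f].
- by do 2 apply: measurable_funeM.
- apply: emeasurable_funM; first by apply/measurable_EFinP.
  apply: emeasurable_funM; first by apply/measurable_EFinP.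
  apply: (@measurable_fun_fubini_tonelli_F _ _ _ _ _ mu (fun z : mR * 'rV[R]_n => ind (y z.1 < `|g z.2|)%R * `|g z.2|%:E)).
    apply: emeasurable_funM; last exact: (measurableT_comp mgE measurable_snd).
    apply: measurable_ind; apply: measurable_fun_ltr; first exact: (measurableT_comp my measurable_fst).
    by apply: measurableT_comp => //; exact: (measurableT_comp mg measurable_snd).
  by move=> z; rewrite mule_ge0 ?ind_ge0.
move=> s _; rewrite -JJm; have [Js|nJ] := boolP (J s); last by rewrite kapJ// !mul0e !mule0.
have s0 := J0 Js; have [[/andP[th0 _] thd] [y0 yr]] := (thP Js, yP Js).
apply: (@le_trans _ _ ((kap s)%:E * ((th s)%:E * ((y s)%:E * d s)))); last first.
  rewrite lee_wpmul2l ?lee_fin// lee_wpmul2l ?lee_fin//.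
  have -> : d s = \int[mu]_z ind (y s < `|g z|)%R by rewrite integral_ind.
  rewrite -ge0_integralZl//; [|exact: measurable_ind|by move=> z _; exact: ind_ge0|by rewrite lee_fin ltW].
  apply: ge0_le_integral => //.
  + by move=> z _; rewrite mule_ge0 ?ind_ge0// lee_fin ltW.
  + by apply: measurable_funeM; exact: measurable_ind.
  + by apply: emeasurable_funM => //; exact: measurable_ind.
  + move=> z _; case: (ltP (y s)) => yg; last by rewrite mule0 mul0e.
    by rewrite mule1 mul1e lee_fin ltW.
have := @hardy_weight_rearr R n p q J w J0 g 1%R s ltr01.
rewrite mul1r powR1 mul1e /hardyW mul1r -bE// -/kap => hw.
have -> : (kap s)%:E * ((th s)%:E * ((y s)%:E * d s)) = (2^-1)%:E * ((kap s)%:E * (s%:E * rearr g s)).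
  rewrite [X in _ * X]muleCA thd /y.
  have -> : ((fine (rearr g s) / 2)%:E = (2^-1)%:E * rearr g s).
    by rewrite rE//= -EFinM mulrC.
  by rewrite -muleA [rearr g s * _]muleC [LHS]muleCA.
rewrite hw Js lee_wpmul2l ?lee_fin//. rewrite !mul1r.
have bs : (0 < b s)%R by case/andP: Js.
rewrite /w powRM ?powR_ge0// -powRrM.
rewrite (_ : - q^-1 * (q - 1) = q^-1 - 1)%R; last by field; rewrite gt_eqF.
rewrite powRDp// powRN powRr1 ?b0// le_eqVlt; apply/orP; left; apply/eqP.
move: (b s) bs (b s `^ q)%R (x `^ (q^-1 - 1))%R => u u0 v z; field.
by rewrite !gt_eqF.
Qed.

End positive.

Lemma truncY_le : truncY <= ((2 * C)%:E * lorN p q%:E (fun z => `|g z|%:E)) `^ q.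
Proof.
rewrite XE Xx; have := X0; rewrite Xx lee_fin le_eqVlt => /orP[/eqP <-|x0]; first exact: poweR_ge0.
have h := truncY_pos_le x0.
have -> : x%:E = (x `^ q^-1)%:E `^ q by rewrite poweR_EFin -powRrM mulVf ?gt_eqF// powRr1 ?ltW.
apply: gt0_ler_poweR; rewrite ?in_itv/= ?leey ?lee_fin ?powR_ge0 ?(ltW q0)//.
by rewrite andbT; apply: le_trans h; rewrite lee_fin powR_ge0.
Qed.

End lorentz_strong.

Section lorentz_good_norm.
Context {R : realType} (n : nat).
Local Notation mR := (measurableTypeR R).
Local Notation leb := (@lebesgue_measure R).
Local Notation mu := (@lebesgue_rV R n).

(** Monotone convergence in the truncation. *)
Lemma Yint_le_lorN (p q K0 : R) (g : 'rV[R]_n -> R) : (1 < p)%R -> (1 <= q)%R ->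
  measurable_fun setT g -> lorentz_norm p%:E +oo g <= K0%:E ->
  Yint p q g <= ((2 * ((1 - p^-1)^-1 + 1))%:E * lorN p q%:E (fun z => `|g z|%:E)) `^ q.
Proof.
move=> p1 q1 mg gK0; set D := (X in _ <= X).
pose f (k : nat) (s : mR) : \bar R :=
  ind ((k.+1%:R)^-1 <= s <= k.+1%:R)%R * (Bfun p g s `^ q * (s^-1)%:E).
have f0 k s : 0 <= f k s.
  rewrite /f; case: (boolP (_ <= s <= _)%R) => [/andP[ks _]|_]; last by rewrite mul0e.
  have s0 : (0 < s)%R by apply: lt_le_trans ks; rewrite invr_gt0.
  by rewrite mule_ge0 ?ind_ge0// mule_ge0 ?poweR_ge0// lee_fin invr_ge0 ltW.
have mf k : measurable_fun setT (f k).
  apply: emeasurable_funM.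
    by apply: measurable_ind; apply: measurable_and; exact: measurable_fun_ler.
  apply: emeasurable_funM; last by apply/measurable_EFinP; exact: measurable_invr.
  by apply: measurable_poweR_fun; exact: measurable_Bfun.
have nf s : {homo f^~ s : k l / (k <= l)%N >-> k <= l}.
  move=> k l kl; rewrite /f; case: (boolP (_ <= s <= _)%R) => [/andP[ks sk]|_]; last first.
    by rewrite mul0e; exact: f0.
  suff -> : (l.+1%:R^-1 <= s <= l.+1%:R)%R by [].
  rewrite (le_trans _ ks) ?(le_trans sk) ?ler_nat//.
  by rewrite lef_pV2 ?posrE// ler_nat.
have lf s : limn (f^~ s) = ind (0 < s)%R * (Bfun p g s `^ q * (s^-1)%:E).
  apply/cvg_lim => //; case: (ltP 0%R s) => s0; last first.
    rewrite mul0e; apply: cvg_near_cst; apply: nearW => k; rewrite /f.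
    have -> : (k.+1%:R^-1 <= s <= k.+1%:R)%R = false; last by rewrite mul0e.
    by apply/negbTE; rewrite negb_and -ltNge (le_lt_trans s0)// invr_gt0.
  apply: cvg_near_cst; near=> k; rewrite /f.
  suff -> : (k.+1%:R^-1 <= s <= k.+1%:R)%R by [].
  apply/andP; split.
    rewrite invf_ple ?posrE//; apply: (@le_trans _ _ k%:R); last by rewrite ler_nat.
    by near: k; exact: nbhs_infty_ger.
  apply: (@le_trans _ _ k%:R); last by rewrite ler_nat.
  by near: k; exact: nbhs_infty_ger.
have -> : Yint p q g = \int[leb]_s limn (f^~ s) by apply: eq_integral => s _; rewrite lf.
rewrite monotone_convergence//.
apply: lime_le.
  by apply: ereal_nondecreasing_is_cvgn => k l kl; apply: ge0_le_integral => // s _; exact: nf.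
apply: nearW => k; apply: (truncY_le p1 q1 mg gK0).
by rewrite ler1n.
Unshelve. all: by end_near.
Qed.

(** A norm in the abstract sense which is equivalent to that of the Lorentz
    space.  For [p = +oo] the supremum over all points is used instead of the
    essential one, which is why finiteness asks for an everywhere bounded
    function. *)
Lemma lorentz_good_norm (p q : \bar R) : 1 < p -> 1 <= q -> (p = +oo -> q = +oo) ->
  exists N : ('rV[R]_n -> \bar R) -> \bar R, [/\ good_norm N,
    forall g : 'rV[R]_n -> R, measurable_fun setT g -> lorentz_norm p q g < +oo ->
      supN (fun x => `|g x|%:E) < +oo -> N (fun x => `|g x|%:E) < +oo &
    forall C : R, exists C' : R, forall g : 'rV[R]_n -> R, measurable_fun setT g ->
      N (fun x => `|g x|%:E) <= C%:E -> lorentz_norm p q g <= C'%:E].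
Proof.
move: p => [p| |] // p1 q1 pq; last first.
  rewrite pq//; exists (@supN R n); split => //; first exact: good_norm_supN.
  move=> C; exists (Num.max C 0%R) => g mg gC; rewrite lorentz_norm_yE//.
  apply: ge_ereal_sup => _ [t +] <-; rewrite /= in_itv/= andbT => t0.
  rewrite /rinv invey/= powRr0 mul1e; apply: ge_ereal_sup => _ [->|[y [y0 dy] <-]].
    by rewrite lee_fin le_max lexx orbT.
  rewrite lee_fin le_max; apply/orP; left; rewrite leNgt; apply/negP => Cy.
  move: dy; rewrite /distr_fun (_ : mkset _ = set0) ?measure0 ?lte_fin ?(le_gtF (ltW t0))//.
  apply/seteqP; split => // x /= yx; have := le_trans (supN_ge _ x) gC; rewrite lee_fin.
  by rewrite leNgt (lt_trans Cy yx).
have {}p1 : (1 < p)%R by rewrite -lte_fin.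
have p0 : (0 < p)%R by lra.
have fin q' g : (1 <= q')%R -> lorentz_norm p%:E q'%:E g < +oo -> Yint p q' g < +oo.
  move=> q1' ; rewrite lorentz_normE => /lty_poweRy; rewrite invr_eq0 gt_eqF ?(lt_le_trans ltr01)// => /(_ isT).
  have q'0 : (0 < q')%R by lra.
  rewrite !ltey; apply: contra => /eqP ->; rewrite gt0_muley// lte_fin divr_gt0//.
exists (lorN p q); split; first exact: good_norm_lorN.
  move=> g mg lg _; apply: le_lt_trans (lorN_le p q mg) _.
  rewrite !lte_add_pinfty ?ltry//; case: q q1 lg {pq} => [q'| |]//= q1 lg.
  by apply: fin => //; rewrite -lee_fin.
move=> C; pose K := ((1 - p^-1)^-1 + 1)%R.
have K0 : (0 <= K)%R by rewrite addr_ge0// invr_ge0 subr_ge0 invf_le1 ?ltW.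
have wk (g : 'rV[R]_n -> R) : measurable_fun setT g -> lorN p q (fun x => `|g x|%:E) <= C%:E ->
    lorentz_norm p%:E +oo g <= (K * C)%:E.
  move=> mg gC; apply: le_trans (lorN_weak p1 q1 mg) _.
  by rewrite EFinM lee_wpmul2l ?lee_fin.
case: q q1 wk {pq} => [q'| |]// q1 wk; last by exists (K * C)%R.
have {}q1 : (1 <= q')%R by rewrite -lee_fin.
have q'0 : (0 < q')%R by lra.
exists ((q' / p * ((2 * K * Num.max C 0%R) `^ q')) `^ q'^-1)%R => g mg gC.
rewrite lorentz_normE -poweR_EFin.
have Y0 := Yint_ge0 p q' g.
apply: gt0_ler_poweR; rewrite ?in_itv/= ?leey ?andbT ?invr_ge0 ?(ltW q'0)//.
- by rewrite mule_ge0// lee_fin divr_ge0 ?ltW.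
- by rewrite lee_fin mulr_ge0 ?powR_ge0// divr_ge0 ?ltW.
rewrite [leRHS]EFinM lee_wpmul2l ?lee_fin ?divr_ge0 ?(ltW q'0) ?(ltW p0)//.
have gC' : lorN p q'%:E (fun z => `|g z|%:E) <= (Num.max C 0%R)%:E.
  by apply: le_trans gC _; rewrite lee_fin le_max lexx.
apply: le_trans (Yint_le_lorN p1 q1 mg (wk g mg gC)) _; rewrite -/K -poweR_EFin.
have N0 : 0 <= lorN p q'%:E (fun z => `|g z|%:E).
  have := le_trans _ (lorN_weak p1 (q:=q'%:E) (g:=g) _ mg).
  move=> /(_ 0) h.
  have : 0 <= K%:E * lorN p q'%:E (fun z => `|g z|%:E).
    by apply: h; [apply: lorentz_norm_ge0; rewrite ?leey ?lte_fin|rewrite lee_fin].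
  by rewrite pmule_rge0// lte_fin addr_gt0// invr_gt0 subr_gt0 invf_lt1.
apply: gt0_ler_poweR; rewrite ?in_itv/= ?leey ?andbT ?(ltW q'0)//.
- by rewrite mule_ge0// lee_fin mulr_ge0.
- by rewrite lee_fin mulr_ge0 ?mulr_ge0// le_max lexx orbT.
- by rewrite [leRHS]EFinM lee_wpmul2l// lee_fin mulr_ge0.
Qed.

End lorentz_good_norm.

(** * The bilinear operator as a space-time integral *)

Section spacetime.
Context {R : realType} (n : nat).
Local Notation mR := (measurableTypeR R).
Local Notation Z := (mR * 'rV[R]_n)%type.

(** Space-time Lebesgue measure: operators that integrate over past times and
    over space are written as one integral, so that linearity, domination and
    the Minkowski inequality apply once. *)
Definition spacetime : set Z -> \bar R := (@lebesgue_measure R) \x (@lebesgue_rV R n).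

HB.instance Definition _ := Measure.on spacetime.

Let spacetime_sigma_finite : sigma_finite setT spacetime.
Proof.
have /sigma_finiteP[F [UF ndF mF]] := sigma_finiteT (@lebesgue_measure R).
have /sigma_finiteP[G [UG ndG mG]] := sigma_finiteT (@lebesgue_rV R n).
exists (fun k => F k `*` G k).
  apply/esym; rewrite -subTset => x _.
  have [i _ Fi] : (\bigcup_i F i) x.1 by rewrite -UF.
  have [j _ Gj] : (\bigcup_i G i) x.2 by rewrite -UG.
  exists (maxn i j) => //; split.
  - exact: (subsetPset _ _ (ndF _ _ (leq_maxl i j))).
  - exact: (subsetPset _ _ (ndG _ _ (leq_maxr i j))).
move=> k; have [mFk Fk] := mF k; have [mGk Gk] := mG k; split.
  exact: measurableX.
by rewrite /spacetime product_measure1E// lte_mul_pinfty// ge0_fin_numE.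
Qed.

HB.instance Definition _ := Measure_isSigmaFinite.Build _ _ _ spacetime
  spacetime_sigma_finite.

Lemma spacetimeE (f : Z -> \bar R) : measurable_fun setT f -> (forall z, 0 <= f z) ->
  \int[spacetime]_z f z = \int[@lebesgue_measure R]_s \int[@lebesgue_rV R n]_y f (s, y).
Proof.
by move=> mf f0; rewrite -(@fubini_tonelli1 _ _ _ _ _ (@lebesgue_measure R) (@lebesgue_rV R n)).
Qed.

Lemma Rintegral_spacetime (f : Z -> R) : measurable_fun setT f ->
  \int[spacetime]_z `|f z|%:E < +oo ->
  (\int[spacetime]_z f z = \int[@lebesgue_measure R]_s \int[@lebesgue_rV R n]_y f (s, y))%R.
Proof.
move=> mf foo.
have fi : ((@lebesgue_measure R) \x (@lebesgue_rV R n))%E.-integrable setT (EFin \o f).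
  by apply/integrableP; split; [exact/measurable_EFinP|exact: foo].
rewrite /Rintegral (Rintegral_fine (integrable_fubini_F fi)).
by congr fine; rewrite -(integral12_prod_meas1 fi).
Qed.

End spacetime.

Section tensor_operator.
Context {R : realType} (n : nat).
Local Notation mR := (measurableTypeR R).
Local Notation leb := (@lebesgue_measure R).
Local Notation mu := (@lebesgue_rV R n).
Local Notation Z := (mR * 'rV[R]_n)%type.
Local Notation Pi := (@spacetime R n).

Lemma fnorm_mulmx (I J : finType) (a : I * J -> R) (b : J -> R) :
  (fnorm (fun i => \sum_j a (i, j) * b j) <= fnorm a * fnorm b)%R.
Proof.
rewrite -(@ler_pXn2r _ 2)// ?nnegrE ?mulr_ge0 ?fnorm_ge0// exprMn !fnorm_sqr.
rewrite (eq_bigr (fun p => a (p.1, p.2) ^+ 2)%R) => [|[]//].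
rewrite -(pair_bigA _ (fun i j => a (i, j) ^+ 2)%R)/= mulr_suml; apply: ler_sum => i _.
rewrite -!fnorm_sqr -exprMn -[X in (X <= _)%R]real_normK ?num_real//.
rewrite lerXn2r// ?nnegrE ?mulr_ge0 ?fnorm_ge0// ler_norml cauchy_schwarz andbT.
rewrite lerNl -sumrN; have := cauchy_schwarz (fun j => (-1) * a (i, j))%R b.
rewrite fnormZ normrN1 mul1r; apply: le_trans; apply: ler_sum => j _.
by rewrite mulN1r mulNr.
Qed.

Lemma measurable_stpair d (T : measurableType d) (f : T -> mR) (g : T -> 'rV[R]_n) :
  measurable_fun setT f -> measurable_fun setT g ->
  measurable_fun setT (fun z => (f z, g z) : Z).
Proof. by move=> mf mg; apply/measurable_fun_pairP. Qed.

Lemma measurable_natr_bool d (T : measurableType d) (b : T -> bool) :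
  measurable_fun setT b -> measurable_fun setT (fun z => (b z)%:R : R).
Proof. by move=> mb; apply/measurable_EFinP; exact: measurable_ind. Qed.

(** The Frobenius norm of the gradient of the Oseen kernel in its Fourier
    form, which is jointly measurable in time and space. *)
Definition gradn (t : R) (x : 'rV[R]_n) : R :=
  fnorm (fun e : 'I_n * ('I_n * 'I_n) => grad_oseen_fourier e.2.2 e.1 e.2.1 t x).

Lemma gradn_ge0 t x : (0 <= gradn t x)%R. Proof. exact: fnorm_ge0. Qed.

Lemma grad_oseen_normE t x : (0 < t)%R -> grad_oseen_norm t x = gradn t x.
Proof.
move=> t0; rewrite /grad_oseen_norm /gradn /fnorm; congr Num.sqrt.
rewrite -(pair_bigA _ (fun i (e : 'I_n * 'I_n) => grad_oseen_fourier e.2 i e.1 t x ^+ 2)%R)/=.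
rewrite exchange_big/=; apply: eq_bigr => i _.
rewrite -(pair_bigA _ (fun j k => grad_oseen_fourier k i j t x ^+ 2)%R)/= exchange_big/=.
by apply: eq_bigr => j _; apply: eq_bigr => k _; rewrite grad_oseenE.
Qed.

Lemma measurable_gradn : measurable_fun setT (fun z : Z => gradn z.1 z.2).
Proof. by apply: measurable_fnorm => e; exact: measurable_grad_oseen_fourier. Qed.

Implicit Types (M : Z -> 'I_n * 'I_n -> R) (w : Z -> \bar R).

(** The integrand of [Bt], cut off to the times that precede t. *)
Definition kerB M (i : 'I_n) (t : R) (x : 'rV[R]_n) (z : Z) : R :=
  ((0 < z.1 < t)%R%:R *
   \sum_jk grad_oseen_fourier jk.2 i jk.1 (t - z.1) (x - z.2) * M z jk)%R.

(** The bilinear operator written for a general source tensor in place of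
    [u (x) u], as one integral over space-time: its dependence on the source
    is linear, and every manipulation below uses only that. *)
Definition Bt M (t : R) (x : 'rV[R]_n) : 'rV[R]_n := \row_i (\int[Pi]_z kerB M i t x z)%R.

(** The size of [Bt] when cancellations are given up.  It takes extended real
    values, so it also decides whether [Bt] converges. *)
Definition Et w (t : R) (x : 'rV[R]_n) : \bar R :=
  \int[Pi]_z (ind (0 < z.1 < t)%R * ((gradn (t - z.1) (x - z.2))%:E * w z)).

Definition msource M := forall jk, measurable_fun setT (fun z => M z jk).

Lemma kerB_le M t x z :
  (fnorm (fun i => kerB M i t x z) <=
     (0 < z.1 < t)%R%:R * (gradn (t - z.1) (x - z.2) * fnorm (M z)))%R.
Proof.
rewrite /kerB fnormZ normr_nat ler_wpM2l//.
exact: (fnorm_mulmx (fun e => grad_oseen_fourier e.2.2 e.1 e.2.1 (t - z.1) (x - z.2))).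
Qed.

(** All kernels are evaluated at the difference of two space-time points. *)
Lemma measurable_shifted d (T : measurableType d) (a b : T -> Z) :
  measurable_fun setT a -> measurable_fun setT b ->
  measurable_fun setT (fun z => ((a z).1 - (b z).1, (a z).2 - (b z).2)%R : Z).
Proof.
move=> ma mb; apply: measurable_stpair.
  apply: measurable_funB; first exact: (measurableT_comp measurable_fst ma).
  exact: (measurableT_comp measurable_fst mb).
apply: measurable_funB_rV; first exact: (measurableT_comp measurable_snd ma).
exact: (measurableT_comp measurable_snd mb).
Qed.

Lemma measurable_window d (T : measurableType d) (a b : T -> Z) :
  measurable_fun setT a -> measurable_fun setT b ->
  measurable_fun setT (fun z => (0 < (b z).1 < (a z).1)%R).
Proof.
move=> ma mb; apply: measurable_and; apply: measurable_fun_ltr => //.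
- exact: (measurableT_comp measurable_fst mb).
- exact: (measurableT_comp measurable_fst mb).
- exact: (measurableT_comp measurable_fst ma).
Qed.

Lemma measurable_grad_shifted k i j d (T : measurableType d) (a b : T -> Z) :
  measurable_fun setT a -> measurable_fun setT b ->
  measurable_fun setT (fun z => grad_oseen_fourier k i j ((a z).1 - (b z).1)%R ((a z).2 - (b z).2)%R).
Proof.
move=> ma mb.
exact: (measurableT_comp (measurable_grad_oseen_fourier k i j) (measurable_shifted ma mb)).
Qed.

Lemma measurable_gradn_shifted d (T : measurableType d) (a b : T -> Z) :
  measurable_fun setT a -> measurable_fun setT b ->
  measurable_fun setT (fun z => gradn ((a z).1 - (b z).1)%R ((a z).2 - (b z).2)%R).
Proof.
by move=> ma mb; exact: (measurableT_comp measurable_gradn (measurable_shifted ma mb)).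
Qed.

Lemma measurable_kerB2 M i : msource M ->
  measurable_fun setT (fun z : Z * Z => kerB M i z.1.1 z.1.2 z.2).
Proof.
move=> mM; apply: measurable_funM.
  by apply: measurable_natr_bool; exact: (measurable_window measurable_fst measurable_snd).
apply: measurable_sum => jk; apply: measurable_funM; last exact: (measurableT_comp (mM jk) measurable_snd).
exact: (measurable_grad_shifted _ _ _ measurable_fst measurable_snd).
Qed.

Lemma measurable_kerB M i t x : msource M -> measurable_fun setT (kerB M i t x).
Proof. by move=> mM; exact: (measurableT_comp (measurable_kerB2 i mM) (pair1_measurable ((t, x) : Z))). Qed.

Lemma measurable_Bt M : msource M -> measurable_fun setT (fun z : Z => Bt M z.1 z.2).
Proof.
move=> mM; apply: measurable_fun_rV => i; under eq_fun do rewrite mxE.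
have h := @measurable_fun_Rintegral _ _ _ _ R Pi (fun z : Z * Z => kerB M i z.1.1 z.1.2 z.2) (measurable_kerB2 i mM).
exact: h.
Qed.

Lemma measurable_Et_fun w : measurable_fun setT w -> measurable_fun setT
  (fun z : Z * Z => ind (0 < z.2.1 < z.1.1)%R * ((gradn (z.1.1 - z.2.1) (z.1.2 - z.2.2))%:E * w z.2)).
Proof.
move=> mw; apply: emeasurable_funM.
  by apply: measurable_ind; exact: (measurable_window measurable_fst measurable_snd).
apply: emeasurable_funM; last exact: (measurableT_comp mw measurable_snd).
apply/measurable_EFinP.
exact: (measurable_gradn_shifted measurable_fst measurable_snd).
Qed.

Lemma ge0_Et_fun w t x z : (forall z, 0 <= w z) ->
  0 <= ind (0 < z.1 < t)%R * ((gradn (t - z.1) (x - z.2))%:E * w z).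
Proof. by move=> w0; rewrite mule_ge0 ?ind_ge0// mule_ge0// lee_fin gradn_ge0. Qed.

Lemma Et_ge0 w t x : (forall z, 0 <= w z) -> 0 <= Et w t x.
Proof. by move=> w0; apply: integral_ge0 => z _; exact: ge0_Et_fun. Qed.

Lemma measurable_Et w t : measurable_fun setT w -> (forall z, 0 <= w z) ->
  measurable_fun setT (Et w t).
Proof.
move=> mw w0.
have := @measurable_fun_fubini_tonelli_F _ _ _ _ _ Pi _ (measurable_Et_fun mw).
move=> /(_ (fun z => ge0_Et_fun z.1.1 z.1.2 z.2 w0)) h.
exact: (measurableT_comp h (pair1_measurable (t : mR))).
Qed.

Lemma le_Et w w' t x : measurable_fun setT w -> measurable_fun setT w' -> (forall z, 0 <= w z) ->
  (forall z, (0 < z.1 < t)%R -> w z <= w' z) -> Et w t x <= Et w' t x.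
Proof.
move=> mw mw' w0 ww'; have mE v : measurable_fun setT v -> measurable_fun setT
   (fun z : Z => ind (0 < z.1 < t)%R * ((gradn (t - z.1) (x - z.2))%:E * v z)).
  by move=> mv; exact: (measurableT_comp (measurable_Et_fun mv) (pair1_measurable ((t, x) : Z))).
apply: ge0_le_integral => //.
- by move=> z _; exact: ge0_Et_fun.
- exact: mE.
- exact: mE.
- move=> z _; case: (boolP (0 < z.1 < t)%R) => zt; last by rewrite !mul0e.
  by rewrite lee_wpmul2l ?ind_ge0// lee_wpmul2l ?lee_fin ?gradn_ge0// ww'.
Qed.

Definition srcn M (z : Z) : \bar R := (fnorm (M z))%:E.

Lemma measurable_srcn M : msource M -> measurable_fun setT (srcn M).
Proof. by move=> mM; apply/measurable_EFinP; exact: measurable_fnorm. Qed.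

Lemma srcn_ge0 M z : 0 <= srcn M z. Proof. by rewrite lee_fin fnorm_ge0. Qed.

Lemma integrable_kerB M i t x : msource M -> Et (srcn M) t x < +oo ->
  Pi.-integrable setT (EFin \o kerB M i t x).
Proof.
move=> mM Eoo; apply: integrable_dominated Eoo.
- exact: measurable_kerB.
- exact: (measurableT_comp (measurable_Et_fun (measurable_srcn mM)) (pair1_measurable ((t, x) : Z))).
- move=> z; rewrite /srcn -!EFinM lee_fin.
  exact: le_trans (ler_fnorm (fun i => kerB M i t x z) i) (kerB_le M t x z).
Qed.

(** When the majorant is infinite there is nothing to prove; otherwise every
    component converges absolutely. *)
Lemma Bt_le M t x : msource M -> (enorm (Bt M t x))%:E <= Et (srcn M) t x.
Proof.
move=> mM; have [Eoo|] := ltP (Et (srcn M) t x) +oo; last by rewrite leye_eq => /eqP ->; rewrite leey.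
have iK i := integrable_kerB i mM Eoo.
rewrite enormE (_ : (fun i => _) = (fun i => \int[Pi]_z kerB M i t x z)%R); last first.
  by apply/funext => i; rewrite mxE.
apply: (@le_trans _ _ (\int[Pi]_z fnorm (fun i => kerB M i t x z))%R%:E).
  by rewrite lee_fin; exact: (fnorm_Rintegral iK).
rewrite EFin_Rintegral; last exact: integrable_fnorm.
apply: ge0_le_integral => //.
- by move=> z _; rewrite lee_fin fnorm_ge0.
- by apply/measurable_EFinP; apply: measurable_fnorm => i; exact: measurable_kerB.
- exact: (measurableT_comp (measurable_Et_fun (measurable_srcn mM)) (pair1_measurable ((t, x) : Z))).
- by move=> z _; rewrite /srcn -!EFinM lee_fin; exact: kerB_le.
Qed.

Lemma BtD M M' t x : msource M -> msource M' ->
  Et (srcn M) t x < +oo -> Et (srcn M') t x < +oo ->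
  Bt (fun z jk => M z jk + M' z jk)%R t x = (Bt M t x + Bt M' t x)%R.
Proof.
move=> mM mM' E1 E2; apply/rowP => i; rewrite !mxE.
rewrite -RintegralD//; [|exact: integrable_kerB|exact: integrable_kerB].
apply: eq_Rintegral => z _; rewrite /kerB -mulrDr -big_split/=; congr (_ * _)%R.
by apply: eq_bigr => jk _; rewrite mulrDr.
Qed.

Lemma BtB M M' t x : msource M -> msource M' ->
  Et (srcn M) t x < +oo -> Et (srcn M') t x < +oo ->
  Bt (fun z jk => M z jk - M' z jk)%R t x = (Bt M t x - Bt M' t x)%R.
Proof.
move=> mM mM' E1 E2; apply/rowP => i; rewrite !mxE.
rewrite -RintegralB//; [|exact: integrable_kerB|exact: integrable_kerB].
apply: eq_Rintegral => z _; rewrite /kerB -mulrBr -sumrB; congr (_ * _)%R.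
by apply: eq_bigr => jk _; rewrite mulrBr.
Qed.

Lemma eq_Bt M M' t x : (forall z jk, (0 < z.1 < t)%R -> M z jk = M' z jk) -> Bt M t x = Bt M' t x.
Proof.
move=> MM'; apply/rowP => i; rewrite !mxE; apply: eq_Rintegral => z _; rewrite /kerB.
case: (boolP (0 < z.1 < t)%R) => zt; last by rewrite !mul0r.
by congr (_ * _)%R; apply: eq_bigr => jk _; rewrite MM'.
Qed.

End tensor_operator.

(** * Bounds on the heat flow and on the bilinear operator *)

Section operator_bounds.
Context {R : realType} (n : nat).
Local Notation mR := (measurableTypeR R).
Local Notation leb := (@lebesgue_measure R).
Local Notation mu := (@lebesgue_rV R n).
Local Notation Z := (mR * 'rV[R]_n)%type.
Local Notation Pi := (@spacetime R n).
Variables (gamma : R) (gamma0 : (0 < gamma)%R).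
Hypothesis gammaP : forall t : R, (0 < t)%R ->
  \int[mu]_x (@grad_oseen_norm R n t x)%:E <= (gamma * t `^ (- 2^-1))%:E.
Implicit Types (f : 'rV[R]_n -> 'rV[R]_n) (w : Z -> \bar R).

Lemma measurable_gradnt t : measurable_fun setT (fun x : 'rV[R]_n => (gradn t x)%:E).
Proof.
by apply/measurable_EFinP; exact: (measurableT_comp (@measurable_gradn R n) (pair1_measurable (t : mR))).
Qed.

Lemma integral_gradn t : (0 < t)%R -> \int[mu]_x (gradn t x)%:E <= (gamma * t `^ (- 2^-1))%:E.
Proof.
by move=> t0; apply: le_trans (gammaP t0); under [leRHS]eq_integral do rewrite grad_oseen_normE//.
Qed.

Lemma measurable_ind_window t : measurable_fun setT (fun z : Z => ind (0 < z.1 < t)%R : \bar R).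
Proof.
by apply: measurable_ind; apply: measurable_and; apply: measurable_fun_ltr => //; exact: measurable_fst.
Qed.

Lemma measurable_gradn_lag t : measurable_fun setT (fun z : Z => (gradn (t - z.1) z.2)%:E).
Proof.
have mt : measurable_fun setT (fun z : Z => (t - z.1)%R : mR).
  by apply: measurable_funB => //; exact: measurable_fst.
apply/measurable_EFinP.
exact: (measurableT_comp (@measurable_gradn R n) (measurable_stpair mt measurable_snd)).
Qed.

(** The convolution is commuted: the kernel no longer depends on x, and the source
    is translated, as Minkowski's inequality requires. *)
Lemma Et_convE w t x : measurable_fun setT w -> (forall z, 0 <= w z) ->
  Et w t x = \int[Pi]_z (ind (0 < z.1 < t)%R * ((gradn (t - z.1) z.2)%:E * w (z.1, x - z.2)%R)).
Proof.
move=> mw w0; have mF := measurable_Et_fun mw.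
have mx : measurable_fun setT (fun z : Z => (x - z.2)%R).
  by apply: measurable_funB_rV; [exact: measurable_cst|exact: measurable_snd].
have mH : measurable_fun setT (fun z : Z => ind (0 < z.1 < t)%R * ((gradn (t - z.1) z.2)%:E * w (z.1, x - z.2)%R)).
  apply: emeasurable_funM; first exact: measurable_ind_window.
  apply: emeasurable_funM; first exact: measurable_gradn_lag.
  exact: (measurableT_comp mw (measurable_stpair measurable_fst mx)).
have mF1 : measurable_fun setT (fun z : Z => ind (0 < z.1 < t)%R * ((gradn (t - z.1) (x - z.2))%:E * w z)).
  exact: (measurableT_comp mF (pair1_measurable ((t, x) : Z))).
rewrite /Et (spacetimeE mF1 (fun z => ge0_Et_fun t x z w0)) (spacetimeE mH); last first.
  by move=> z; rewrite mule_ge0 ?ind_ge0// mule_ge0// lee_fin gradn_ge0.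
apply: eq_integral => s _; rewrite -[LHS](@ge0_integral_reflect_rV _ _ x).
- by apply: eq_integral => y _ /=; rewrite subKr.
- exact: (measurableT_comp mF1 (pair1_measurable s)).
- by move=> y; exact: (ge0_Et_fun t x (s, y)).
Qed.

(** What remains of [Et] once the space integral is estimated. *)
Definition timeI (t : R) (ub : R -> \bar R) : \bar R :=
  \int[leb]_s (ind (0 < s < t)%R * ((gamma * (t - s) `^ (- 2^-1))%:E * ub s)).

Lemma measurable_timeI_fun (t : R) (ub : mR -> \bar R) : measurable_fun setT ub ->
  measurable_fun setT (fun s : mR => ind (0 < s < t)%R * ((gamma * (t - s) `^ (- 2^-1))%:E * ub s)).
Proof.
move=> mub; apply: emeasurable_funM; first by apply: measurable_ind; exact: measurable_oo.
apply: emeasurable_funM => //; apply/measurable_EFinP; apply: measurable_funM => //.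
apply: (measurableT_comp (measurable_powRl _)); exact: measurable_funB.
Qed.

(** The heart of the theory: in any norm that is translation invariant and
    satisfies Minkowski's inequality, the space convolution costs only the
    L1 norm of the kernel. *)
Lemma Et_norm N w (ub : mR -> \bar R) t : good_norm N -> measurable_fun setT w ->
  (forall z, 0 <= w z) -> measurable_fun setT ub -> (forall s, 0 <= ub s) ->
  (forall s, (0 < s < t)%R -> N (fun x => w (s, x)) <= ub s) ->
  N (Et w t) <= timeI t ub.
Proof.
move=> gN mw w0 mub ub0 wub.
rewrite (_ : Et w t = fun x => \int[Pi]_z (ind (0 < z.1 < t)%R *
    ((gradn (t - z.1) z.2)%:E * w (z.1, x - z.2)%R))); last first.
  by apply/funext => x; exact: Et_convE.
pose ub' (z : Z) : \bar R := ind (0 < z.1 < t)%R * ((gradn (t - z.1) z.2)%:E * ub z.1).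
have mub' : measurable_fun setT ub'.
  apply: emeasurable_funM; first exact: measurable_ind_window.
  apply: emeasurable_funM; first exact: measurable_gradn_lag.
  exact: (measurableT_comp mub measurable_fst).
have ub'0 z : 0 <= ub' z by rewrite /ub' mule_ge0 ?ind_ge0// mule_ge0// lee_fin gradn_ge0.
apply: (@le_trans _ _ (\int[Pi]_z ub' z)).
  apply: (@gn_mink _ _ _ gN _ _ Pi (fun zx : Z * 'rV[R]_n => ind (0 < zx.1.1 < t)%R *
    ((gradn (t - zx.1.1) zx.1.2)%:E * w (zx.1.1, zx.2 - zx.1.2)%R)) ub') => //.
  - apply: emeasurable_funM; first exact: (measurableT_comp (measurable_ind_window t) measurable_fst).
    apply: emeasurable_funM; first exact: (measurableT_comp (measurable_gradn_lag t) measurable_fst).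
    apply: (measurableT_comp mw); apply: measurable_stpair.
      exact: (measurableT_comp measurable_fst measurable_fst).
    apply: measurable_funB_rV; first exact: measurable_snd.
    exact: (measurableT_comp measurable_snd measurable_fst).
  - by move=> z; rewrite mule_ge0 ?ind_ge0// mule_ge0// lee_fin gradn_ge0.
  - move=> z /=; have mws : measurable_fun setT (fun x : 'rV[R]_n => w (z.1, x)).
      exact: (measurableT_comp mw (pair1_measurable z.1)).
    have mws' : measurable_fun setT (fun x : 'rV[R]_n => w (z.1, x - z.2)%R).
      by apply: (measurableT_comp mws); apply: measurable_funB_rV => //; exact: measurable_cst.
    rewrite /ub'; case: (boolP (0 < z.1 < t)%R) => zt.
      rewrite mul1e (_ : (fun x => _) = fun x => (gradn (t - z.1) z.2)%:E * w (z.1, x - z.2)%R); last first.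
        by apply/funext => x; rewrite mul1e.
      apply: le_trans (gn_scale gN _ _ _) _ => //; first exact: gradn_ge0.
      rewrite lee_wpmul2l ?lee_fin ?gradn_ge0//; apply: le_trans (wub _ zt).
      exact: (gn_shift gN z.2 mws).
    rewrite mul0e (_ : (fun x => _) = fun x => 0%:E * w (z.1, x)); last first.
      by apply/funext => x; rewrite !mul0e.
    by apply: le_trans (gn_scale gN _ _ _) _ => //; rewrite mul0e.
rewrite (spacetimeE mub' ub'0); apply: ge0_le_integral => //.
- by move=> s _; apply: integral_ge0 => y _; exact: ub'0.
- exact: (measurable_fun_fubini_tonelli_F _ mub').
- exact: measurable_timeI_fun.
- move=> s _; rewrite /ub'/=; case: (boolP (0 < s < t)%R) => st; last first.
    by under eq_integral do rewrite mul0e; rewrite integral0 mul0e.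
  under eq_integral do rewrite mul1e; rewrite mul1e.
  rewrite ge0_integralZr//; [|exact: measurable_gradnt|by move=> y _; rewrite lee_fin gradn_ge0].
  by apply: lee_wpmul2r => //; apply: integral_gradn; rewrite subr_gt0; case/andP: st.
Qed.

Lemma Et_le_sup w (ub : mR -> \bar R) t x : measurable_fun setT w ->
  (forall z, 0 <= w z) -> measurable_fun setT ub -> (forall s, 0 <= ub s) ->
  (forall s y, (0 < s < t)%R -> w (s, y) <= ub s) -> Et w t x <= timeI t ub.
Proof.
move=> mw w0 mub ub0 wub; apply: le_trans (supN_ge (Et w t) x) _.
apply: Et_norm => //; first exact: good_norm_supN.
by move=> s st; apply: supN_le => y; exact: wub.
Qed.

Lemma timeI_pow (t C c : R) : (0 < t)%R -> (0 <= C)%R ->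
  timeI t (fun s => (C * s `^ (- c))%:E) =
  (gamma * C * t `^ (2^-1 - c))%:E * betaI 2^-1 c.
Proof.
move=> t0 C0; rewrite /timeI.
rewrite (eq_integral (fun s : mR => (gamma * C)%:E * (ind (0 < s < t)%R * ((t - s) `^ (- 2^-1) * s `^ (- c))%:E))).
  rewrite ge0_integralZl; last 4 first.
  - exact: measurableT.
  - exact: measurable_kernel_time.
  - by move=> s _; exact: ge0_kernel_time.
  - by rewrite lee_fin mulr_ge0// ltW.
  rewrite kernel_time_scale// (_ : 1 - 2^-1 - c = 2^-1 - c)%R; last by field.
  by rewrite [in RHS]EFinM muleA.
move=> s _; rewrite [RHS]muleCA; congr (_ * _); rewrite -!EFinM; congr (_%:E).
by rewrite mulrACA.
Qed.

Lemma timeI_exp (t C c del lam : R) : (0 < t)%R -> (0 <= C)%R -> (0 <= del <= 1)%R -> (0 < lam)%R ->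
  timeI t (fun s => (C * s `^ (- c) * expR (lam * s))%:E) <=
  (gamma * C * expR (lam * t) * (lam `^ (- del) * t `^ (1 - (2^-1 + del) - c)))%:E * betaI (2^-1 + del) c.
Proof.
move=> t0 C0 hdel lam0; rewrite /timeI.
rewrite (eq_integral (fun s : mR => (gamma * C * expR (lam * t))%:E *
   (ind (0 < s < t)%R * ((t - s) `^ (- 2^-1) * s `^ (- c) * expR (- (lam * (t - s))))%:E))).
  have gC0 : (0 <= gamma * C * expR (lam * t))%R by rewrite !mulr_ge0 ?expR_ge0// ltW.
  rewrite ge0_integralZl//.
  - by rewrite [in leRHS]EFinM -muleA lee_wpmul2l ?lee_fin// kernel_time_expR.
  - apply: emeasurable_funM; first by apply: measurable_ind; exact: measurable_oo.
    apply/measurable_EFinP; apply: measurable_funM.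
      apply: measurable_funM; last exact: measurable_powRl.
      by apply: (measurableT_comp (measurable_powRl _)); exact: measurable_funB.
    apply: (measurableT_comp (@measurable_expR R)); apply: measurable_funN.
    by apply: measurable_funM => //; exact: measurable_funB.
  - by move=> s _; rewrite mule_ge0 ?ind_ge0// lee_fin !mulr_ge0 ?powR_ge0 ?expR_ge0.
move=> s _; rewrite [RHS]muleCA; congr (_ * _); rewrite -!EFinM; congr (_%:E).
have -> : expR (lam * s) = (expR (lam * t) * expR (- (lam * (t - s))))%R.
  by rewrite -expRD; congr expR; ring.
by ring.
Qed.

Lemma measurable_heat_kernel2 : measurable_fun setT (fun z : Z => heat_kernel z.1 z.2).
Proof.
have m4 (c : R) : measurable_fun setT (fun z : Z => c * z.1 : R)%R.
  by apply: measurable_funM => //; exact: measurable_fst.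
apply: measurable_funM; first exact: (measurableT_comp (measurable_powRl _) (m4 _)).
apply: (measurableT_comp (@measurable_expR R)); apply: measurable_funN.
apply: measurable_funM; last exact: (measurableT_comp (@measurable_invr R) (m4 _)).
by apply: measurable_funX; exact: (measurableT_comp (@measurable_enorm R n) measurable_snd).
Qed.

Lemma measurable_S_op f : measurable_fun setT f ->
  measurable_fun setT (fun z : Z => S_op f z.1 z.2).
Proof.
move=> mf; apply: measurable_fun_rV => i; under eq_fun do rewrite mxE.
apply: (@measurable_fun_Rintegral _ _ _ _ R mu (fun z : Z * 'rV[R]_n =>
  heat_kernel z.1.1 (z.1.2 - z.2) * f z.2 0 i)%R); apply: measurable_funM.
  have m1 : measurable_fun setT (fun z : Z * 'rV[R]_n => z.1.1).
    exact: (measurableT_comp measurable_fst measurable_fst).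
  have m2 : measurable_fun setT (fun z : Z * 'rV[R]_n => z.1.2 - z.2)%R.
    apply: measurable_funB_rV; last exact: measurable_snd.
    exact: (measurableT_comp measurable_snd measurable_fst).
  exact: (measurableT_comp measurable_heat_kernel2 (measurable_stpair m1 m2)).
exact: (measurableT_comp (measurable_fun_coord i mf) measurable_snd).
Qed.

Definition heatE f (t : R) (x : 'rV[R]_n) : \bar R :=
  \int[mu]_y (heat_kernel t (x - y) * enorm (f y))%:E.

Lemma measurable_heat_shift t (x : 'rV[R]_n) :
  measurable_fun setT (fun y : 'rV[R]_n => heat_kernel t (x - y)%R).
Proof. exact: (measurableT_comp (@measurable_heat_kernel R n t) (measurable_reflect_rV x)). Qed.

Lemma measurable_heatE_fun f t x : measurable_fun setT f ->
  measurable_fun setT (fun y : 'rV[R]_n => (heat_kernel t (x - y) * enorm (f y))%:E).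
Proof.
move=> mf; apply/measurable_EFinP; apply: measurable_funM; first exact: measurable_heat_shift.
exact: (measurableT_comp (@measurable_enorm R n) mf).
Qed.

Lemma integrable_S_op f t x i : measurable_fun setT f -> heatE f t x < +oo ->
  mu.-integrable setT (EFin \o (fun y => heat_kernel t (x - y) * f y 0 i)%R).
Proof.
move=> mf foo; apply: integrable_dominated foo.
- by apply: measurable_funM; [exact: measurable_heat_shift|exact: measurable_fun_coord].
- exact: measurable_heatE_fun.
- move=> y; rewrite lee_fin normrM ger0_norm ?heat_kernel_ge0// ler_wpM2l ?heat_kernel_ge0//.
  exact: ler_enorm.
Qed.

Lemma S_op_le f t x : measurable_fun setT f -> (enorm (S_op f t x))%:E <= heatE f t x.
Proof.
move=> mf; have [Eoo|] := ltP (heatE f t x) +oo; last by rewrite leye_eq => /eqP ->; rewrite leey.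
have iK i := integrable_S_op i mf Eoo.
rewrite enormE (_ : (fun i => _) = (fun i => \int[mu]_y (heat_kernel t (x - y) * f y 0 i))%R); last first.
  by apply/funext => i; rewrite mxE.
apply: (@le_trans _ _ (\int[mu]_y fnorm (fun i => heat_kernel t (x - y) * f y 0 i))%R%:E).
  by rewrite lee_fin; exact: (fnorm_Rintegral iK).
rewrite EFin_Rintegral; last exact: integrable_fnorm.
rewrite le_eqVlt; apply/orP; left; apply/eqP; apply: eq_integral => y _ /=.
by rewrite fnormZ ger0_norm ?heat_kernel_ge0.
Qed.

(** The heat kernel has mass one, so the heat flow does not increase a
    translation-invariant norm. *)
Lemma heatE_norm N f t (C : R) : good_norm N -> measurable_fun setT f -> (0 < t)%R -> (0 <= C)%R ->
  N (fun x => (enorm (f x))%:E) <= C%:E -> N (heatE f t) <= C%:E.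
Proof.
move=> gN mf t0 C0 fC; have me := measurableT_comp (@measurable_enorm R n) mf.
rewrite (_ : heatE f t = fun x => \int[mu]_y ((heat_kernel t y)%:E * (enorm (f (x - y)%R))%:E)); last first.
  apply/funext => x; rewrite /heatE -[LHS](@ge0_integral_reflect_rV _ _ x).
  - by apply: eq_integral => y _; rewrite subKr EFinM.
  - exact: measurable_heatE_fun.
  - by move=> y; rewrite lee_fin mulr_ge0 ?heat_kernel_ge0 ?enorm_ge0.
have mhE : measurable_fun setT (fun y : 'rV[R]_n => (heat_kernel t y)%:E).
  by apply/measurable_EFinP; exact: measurable_heat_kernel.
have meE : measurable_fun setT (fun y : 'rV[R]_n => (enorm (f y))%:E) by exact/measurable_EFinP.
apply: (@le_trans _ _ (\int[mu]_y ((heat_kernel t y)%:E * C%:E))).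
  apply: (@gn_mink _ _ _ gN _ _ mu (fun yx : 'rV[R]_n * 'rV[R]_n =>
    (heat_kernel t yx.1)%:E * (enorm (f (yx.2 - yx.1)%R))%:E) (fun y => (heat_kernel t y)%:E * C%:E)).
  - apply: emeasurable_funM; first exact: (measurableT_comp mhE measurable_fst).
    apply: (measurableT_comp meE); apply: measurable_funB_rV; [exact: measurable_snd|exact: measurable_fst].
  - by move=> z; rewrite -EFinM lee_fin mulr_ge0 ?heat_kernel_ge0 ?enorm_ge0.
  - exact: emeasurable_funM.
  - move=> y /=; have ms : measurable_fun setT (fun x : 'rV[R]_n => (enorm (f (x - y)%R))%:E).
      by apply: (measurableT_comp meE); apply: measurable_funB_rV => //; exact: measurable_cst.
    have e0 x : 0 <= (enorm (f x))%:E by rewrite lee_fin enorm_ge0.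
    apply: le_trans (gn_scale gN ms (fun x => e0 _) (heat_kernel_ge0 _ _)) _.
    rewrite lee_wpmul2l ?lee_fin ?heat_kernel_ge0//; apply: le_trans fC.
    exact: (gn_shift gN y meE).
rewrite ge0_integralZr ?lee_fin//; last by move=> y _; rewrite lee_fin heat_kernel_ge0.
by rewrite integral_heat_kernel// mul1e.
Qed.

End operator_bounds.

(** * Fields and contractive sequences *)

Section fields.
Context {R : realType} (n : nat).
Local Notation mR := (measurableTypeR R).
Local Notation leb := (@lebesgue_measure R).
Local Notation mu := (@lebesgue_rV R n).
Local Notation Z := (mR * 'rV[R]_n)%type.
Local Notation Pi := (@spacetime R n).
Implicit Types (u v : R -> 'rV[R]_n -> 'rV[R]_n).

Definition mfield u := measurable_fun setT (fun z : Z => u z.1 z.2).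

Definition tens u v (z : Z) (jk : 'I_n * 'I_n) : R := (u z.1 z.2 0 jk.1 * v z.1 z.2 0 jk.2)%R.

Lemma msource_tens u v : mfield u -> mfield v -> msource (tens u v).
Proof. by move=> mu' mv jk; apply: measurable_funM; exact: measurable_fun_coord. Qed.

Lemma fnorm_tens u v z : fnorm (tens u v z) = (enorm (u z.1 z.2) * enorm (v z.1 z.2))%R.
Proof. by rewrite !enormE -fnormM. Qed.

Lemma mfield_slice u t : mfield u -> measurable_fun setT (u t).
Proof. by move=> m_u; exact: (measurableT_comp m_u (pair1_measurable (t : mR))). Qed.

Definition tensB u v (z : Z) (jk : 'I_n * 'I_n) : R := (tens u u z jk - tens v v z jk)%R.

Lemma msource_tensB u v : mfield u -> mfield v -> msource (tensB u v).
Proof. by move=> m_u mv jk; apply: measurable_funB; exact: msource_tens. Qed.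

(** The difference of two squares factors, so its norm is controlled by the
    difference of the fields. *)
Lemma fnorm_tensB u v z : (fnorm (tensB u v z) <=
  (enorm (u z.1 z.2) + enorm (v z.1 z.2)) * enorm (u z.1 z.2 - v z.1 z.2))%R.
Proof.
rewrite (_ : tensB u v z = fun jk =>
    tens u (fun t x => u t x - v t x) z jk + tens (fun t x => u t x - v t x) v z jk)%R.
  apply: le_trans (ler_fnormD _ _) _; rewrite !fnorm_tens/=.
  by rewrite mulrDl lerD// mulrC.
by apply/funext => jk; rewrite /tensB /tens !mxE; ring.
Qed.

(** The iterated real-valued integrals agree with the space-time integral once the
    latter converges absolutely. *)
Lemma B_opE u v t x : mfield u -> mfield v -> Et (srcn (tens u v)) t x < +oo ->
  B_op u v t x = Bt (tens u v) t x.
Proof.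
move=> m_u mv Eoo; apply/rowP => i; rewrite !mxE.
have mM := msource_tens m_u mv; have /integrableP[_ iK] := integrable_kerB i mM Eoo.
rewrite (Rintegral_spacetime (measurable_kerB i t x mM) iK) Rintegral_mkcond.
apply: eq_Rintegral => s _; rewrite patchE mem_setE in_itv/=.
case: ifPn => st.
  apply: eq_Rintegral => y _; rewrite /kerB /= st mul1r.
  rewrite -(pair_bigA _ (fun j k => grad_oseen_fourier k i j (t - s) (x - y) * tens u v (s, y) (j, k)))%R/=.
  apply: eq_bigr => j _; apply: eq_bigr => k _; rewrite grad_oseenE ?mulrA//.
  by rewrite subr_gt0; case/andP: st.
under eq_Rintegral do rewrite /kerB /= (negbTE st) mul0r.
by rewrite /Rintegral integral0.
Qed.

Lemma cvg_enorm (g_ : nat -> 'rV[R]_n) (g : 'rV[R]_n) :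
  (forall i, (fun k => g_ k 0%R i : R) @ \oo --> (g 0%R i : R)) ->
  (fun k => enorm (g_ k) : R) @ \oo --> (enorm g : R).
Proof.
move=> gi; apply: (@cvg_comp _ _ _ (fun k => \sum_(i < n) g_ k 0 i ^+ 2)%R (@Num.sqrt R)); last first.
  exact: sqrt_continuous.
elim: (index_enum _) => [|i s IH].
  rewrite big_nil (_ : (fun k => _) = fun=> 0%R); first exact: cvg_cst.
  by apply/funext => k; rewrite big_nil.
rewrite big_cons (_ : (fun k => _) = fun k => g_ k 0 i ^+ 2 + \sum_(j <- s) g_ k 0 j ^+ 2)%R; last first.
  by apply/funext => k; rewrite big_cons.
apply: cvgD => //; rewrite expr2; under eq_fun do rewrite expr2.
by apply: cvgM; exact: gi.
Qed.

Lemma exists_lam (K del : R) : (0 <= K)%R -> (0 < del)%R ->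
  exists lam : R, (0 < lam)%R /\ (K * lam `^ (- del) <= 1)%R.
Proof.
move=> K0 d0; have K1 : (0 < K + 1)%R by rewrite ltr_wpDl.
exists ((K + 1) `^ del^-1)%R; split; first exact: powR_gt0.
rewrite -powRrM mulrN mulVf ?gt_eqF// powR_inv1 ?(ltW K1)//.
by rewrite ler_pdivrMr// mul1r lerDl.
Qed.

Lemma le0_geometric (e C th : R) : (0 <= th < 1)%R -> (forall m, e <= C * th ^+ m)%R -> (e <= 0)%R.
Proof.
move=> /andP[th0 th1] h.
have cv : (fun m => C * th ^+ m : R)%R @ \oo --> (0 : R)%R.
  rewrite -[X in _ --> X](mulr0 C); apply: cvgM; first exact: cvg_cst.
  by apply: cvg_expr; rewrite ger0_norm.
rewrite -(cvg_lim _ cv)//; apply: limr_ge; first exact: (cvgP _ cv).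
by apply: nearW => m; exact: h.
Qed.

(** The increments are dominated by a geometric series. *)
Lemma cvg_contractive (u : nat -> R) (C th : R) : (0 <= th < 1)%R ->
  (forall m, `|u m.+1 - u m| <= C * th ^+ m)%R -> cvgn u.
Proof.
move=> /andP[th0 th1] h.
have C0 : (0 <= C)%R by have := h 0%N; rewrite expr0 mulr1; apply: le_trans.
have cs : cvgn (series (telescope u)).
  apply: normed_cvg; apply: (@series_le_cvg _ _ (geometric C th)).
  - by move=> m /=.
  - by move=> m /=; rewrite mulr_ge0// exprn_ge0.
  - exact: h.
  - by apply: is_cvg_geometric_series; rewrite ger0_norm.
rewrite (_ : u = fun m => (u 0%N + series (telescope u) m)%R); last first.
  by apply/funext => m; exact: eq_sum_telescope.
by apply: is_cvgD => //; exact: is_cvg_cst.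
Qed.

(** Tail estimate of a geometrically contractive sequence of vectors. *)
Lemma enorm_tail (g_ : nat -> 'rV[R]_n) (g : 'rV[R]_n) (C th : R) : (0 <= th < 1)%R -> (0 <= C)%R ->
  (forall m, enorm (g_ m.+1 - g_ m) <= C * th ^+ m)%R ->
  (forall i, (fun k => g_ k 0%R i : R) @ \oo --> (g 0%R i : R)) ->
  forall m, (enorm (g - g_ m) <= C / (1 - th) * th ^+ m)%R.
Proof.
move=> /andP[th0 th1] C0 h gi m; have d0 : (0 < 1 - th)%R by rewrite subr_gt0.
have hk k : (enorm (g_ (m + k)%N - g_ m) <= C * th ^+ m * (1 - th ^+ k) / (1 - th))%R.
  elim: k => [|k IH]; first by rewrite addn0 subrr enorm0 expr0 subrr mulr0 mul0r.
  rewrite addnS -(subrKA (g_ (m + k)%N)); apply: le_trans (ler_enormD _ _) _.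
  apply: le_trans (lerD (h _) IH) _; rewrite exprD exprS.
  rewrite (_ : (C * (th ^+ m * th ^+ k) + C * th ^+ m * (1 - th ^+ k) / (1 - th) =
    C * th ^+ m * (1 - th * th ^+ k) / (1 - th)))%R//.
  by field; rewrite gt_eqF.
have cv : (fun k => enorm (g_ (m + k)%N - g_ m) : R) @ \oo --> (enorm (g - g_ m) : R).
  apply: cvg_enorm => i; rewrite !mxE; under eq_fun do rewrite !mxE.
  apply: cvgB; last exact: cvg_cst.
  have := gi i; rewrite -(cvg_shiftn m) => gim.
  by rewrite (_ : (fun k => _) = fun k => g_ (k + m)%N 0%R i)//; apply/funext => k; rewrite addnC.
rewrite -(cvg_lim _ cv)//; apply: limr_le; first exact: (cvgP _ cv).
apply: nearW => k; apply: le_trans (hk k) _.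
rewrite [leRHS]mulrAC ler_pM2r ?invr_gt0// ler_piMr ?mulr_ge0 ?exprn_ge0//.
by rewrite gerBl exprn_ge0.
Qed.

End fields.

(** * Contraction and uniqueness *)

Section mild.
Context {R : realType} (n : nat).
Local Notation mR := (measurableTypeR R).
Local Notation leb := (@lebesgue_measure R).
Local Notation mu := (@lebesgue_rV R n).
Local Notation Z := (mR * 'rV[R]_n)%type.
Local Notation Pi := (@spacetime R n).
Implicit Types (u v : R -> 'rV[R]_n -> 'rV[R]_n).
Variables (gamma : R) (gamma0 : (0 < gamma)%R).
Hypothesis gammaP : forall t : R, (0 < t)%R ->
  \int[mu]_x (@grad_oseen_norm R n t x)%:E <= (gamma * t `^ (- 2^-1))%:E.
Variables (a tau : R) (a01 : (0 <= a < 1)%R) (tau0 : (0 < tau)%R).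

Let a0 : (0 <= a)%R. Proof. by case/andP: a01. Qed.
Let a1 : (a < 1)%R. Proof. by case/andP: a01. Qed.

(** The factor by which the bilinear operator acts in the weight t^(a/2) on the time
    interval (0, tau). *)
Definition kap : R := (gamma * beta_const a * tau `^ ((1 - a) / 2))%R.

Lemma kap_ge0 : (0 <= kap)%R.
Proof. by rewrite !mulr_ge0 ?powR_ge0 ?beta_const_ge0// ltW. Qed.

Let powa s : (0 < s)%R -> (s `^ (- (a / 2)) * s `^ (- (a / 2)) = s `^ (- a))%R.
Proof. by move=> s0; rewrite -powRDp//; congr (_ `^ _)%R; field. Qed.

Let mpow c (e : R) : measurable_fun setT (fun s : mR => (c * s `^ e)%:E).
Proof. by apply/measurable_EFinP; apply: measurable_funM => //; exact: measurable_powRl. Qed.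

(** A source of size C s^(-a) produces a field of size kap C t^(-a/2): the time
    integral scales like t^(1/2 - a), and t^((1-a)/2) is bounded by its value at
    tau. *)
Lemma Et_small (w : Z -> \bar R) C t x : measurable_fun setT w -> (forall z, 0 <= w z) -> (0 <= C)%R ->
  (0 < t < tau)%R -> (forall s y, (0 < s < t)%R -> w (s, y) <= (C * s `^ (- a))%:E) ->
  Et w t x <= (kap * C * t `^ (- (a / 2)))%:E.
Proof.
move=> mw w0 C0 /andP[t0 tt] wC.
apply: le_trans (Et_le_sup gammaP x mw w0 (mpow C (- a)) _ wC) _.
  by move=> s; rewrite lee_fin mulr_ge0// powR_ge0.
rewrite timeI_pow// -beta_constE// -EFinM lee_fin /kap.
rewrite (_ : 2^-1 - a = (1 - a) / 2 + - (a / 2))%R; last by field.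
rewrite powRDp//; set P := (t `^ (- (a / 2)))%R.
have P0 : (0 <= P)%R by exact: powR_ge0.
rewrite (_ : gamma * C * (t `^ ((1 - a) / 2) * P) * beta_const a =
  gamma * C * P * beta_const a * t `^ ((1 - a) / 2))%R; last by ring.
rewrite (_ : gamma * beta_const a * tau `^ ((1 - a) / 2) * C * P =
  gamma * C * P * beta_const a * tau `^ ((1 - a) / 2))%R; last by ring.
rewrite ler_wpM2l ?mulr_ge0 ?beta_const_ge0 ?(ltW gamma0)//.
by rewrite ge0_ler_powR ?nnegrE ?(ltW t0) ?(ltW tau0) ?(ltW tt)// divr_ge0// subr_ge0 ltW.
Qed.

Definition wbound u K := forall s y, (0 < s < tau)%R -> (enorm (u s y) <= K * s `^ (- (a / 2)))%R.

(** The integral equation with the bilinear operator in the form [Bt]. *)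
Definition mild f u := forall t x, (0 < t < tau)%R -> u t x = (S_op f t x - Bt (tens u u) t x)%R.

Lemma Et_tens_lty u K t x : mfield u -> wbound u K -> (0 < t < tau)%R ->
  Et (srcn (tens u u)) t x <= (kap * (K * K) * t `^ (- (a / 2)))%:E.
Proof.
move=> m_u uK tt; have /andP[t0 tt'] := tt; apply: Et_small => //.
- by apply: measurable_srcn; exact: msource_tens.
- exact: srcn_ge0.
- by rewrite -expr2 sqr_ge0.
- move=> s y /andP[s0 st]; have hs : (0 < s < tau)%R by rewrite s0 (lt_trans st).
  rewrite /srcn fnorm_tens lee_fin -powa// mulrACA.
  by rewrite ler_pM ?enorm_ge0 ?uK.
Qed.

Lemma Bt_contract u v K D t x : mfield u -> mfield v -> wbound u K -> wbound v K ->
  wbound (fun t x => u t x - v t x)%R D -> (0 < t < tau)%R -> (0 <= K)%R -> (0 <= D)%R ->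
  (enorm (Bt (tens u u) t x - Bt (tens v v) t x) <= kap * (2 * K * D) * t `^ (- (a / 2)))%R.
Proof.
move=> m_u mv uK vK uvD tt K0 D0; have /andP[t0 tt'] := tt.
have fin w : mfield w -> wbound w K -> Et (srcn (tens w w)) t x < +oo.
  by move=> mw wK; apply: le_lt_trans (Et_tens_lty x mw wK tt) _; rewrite ltry.
rewrite -BtB ?fin//; try exact: msource_tens.
rewrite -lee_fin; apply: le_trans (Bt_le t x (msource_tensB m_u mv)) _; apply: Et_small => //.
- by apply: measurable_srcn; exact: msource_tensB.
- exact: srcn_ge0.
- by rewrite !mulr_ge0.
- move=> s y /andP[s0 st]; have hs : (0 < s < tau)%R by rewrite s0 (lt_trans st).
  rewrite /srcn lee_fin; apply: le_trans (fnorm_tensB _ _ _) _; rewrite -powa// mulrACA.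
  rewrite ler_pM ?addr_ge0 ?enorm_ge0//; last exact: uvD.
  by rewrite mulr2n mulrDl mul1r mulrDl lerD ?uK ?vK.
Qed.

Section exponential.
Variables (c : R) (c0 : (0 <= c)%R) (c1 : (c < 1)%R).
Let del : R := ((1 - a) / 4)%R.
Let del0 : (0 < del)%R. Proof. by rewrite divr_gt0// subr_gt0. Qed.
Let del1 : (del <= 4^-1)%R.
Proof. by rewrite /del -[leRHS]mul1r ler_pM2r// gerBl. Qed.

(** A large exponential weight makes the time kernel small on any bounded
    time interval. *)
Lemma timeI_exp_small (K e : R) : (0 <= K)%R -> (1 - (2^-1 + del) - c = del + e)%R ->
  exists lam : R, (0 < lam)%R /\ forall C t, (0 <= C)%R -> (0 < t < tau)%R ->
    timeI gamma t (fun s => (K * C * s `^ (- c) * expR (lam * s))%:E) <=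
    (C * t `^ e * expR (lam * t))%:E.
Proof.
move=> K0 hc; have d1 : (0 <= 2^-1 + del < 1)%R.
  by move: del0 del1 => h1 h2; apply/andP; split; lra.
have b1 : betaI (2^-1 + del) c = (fine (betaI (2^-1 + del) c))%:E.
  by rewrite fineK// ge0_fin_numE ?betaI_ge0// betaI_lty// c0.
move: b1; set b := fine _ => b1.
have b0 : (0 <= b)%R by rewrite -lee_fin -b1 betaI_ge0.
have K'0 : (0 <= gamma * K * tau `^ del * b)%R by rewrite !mulr_ge0 ?powR_ge0// ltW.
have [lam [lam0 lamK]] := exists_lam K'0 del0.
exists lam; split=> // C t C0 /andP[t0 tt].
have hdel : (0 <= del <= 1)%R by move: del0 del1 => h1 h2; apply/andP; split; lra.
apply: le_trans (timeI_exp gamma0 c t0 _ hdel lam0) _; first by rewrite mulr_ge0.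
rewrite b1 -EFinM lee_fin hc powRDp//.
have td : (t `^ del <= tau `^ del)%R.
  by rewrite ge0_ler_powR ?nnegrE ?(ltW t0) ?(ltW tau0) ?(ltW tt) ?(ltW del0).
have X0 : (0 <= C * t `^ e * expR (lam * t))%R by rewrite !mulr_ge0 ?powR_ge0 ?expR_ge0.
rewrite -[leRHS]mul1r.
apply: (@le_trans _ _ (gamma * K * tau `^ del * b * lam `^ (- del) * (C * t `^ e * expR (lam * t)))%R).
  rewrite (_ : gamma * (K * C) * expR (lam * t) * (lam `^ (- del) * (t `^ del * t `^ e)) * b =
    t `^ del * (gamma * K * b * lam `^ (- del) * (C * t `^ e * expR (lam * t))))%R; last by ring.
  rewrite (_ : gamma * K * tau `^ del * b * lam `^ (- del) * (C * t `^ e * expR (lam * t)) =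
    tau `^ del * (gamma * K * b * lam `^ (- del) * (C * t `^ e * expR (lam * t))))%R; last by ring.
  by rewrite ler_wpM2r// mulr_ge0// !mulr_ge0 ?powR_ge0// ltW.
by rewrite ler_wpM2r.
Qed.

End exponential.

(** Two mild solutions with the same singular bound agree: their difference,
    in a suitable exponential weight, is at most half of itself. *)
Lemma mild_unique f u v K : mfield u -> mfield v -> (0 <= K)%R ->
  wbound u K -> wbound v K -> mild f u -> mild f v ->
  forall t x, (0 < t < tau)%R -> u t x = v t x.
Proof.
move=> m_u mv K0 uK vK fu fv.
have K40 : (0 <= 4 * K)%R by rewrite mulr_ge0.
have he : (1 - (2^-1 + (1 - a) / 4) - a = (1 - a) / 4 + - (a / 2))%R by field.
have [lam [lam0 hlam]] := @timeI_exp_small a a0 a1 (4 * K)%R (- (a / 2))%R K40 he.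
have fin w t x : mfield w -> wbound w K -> (0 < t < tau)%R -> Et (srcn (tens w w)) t x < +oo.
  by move=> mw wK tt; apply: le_lt_trans (Et_tens_lty x mw wK tt) _; rewrite ltry.
have main k : forall t x, (0 < t < tau)%R ->
    (enorm (u t x - v t x) <= 2 * K * t `^ (- (a / 2)) * expR (lam * t) * (2^-1) ^+ k)%R.
  elim: k => [|k IH] t x tt; have /andP[t0 tt'] := tt.
    rewrite expr0 mulr1; apply: le_trans (ler_enormB _ _) _.
    apply: (@le_trans _ _ (2 * K * t `^ (- (a / 2)))%R).
      by rewrite mulr2n mulrDl mul1r mulrDl lerD ?uK ?vK.
    by rewrite ler_peMr ?mulr_ge0 ?powR_ge0// -expR0 ler_expR mulr_ge0// ltW.
  rewrite fu// fv// opprB addrC addrA subrK -enormN opprB.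
  rewrite -BtB ?fin//; try exact: msource_tens.
  rewrite -lee_fin; apply: le_trans (Bt_le t x (msource_tensB m_u mv)) _.
  pose C := (K * (2^-1) ^+ k)%R.
  have C0 : (0 <= C)%R by rewrite mulr_ge0// exprn_ge0.
  pose ub (s : mR) : \bar R := (4 * K * C * s `^ (- a) * expR (lam * s))%:E.
  apply: (@le_trans _ _ (timeI gamma t ub)).
    apply: Et_le_sup => //.
    - by apply: measurable_srcn; exact: msource_tensB.
    - exact: srcn_ge0.
    - apply/measurable_EFinP; apply: measurable_funM.
        by apply: measurable_funM => //; exact: measurable_powRl.
      by apply: (measurableT_comp (@measurable_expR R)); exact: measurable_funM.
    - by move=> s; rewrite lee_fin !mulr_ge0 ?powR_ge0 ?expR_ge0.
    - move=> s y /andP[s0 st]; have hs : (0 < s < tau)%R by rewrite s0 (lt_trans st).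
      rewrite /srcn lee_fin; apply: le_trans (fnorm_tensB _ _ _) _; rewrite -powa//=.
      rewrite (_ : 4 * K * C * (s `^ (- (a / 2)) * s `^ (- (a / 2))) * expR (lam * s) =
        (2 * K * s `^ (- (a / 2))) * (2 * K * s `^ (- (a / 2)) * expR (lam * s) * (2^-1) ^+ k))%R; last first.
        by rewrite /C; ring.
      rewrite ler_pM ?addr_ge0 ?enorm_ge0 ?IH//.
      by rewrite mulr2n mulrDl mul1r mulrDl lerD ?uK ?vK.
  apply: le_trans (hlam C t C0 tt) _; rewrite lee_fin le_eqVlt; apply/orP; left; apply/eqP.
  by rewrite /C exprS; field.
move=> t x tt; apply/eqP; rewrite -subr_eq0; apply/eqP; apply: enorm_eq0; apply/eqP.
rewrite eq_le enorm_ge0 andbT; apply: (@le0_geometric R _ _ 2^-1); last by move=> m; exact: main.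
by apply/andP; split; lra.
Qed.

End mild.

(** * Picard iteration *)

Section picard.
Context {R : realType} (n : nat).
Local Notation mR := (measurableTypeR R).
Local Notation leb := (@lebesgue_measure R).
Local Notation mu := (@lebesgue_rV R n).
Local Notation Z := (mR * 'rV[R]_n)%type.
Implicit Types (u v : R -> 'rV[R]_n -> 'rV[R]_n).
Variables (gamma : R) (gamma0 : (0 < gamma)%R).
Hypothesis gammaP : forall t : R, (0 < t)%R ->
  \int[mu]_x (@grad_oseen_norm R n t x)%:E <= (gamma * t `^ (- 2^-1))%:E.
Variables (a tau : R) (a01 : (0 <= a < 1)%R) (tau0 : (0 < tau)%R).
Variables (f : 'rV[R]_n -> 'rV[R]_n) (mf : measurable_fun setT f).
Variables (A : R) (A0 : (0 <= A)%R).
Hypothesis fA : forall t x, (0 < t < tau)%R -> heatE f t x <= (A * t `^ (- (a / 2)))%:E.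
Local Notation k := (kap gamma a tau).
Let th : R := (4 * A * k)%R.
Hypothesis th1 : (th < 1)%R.

Let k0 : (0 <= k)%R. Proof. exact: kap_ge0. Qed.
Let th0 : (0 <= th)%R. Proof. by apply: mulr_ge0 => //; exact: mulr_ge0. Qed.
Let A20 : (0 <= 2 * A)%R. Proof. by rewrite mulr_ge0. Qed.

(** The iterates vanish outside (0, tau), so that each one is measurable on the
    whole of space-time. *)
Fixpoint picard_iter (m : nat) : R -> 'rV[R]_n -> 'rV[R]_n :=
  match m with
  | 0 => fun _ _ => 0%R
  | m'.+1 => fun t x => ((0 < t < tau)%R%:R *:
      (S_op f t x - Bt (tens (picard_iter m') (picard_iter m')) t x))%R
  end.
Local Notation p := picard_iter.

Lemma picard_iterS m t x : (0 < t < tau)%R ->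
  p m.+1 t x = (S_op f t x - Bt (tens (p m) (p m)) t x)%R.
Proof. by move=> tt /=; rewrite tt scale1r. Qed.

Lemma mfield_picard m : mfield (p m).
Proof.
elim: m => [|m IH]; first exact: measurable_cst.
have mD := measurable_funB_rV (measurable_S_op mf) (measurable_Bt (msource_tens IH IH)).
apply: measurable_fun_rV => i.
rewrite (_ : (fun z => _) = fun z : Z => ((0 < z.1 < tau)%R%:R *
    (S_op f z.1 z.2 - Bt (tens (p m) (p m)) z.1 z.2) 0 i)%R); last first.
  by apply/funext => z; rewrite [LHS]mxE.
apply: measurable_funM; last exact: (measurable_fun_coord i mD).
by apply: measurable_natr_bool; exact: (measurableT_comp (measurable_oo tau) measurable_fst).
Qed.

Lemma S_op_bound t x : (0 < t < tau)%R -> (enorm (S_op f t x) <= A * t `^ (- (a / 2)))%R.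
Proof. by move=> tt; rewrite -lee_fin; apply: le_trans (S_op_le t x mf) _; exact: fA. Qed.

(** The ball of radius 2 A is mapped to itself because A + 4 A^2 kap <= 2 A. *)
Lemma picard_bound m : wbound a tau (p m) (2 * A)%R.
Proof.
elim: m => [|m IH] t x tt; first by rewrite enorm0 mulr_ge0// powR_ge0.
have pw := powR_ge0 t (- (a / 2)).
rewrite picard_iterS//; apply: le_trans (ler_enormB _ _) _.
have B : (enorm (Bt (tens (p m) (p m)) t x) <= k * (2 * A * (2 * A)) * t `^ (- (a / 2)))%R.
  rewrite -lee_fin; apply: le_trans (Bt_le t x (msource_tens (mfield_picard m) (mfield_picard m))) _.
  exact: (Et_tens_lty gamma0 gammaP a01 tau0 x (mfield_picard m) IH tt).
apply: le_trans (lerD (S_op_bound x tt) B) _; rewrite -mulrDl ler_wpM2r//.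
rewrite mulr2n mulrDl mul1r lerD2l -[leRHS]mulr1.
rewrite (_ : k * ((A + A) * (A + A)) = A * th)%R; last by rewrite /th; ring.
by rewrite ler_wpM2l// ltW.
Qed.

Lemma Bt_tens0 t x : Bt (tens (p 0) (p 0)) t x = 0%R.
Proof.
apply/rowP => i; rewrite !mxE; under eq_Rintegral => z _.
  rewrite /kerB big1 ?mulr0; last by move=> jk _; rewrite /tens mxE mul0r mulr0.
  over.
by rewrite /Rintegral integral0.
Qed.

Lemma picard_step m : wbound a tau (fun t x => p m.+1 t x - p m t x)%R (A * th ^+ m)%R.
Proof.
elim: m => [|m IH] t x tt.
  by rewrite subr0 picard_iterS// Bt_tens0 subr0 expr0 mulr1 S_op_bound.
rewrite !picard_iterS// opprB addrC addrA subrK.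
have D0 : (0 <= A * th ^+ m)%R by rewrite mulr_ge0// exprn_ge0.
have := Bt_contract gamma0 gammaP a01 tau0 x (mfield_picard m.+1) (mfield_picard m)
  (picard_bound m.+1) (picard_bound m) IH tt A20 D0.
rewrite -enormN opprB => h; apply: le_trans h _; rewrite le_eqVlt; apply/orP; left; apply/eqP.
by rewrite exprS /th; ring.
Qed.

(** Persistence of norms along the iteration, uniformly in the number of
    steps: the quadratic term is absorbed by an exponential weight. *)
Lemma picard_norm N C : good_norm N -> (0 <= C)%R -> N (fun x => (enorm (f x))%:E) <= C%:E ->
  exists W : R, forall m t, (0 < t < tau)%R -> N (fun x => (enorm (p m t x))%:E) <= W%:E.
Proof.
move=> gN C0 fC; have [a0 a1] := andP a01.
have a20 : (0 <= a / 2)%R by rewrite divr_ge0.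
have a21 : (a / 2 < 1)%R by lra.
have A40 : (0 <= 4 * A)%R by rewrite mulr_ge0.
have he : (1 - (2^-1 + (1 - a) / 4) - a / 2 = (1 - a) / 4 + 0)%R by field.
have [lam [lam0 hlam]] := @timeI_exp_small R gamma gamma0 a tau a01 tau0 (a / 2)%R a20 a21 (4 * A)%R 0%R A40 he.
have e1 t : (0 < t)%R -> (1 <= expR (lam * t))%R.
  by move=> t0; rewrite -expR0 ler_expR mulr_ge0// ltW.
exists (2 * C * expR (lam * tau))%R.
suff main m : forall t, (0 < t < tau)%R -> N (fun x => (enorm (p m t x))%:E) <= (2 * C * expR (lam * t))%:E.
  move=> m t tt; apply: le_trans (main m t tt) _; rewrite lee_fin ler_wpM2l ?mulr_ge0//.
  by rewrite ler_expR ler_wpM2l ?(ltW lam0)//; case/andP: tt => _ /ltW.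
elim: m => [|m IH] t tt; have /andP[t0 tt'] := tt.
  rewrite (_ : (fun x => _) = fun x : 'rV[R]_n => 0%:E * 0); last first.
    by apply/funext => x; rewrite enorm0 mul0e.
  apply: le_trans (gn_scale gN _ _ _) _ => //; rewrite mul0e lee_fin.
  by rewrite !mulr_ge0 ?expR_ge0.
have mp := mfield_picard m; have mM := msource_tens mp mp.
have me s : measurable_fun setT (fun x : 'rV[R]_n => (enorm (p m s x))%:E).
  apply/measurable_EFinP; exact: (measurableT_comp (@measurable_enorm R n) (mfield_slice s mp)).
have mh : measurable_fun setT (heatE f t).
  have h : measurable_fun setT (fun z : 'rV[R]_n * 'rV[R]_n => (heat_kernel t (z.1 - z.2)%R * enorm (f z.2))%:E).
    apply/measurable_EFinP; apply: measurable_funM.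
      apply: (measurableT_comp (@measurable_heat_kernel R n t)).
      by apply: measurable_funB_rV; [exact: measurable_fst|exact: measurable_snd].
    exact: (measurableT_comp (measurableT_comp (@measurable_enorm R n) mf) measurable_snd).
  apply: (@measurable_fun_fubini_tonelli_F _ _ _ _ _ mu _ h) => z.
  by rewrite lee_fin mulr_ge0 ?heat_kernel_ge0 ?enorm_ge0.
have mE : measurable_fun setT (Et (srcn (tens (p m) (p m))) t).
  by apply: measurable_Et; [exact: measurable_srcn|exact: srcn_ge0].
have h0 x : 0 <= heatE f t x.
  by apply: integral_ge0 => y _; rewrite lee_fin mulr_ge0 ?heat_kernel_ge0 ?enorm_ge0.
have E0 x : 0 <= Et (srcn (tens (p m) (p m))) t x by apply: Et_ge0; exact: srcn_ge0.
apply: (@le_trans _ _ (N (fun x => heatE f t x + Et (srcn (tens (p m) (p m))) t x))).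
  apply: (gn_mono gN).
  - apply/measurable_EFinP.
    exact: (measurableT_comp (@measurable_enorm R n) (mfield_slice t (mfield_picard m.+1))).
  - exact: emeasurable_funD.
  - by move=> x; rewrite lee_fin enorm_ge0.
  - move=> x; rewrite picard_iterS//; apply: (@le_trans _ _ ((enorm (S_op f t x))%:E + (enorm (Bt (tens (p m) (p m)) t x))%:E)).
      by rewrite -EFinD lee_fin ler_enormB.
    by apply: leeD; [exact: S_op_le|exact: Bt_le].
apply: le_trans (gn_add gN mh mE h0 E0) _.
apply: (@le_trans _ _ (C%:E + (C * t `^ 0 * expR (lam * t))%:E)); last first.
  by rewrite -EFinD lee_fin powRr0 mulr1 mulr2n mulrDl mul1r mulrDl lerD2r ler_peMr// e1.
apply: leeD; first exact: heatE_norm.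
apply: le_trans (hlam C t C0 tt); apply: (Et_norm gammaP) => //.
- exact: measurable_srcn.
- exact: srcn_ge0.
- apply/measurable_EFinP; apply: measurable_funM.
    by apply: measurable_funM => //; exact: measurable_powRl.
  by apply: (measurableT_comp (@measurable_expR R)); exact: measurable_funM.
- by move=> s; rewrite lee_fin !mulr_ge0 ?powR_ge0 ?expR_ge0.
- move=> s /andP[s0 st]; have hs : (0 < s < tau)%R by rewrite s0 (lt_trans st).
  have ws0 : (0 <= 2 * A * s `^ (- (a / 2)))%R by rewrite mulr_ge0// powR_ge0.
  apply: (@le_trans _ _ (N (fun x => (2 * A * s `^ (- (a / 2)))%:E * (enorm (p m s x))%:E))).
    apply: (gn_mono gN).
    + exact: (measurableT_comp (measurable_srcn mM) (pair1_measurable (s : mR))).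
    + exact: measurable_funeM.
    + by move=> x; exact: srcn_ge0.
    + move=> x; rewrite /srcn fnorm_tens -EFinM lee_fin ler_wpM2r ?enorm_ge0//.
      exact: picard_bound.
  apply: le_trans (gn_scale gN (me s) _ ws0) _; first by move=> x; rewrite lee_fin enorm_ge0.
  apply: (@le_trans _ _ ((2 * A * s `^ (- (a / 2)))%:E * (2 * C * expR (lam * s))%:E)).
    by rewrite lee_wpmul2l ?lee_fin// IH.
  rewrite -EFinM lee_fin le_eqVlt; apply/orP; left; apply/eqP; ring.
Qed.

(** The last clause propagates every admissible norm that the data has. *)
Lemma picard : exists v, [/\ mfield v, wbound a tau v (2 * A)%R, mild tau f v &
  forall N C, good_norm N -> (0 <= C)%R -> N (fun x => (enorm (f x))%:E) <= C%:E ->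
  exists W : R, forall t, (0 < t < tau)%R -> N (fun x => (enorm (v t x))%:E) <= W%:E].
Proof.
have th01 : (0 <= th < 1)%R by rewrite th0.
pose v (t : R) (x : 'rV[R]_n) : 'rV[R]_n := \row_i (limn (fun m => p m t x 0%R i : R))%R.
have p0 m t x : ~~ (0 < t < tau)%R -> p m t x = 0%R.
  by case: m => [//|m] /negbTE tt /=; rewrite tt scale0r.
have st m t x : (enorm (p m.+1 t x - p m t x) <= A * t `^ (- (a / 2)) * th ^+ m)%R.
  case: (boolP (0 < t < tau)%R) => tt; first by rewrite mulrAC; exact: picard_step.
  by rewrite !p0// subr0 enorm0 !mulr_ge0 ?powR_ge0 ?exprn_ge0.
have cv t x i : (fun m => p m t x 0%R i : R) @ \oo --> (v t x 0%R i : R).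
  rewrite mxE; apply: (@cvg_contractive R _ (A * t `^ (- (a / 2)))%R th th01) => m.
  by apply: le_trans (st m t x); have := ler_enorm (p m.+1 t x - p m t x)%R i; rewrite !mxE.
have tail t x m : (enorm (v t x - p m t x) <= A * t `^ (- (a / 2)) / (1 - th) * th ^+ m)%R.
  apply: (@enorm_tail R n (fun m => p m t x) (v t x) (A * t `^ (- (a / 2)))%R th th01) => //.
  by rewrite mulr_ge0 ?powR_ge0.
have mv : mfield v.
  apply: measurable_fun_rV => i.
  apply: (@measurable_fun_cvg _ _ _ _ (fun m (z : Z) => p m z.1 z.2 0%R i)) => //.
  by move=> m; exact: (measurable_fun_coord i (mfield_picard m)).
have ce t x : (fun m => enorm (p m t x) : R) @ \oo --> (enorm (v t x) : R).
  by apply: cvg_enorm => i; exact: cv.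
have vb : wbound a tau v (2 * A)%R.
  move=> t x tt; rewrite -(cvg_lim _ (ce t x))//; apply: limr_le; first exact: (cvgP _ (ce t x)).
  by apply: nearW => m; exact: picard_bound.
have d1 : (0 < 1 - th)%R by rewrite subr_gt0.
exists v; split => //.
- move=> t x tt; apply/eqP; rewrite -subr_eq0; apply/eqP; apply: enorm_eq0; apply/eqP.
  rewrite eq_le enorm_ge0 andbT.
  pose D m := (A / (1 - th) * th ^+ m)%R.
  have D0 m : (0 <= D m)%R by rewrite mulr_ge0 ?exprn_ge0// divr_ge0// ltW.
  apply: (@le0_geometric R _ ((A / (1 - th) + k * (2 * (2 * A) * (A / (1 - th)))) * t `^ (- (a / 2)))%R th th01) => m.
  rewrite -(subrKA (p m.+1 t x)); apply: le_trans (ler_enormD _ _) _.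
  have pm : wbound a tau (fun s y => p m s y - v s y)%R (D m).
    move=> s y hs; rewrite -enormN opprB; apply: le_trans (tail s y m) _.
    by rewrite /D le_eqVlt; apply/orP; left; apply/eqP; ring.
  have h1 : (enorm (v t x - p m.+1 t x) <= A / (1 - th) * t `^ (- (a / 2)) * th ^+ m)%R.
    apply: le_trans (tail t x m.+1) _; rewrite exprS.
    rewrite [leRHS](_ : _ = A * t `^ (- (a / 2)) / (1 - th) * (1 * th ^+ m))%R; last by ring.
    rewrite ler_wpM2l ?divr_ge0 ?mulr_ge0 ?powR_ge0 ?(ltW d1)//.
    by rewrite ler_wpM2r ?exprn_ge0 ?(ltW th1).
  have h2 := Bt_contract gamma0 gammaP a01 tau0 x (mfield_picard m) mv
    (picard_bound m) vb pm tt A20 (D0 m).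
  have h3 : (enorm (p m.+1 t x - (S_op f t x - Bt (tens v v) t x)) <=
      k * (2 * (2 * A) * D m) * t `^ (- (a / 2)))%R.
    by rewrite picard_iterS// opprB addrC addrA subrK -enormN opprB.
  apply: le_trans (lerD h1 h3) _; rewrite le_eqVlt; apply/orP; left; apply/eqP.
  by rewrite /D; ring.
- move=> N C gN C0 fC; have [W hW] := picard_norm gN C0 fC; exists W => t tt.
  apply: (gn_fatou gN (g_ := fun m x => enorm (p m t x))) => //.
  + by move=> m; exact: (measurableT_comp (@measurable_enorm R n) (mfield_slice t (mfield_picard m))).
  + by move=> m x; exact: enorm_ge0.
  + by move=> m; exact: hW.
Qed.

End picard.

(** * Restarting a solution *)

Section glue.
Context {R : realType} (n : nat).
Local Notation mR := (measurableTypeR R).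
Local Notation leb := (@lebesgue_measure R).
Local Notation mu := (@lebesgue_rV R n).
Local Notation Z := (mR * 'rV[R]_n)%type.
Local Notation Pi := (@spacetime R n).
Implicit Types (u v : R -> 'rV[R]_n -> 'rV[R]_n) (M : Z -> 'I_n * 'I_n -> R).

Lemma heat_kernel_bounded s (x : 'rV[R]_n) : (0 < s)%R ->
  (`|heat_kernel s x| <= (4 * pi * s) `^ (- (n%:R / 2)))%R.
Proof.
move=> s0; rewrite ger0_norm ?heat_kernel_ge0// /heat_kernel ler_piMr ?powR_ge0//.
by rewrite -expR0 ler_expR oppr_le0 divr_ge0 ?sqr_ge0// mulr_ge0// ltW.
Qed.

Lemma grad_oseen_fourier_bounded k i j s : (0 < s)%R ->
  exists C : R, forall x : 'rV[R]_n, (`|grad_oseen_fourier k i j s x| <= C)%R.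
Proof.
move=> s0; have iS := @integrable_oseen_symbol R n k i j s s0.
exists ((2 * pi) ^- n * \int[mu]_xi `|oseen_symbol k i j s xi|)%R => x.
rewrite /grad_oseen_fourier normrM ger0_norm ?invr_ge0 ?exprn_ge0 ?mulr_ge0 ?pi_ge0//.
rewrite ler_wpM2l ?invr_ge0 ?exprn_ge0 ?mulr_ge0 ?pi_ge0//.
have mS : measurable_fun setT (oseen_symbol k i j s : 'rV[R]_n -> R).
  by apply/measurable_EFinP; exact: (measurable_int mu).
have mC : measurable_fun setT (fun xi : 'rV[R]_n => oseen_symbol k i j s xi * cos (pi / 2 + dot x xi))%R.
  apply: measurable_funM => //; apply: measurable_fun_cos; apply: measurable_funD => //.
  by apply: measurable_fun_dot => //; exact: measurable_cst.
have le1 (xi : 'rV[R]_n) : (`|oseen_symbol k i j s xi * cos (pi / 2 + dot x xi)| <= `|oseen_symbol k i j s xi|)%R.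
  by rewrite normrM ler_piMr// ler_norml cos_geN1 cos_le1.
have iC : mu.-integrable setT (EFin \o (fun xi : 'rV[R]_n => oseen_symbol k i j s xi * cos (pi / 2 + dot x xi))%R).
  apply: (@integrable_dominated _ _ _ mu _ (fun xi : 'rV[R]_n => `|oseen_symbol k i j s xi|%:E)) => //.
    by apply/measurable_EFinP; exact: measurableT_comp.
  by case/integrableP: iS.
apply: le_trans (le_normr_Rintegral _ iC) _ => //.
apply: le_Rintegral => //; exact: integrable_norm.
Qed.

Section smoothing.
Variables (sg : R) (sg0 : (0 < sg)%R) (x : 'rV[R]_n).

Lemma integrable_heat_shift (g : 'rV[R]_n -> R) C : measurable_fun setT g ->
  (forall y, `|g y| <= C)%R ->
  mu.-integrable setT (EFin \o (fun y => heat_kernel sg (x - y) * g y)%R).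
Proof.
move=> mg gC.
apply: (@integrable_dominated _ _ _ mu (fun y : 'rV[R]_n => heat_kernel sg (x - y) * g y)%R
  (fun y : 'rV[R]_n => (heat_kernel sg (x - y)%R)%:E * C%:E)).
- by apply: measurable_funM => //; exact: measurable_heat_shift.
- by apply: emeasurable_funM => //; apply/measurable_EFinP; exact: measurable_heat_shift.
- by move=> y; rewrite -EFinM lee_fin normrM ger0_norm ?heat_kernel_ge0// ler_wpM2l ?heat_kernel_ge0.
rewrite ge0_integralZr//.
- rewrite (ge0_integral_reflect_rV x (f := fun y => (heat_kernel sg y)%:E)).
  + by rewrite integral_heat_kernel// mul1e ltry.
  + by apply/measurable_EFinP; exact: measurable_heat_kernel.
  + by move=> y; rewrite lee_fin heat_kernel_ge0.
- by apply/measurable_EFinP; exact: measurable_heat_shift.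
- by move=> y _; rewrite lee_fin heat_kernel_ge0.
- by rewrite lee_fin; apply: le_trans (gC 0%R).
Qed.

(** The function g is h before smoothing; the source point z and a constant weight c
    are carried along because kernels occur in this form. *)
Lemma heat_conv (g h : 'rV[R]_n -> R) (z : 'rV[R]_n) c C : measurable_fun setT g ->
  (forall y, `|g y| <= C)%R ->
  (forall w, \int[mu]_y (heat_kernel sg y * g (w - y)) = h w)%R ->
  (\int[mu]_y (heat_kernel sg (x - y) * (g (y - z) * c)) = h (x - z) * c)%R.
Proof.
move=> mg gC gh.
have mgz : measurable_fun setT (fun y : 'rV[R]_n => g (y - z)%R).
  by apply: (measurableT_comp mg); apply: measurable_funB_rV => //; exact: measurable_cst.
under eq_Rintegral do rewrite mulrA.
rewrite RintegralZr//; last by apply: integrable_heat_shift mgz _ => y; exact: gC.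
congr (_ * _)%R; rewrite -gh.
rewrite -(Rintegral_reflect_rV x (f := fun y => heat_kernel sg (x - y) * g (y - z))%R); last first.
  by apply: measurable_funM => //; exact: measurable_heat_shift.
by apply: eq_Rintegral => y _; rewrite subKr addrAC.
Qed.

(** A uniform bound on the inner absolute integral suffices for exchanging the two
    integrals, since the heat kernel has mass one. *)
Lemma heat_fubini d (T : measurableType d) (m : {sigma_finite_measure set T -> \bar R})
    (F : 'rV[R]_n * T -> R) K : measurable_fun setT F ->
  (forall y, \int[m]_z `|F (y, z)|%:E <= K%:E) ->
  (forall y, m.-integrable setT (EFin \o (fun z => F (y, z)))) ->
  (\int[mu]_y (heat_kernel sg (x - y) * \int[m]_z F (y, z)) =
   \int[m]_z \int[mu]_y (heat_kernel sg (x - y) * F (y, z)))%R.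
Proof.
move=> mF FK iF.
under eq_Rintegral do rewrite -RintegralZl//.
have mhx : measurable_fun setT (fun z : 'rV[R]_n * T => heat_kernel sg (x - z.1)%R).
  exact: (measurableT_comp (measurable_heat_shift sg x) measurable_fst).
have mHF := measurable_funM mhx mF.
rewrite (@Rfubini _ _ _ _ _ mu m (fun z => heat_kernel sg (x - z.1) * F z)%R)//.
have mFa : measurable_fun setT (fun z => `|F z|%:E) by apply/measurable_EFinP; exact: measurableT_comp.
have mI : measurable_fun setT (fun y => \int[m]_z `|F (y, z)|%:E).
  exact: (measurable_fun_fubini_tonelli_F _ mFa).
have mhE : measurable_fun setT (fun y : 'rV[R]_n => (heat_kernel sg (x - y)%R)%:E).
  by apply/measurable_EFinP; exact: measurable_heat_shift.
have h0 (y : 'rV[R]_n) : 0 <= (heat_kernel sg (x - y)%R)%:E by rewrite lee_fin heat_kernel_ge0.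
apply: (@le_lt_trans _ _ (\int[mu]_y ((heat_kernel sg (x - y)%R)%:E * K%:E))).
  rewrite (eq_integral (fun y : 'rV[R]_n => (heat_kernel sg (x - y)%R)%:E * \int[m]_z `|F (y, z)|%:E)); last first.
    move=> y _; under eq_integral do rewrite normrM (ger0_norm (heat_kernel_ge0 _ _)) EFinM.
    by rewrite /= ge0_integralZl//; exact: (measurableT_comp mFa (pair1_measurable y)).
  apply: ge0_le_integral => //.
  - by move=> y _; rewrite mule_ge0// integral_ge0.
  - exact: emeasurable_funM.
  - exact: emeasurable_funM.
  - by move=> y _; rewrite lee_wpmul2l.
have K0 : 0 <= K%:E by apply: le_trans (FK 0%R); exact: integral_ge0.
rewrite ge0_integralZr//.
rewrite (ge0_integral_reflect_rV x (f := fun y => (heat_kernel sg y)%:E)).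
- by rewrite integral_heat_kernel// mul1e ltry.
- by apply/measurable_EFinP; exact: measurable_heat_kernel.
- by move=> y; rewrite lee_fin heat_kernel_ge0.
Qed.

Lemma S_semigroup f t0 K : measurable_fun setT f -> (0 < t0)%R ->
  (forall y, heatE f t0 y <= K%:E) -> S_op (S_op f t0) sg x = S_op f (sg + t0) x.
Proof.
move=> mf t00 fK; apply/rowP => i; rewrite !mxE.
under eq_Rintegral do rewrite mxE.
have fin y : heatE f t0 y < +oo by apply: le_lt_trans (fK y) _; rewrite ltry.
rewrite (@heat_fubini _ _ mu (fun z : 'rV[R]_n * 'rV[R]_n => heat_kernel t0 (z.1 - z.2) * f z.2 0 i)%R K).
- apply: eq_Rintegral => z _ /=.
  exact: (@heat_conv (heat_kernel t0) (heat_kernel (sg + t0)%R) z (f z 0%R i) _ (measurable_heat_kernel t0)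
    (fun y => heat_kernel_bounded y t00) (fun w => conv_heat_kernel w sg0 t00)).
- apply: measurable_funM; last exact: (measurableT_comp (measurable_fun_coord i mf) measurable_snd).
  apply: (measurableT_comp (@measurable_heat_kernel R n t0)).
  by apply: measurable_funB_rV; [exact: measurable_fst|exact: measurable_snd].
- move=> y; apply: le_trans (fK y); apply: ge0_le_integral => //.
  + by have /integrableP[] := integrable_S_op i mf (fin y) => h _; apply/measurable_EFinP;
      apply: measurableT_comp => //; exact/measurable_EFinP.
  + exact: measurable_heatE_fun.
  + move=> z _; rewrite lee_fin normrM ger0_norm ?heat_kernel_ge0// ler_wpM2l ?heat_kernel_ge0//.
    exact: ler_enorm.
- by move=> y; exact: integrable_S_op.
Qed.

Definition before M (t0 : R) (z : Z) (jk : 'I_n * 'I_n) : R := ((0 < z.1 < t0)%R%:R * M z jk)%R.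

(** Smoothing the bilinear term for a further time sg only advances its kernel:
    the result is the contribution of the sources before t0 at the time sg + t0. *)
Lemma Bt_semigroup M t0 K : msource M -> (0 < t0)%R ->
  (forall y, Et (srcn M) t0 y <= K%:E) ->
  S_op (Bt M t0) sg x = Bt (before M t0) (sg + t0) x.
Proof.
move=> mM t00 fK; apply/rowP => i; rewrite !mxE.
under eq_Rintegral do rewrite mxE.
have fin y : Et (srcn M) t0 y < +oo by apply: le_lt_trans (fK y) _; rewrite ltry.
have mkB := measurable_kerB2 i mM.
have mswap : measurable_fun setT (fun z : 'rV[R]_n * Z => (((t0, z.1), z.2) : Z * Z)).
  by apply/measurable_fun_pairP; split => /=; [apply: measurable_stpair; [exact: measurable_cst|exact: measurable_fst]|exact: measurable_snd].
rewrite (@heat_fubini _ _ Pi (fun z : 'rV[R]_n * Z => kerB M i t0 z.1 z.2)%R K).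
- apply: eq_Rintegral => z _; rewrite /kerB /before /=.
  case: (boolP (0 < z.1 < t0)%R) => zt; last first.
    rewrite [RHS]mulrC big1 ?mul0r; last by move=> jk _; rewrite mul0r mulr0.
    by under eq_Rintegral do rewrite mul0r mulr0; rewrite /Rintegral integral0.
  have /andP[z0 zt0] := zt; have lag : (0 < t0 - z.1)%R by rewrite subr_gt0.
  have -> : (0 < z.1 < sg + t0)%R by rewrite z0 (lt_trans zt0)// ltrDr.
  rewrite mul1r; under eq_Rintegral do rewrite mul1r mulr_sumr.
  have bG (jk : 'I_n * 'I_n) := @grad_oseen_fourier_bounded jk.2 i jk.1 (t0 - z.1)%R lag.
  have mG (jk : 'I_n * 'I_n) : measurable_fun setT (fun y : 'rV[R]_n => grad_oseen_fourier jk.2 i jk.1 (t0 - z.1)%R y).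
    exact: (measurableT_comp (@measurable_grad_oseen_fourier R n jk.2 i jk.1) (pair1_measurable (t0 - z.1 : mR)%R)).
  rewrite Rintegral_sum; last first.
    move=> jk; have [C hC] := bG jk.
    apply: (@integrable_heat_shift _ (C * `|M z jk|)%R).
      apply: measurable_funM => //; apply: (measurableT_comp (mG jk)).
      by apply: measurable_funB_rV => //; exact: measurable_cst.
    by move=> y; rewrite normrM ler_wpM2r.
  apply: eq_bigr => jk _; have [C hC] := bG jk.
  rewrite mul1r -addrA.
  exact: (@heat_conv (grad_oseen_fourier jk.2 i jk.1 (t0 - z.1)%R) (grad_oseen_fourier jk.2 i jk.1 (sg + (t0 - z.1))%R)
    z.2 (M z jk) _ (mG jk) hC (fun w => conv_grad_oseen jk.2 i jk.1 w sg0 lag)).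
- exact: (measurableT_comp mkB mswap).
- move=> y; apply: le_trans (fK y); apply: ge0_le_integral => //.
  + by apply/measurable_EFinP; apply: measurableT_comp => //; exact: measurable_kerB.
  + exact: (measurableT_comp (measurable_Et_fun (measurable_srcn mM)) (pair1_measurable ((t0, y) : Z))).
  + move=> z _; rewrite /srcn -!EFinM lee_fin.
    exact: le_trans (ler_fnorm (fun i => kerB M i t0 y z) i) (kerB_le M t0 y z).
- by move=> y; exact: integrable_kerB.
Qed.

End smoothing.

Lemma measurable_stshift (b : R) : measurable_fun setT (fun z : Z => ((z.1 - b)%R, z.2) : Z).
Proof.
by apply: measurable_stpair; [apply: measurable_funB => //; exact: measurable_fst|exact: measurable_snd].
Qed.

Lemma spacetime_shift (b : R) (f : Z -> \bar R) : measurable_fun setT f -> (forall z, 0 <= f z) ->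
  \int[Pi]_z f (z.1 - b, z.2)%R = \int[Pi]_z f z.
Proof.
move=> mf f0.
have ms := measurable_stshift b.
rewrite (spacetimeE (measurableT_comp mf ms) (fun z => f0 _)) (spacetimeE mf f0).
have mI := @measurable_fun_fubini_tonelli_F _ _ _ _ _ mu f mf f0.
have I0 s : 0 <= \int[mu]_y f (s, y) by exact: integral_ge0.
rewrite [RHS](@ge0_integral_affine R 1%R (- b)%R _ ltr01 mI I0).
by rewrite mul1e; apply: eq_integral => s _ /=; rewrite mul1r.
Qed.

Lemma Rspacetime_shift (b : R) (f : Z -> R) : measurable_fun setT f ->
  (\int[Pi]_z f (z.1 - b, z.2) = \int[Pi]_z f z)%R.
Proof.
move=> mf; have mfE : measurable_fun setT (EFin \o f) by exact/measurable_EFinP.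
rewrite /Rintegral integralE [in RHS]integralE; congr (fine (_ - _)).
- rewrite -(spacetime_shift b (measurable_funepos mfE)); first by apply: eq_integral => z _; rewrite !funeposE.
  by move=> z; exact: funepos_ge0.
- rewrite -(spacetime_shift b (measurable_funeneg mfE)); first by apply: eq_integral => z _; rewrite !funenegE.
  by move=> z; exact: funeneg_ge0.
Qed.


(** Restarting: the field that follows [u] up to time [t0] and then the
    solution [v] issued from [u t0]. *)
Definition concat (t0 : R) u v (s : R) (y : 'rV[R]_n) : 'rV[R]_n :=
  if (s <= t0)%R then u s y else v (s - t0)%R y.

Lemma mfield_concat t0 u v : mfield u -> mfield v -> mfield (concat t0 u v).
Proof.
move=> m_u mv; have mvs : mfield (fun s y => v (s - t0)%R y).
  exact: (measurableT_comp mv (measurable_stshift t0)).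
apply: measurable_fun_rV => i.
rewrite (_ : (fun z => _) = fun z : Z => if (z.1 <= t0)%R then u z.1 z.2 0%R i else v (z.1 - t0)%R z.2 0%R i); last first.
  by apply/funext => z; rewrite /concat; case: ifP.
apply: measurable_fun_ifT.
- by apply: measurable_fun_ler => //; exact: measurable_fst.
- exact: (measurable_fun_coord i m_u).
- exact: (measurable_fun_coord i mvs).
Qed.

Section restart.
Variables (t0 sg : R) (t00 : (0 < t0)%R) (sg0 : (0 < sg)%R).
Implicit Types (x : 'rV[R]_n).

Definition after M (z : Z) (jk : 'I_n * 'I_n) : R :=
  ((t0 < z.1)%R%:R * M (z.1 - t0, z.2)%R jk)%R.

Lemma msource_shift M : msource M -> msource (fun z => M (z.1 - t0, z.2)%R).
Proof.
by move=> mM jk; exact: (measurableT_comp (mM jk) (measurable_stshift t0)).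
Qed.

Lemma msource_after M : msource M -> msource (after M).
Proof.
move=> mM jk; apply: measurable_funM; last exact: (msource_shift mM).
by apply: measurable_natr_bool; apply: measurable_fun_ltr => //; exact: measurable_fst.
Qed.

Let window s : ((0 < s < t0 + sg) && (t0 < s))%R = (0 < s - t0 < sg)%R.
Proof.
apply/idP/idP => [/andP[/andP[_ h1] h2]|/andP[h1 h2]]; first by apply/andP; split; lra.
by move: t00 => h3; apply/andP; split; first (apply/andP; split); lra.
Qed.

(** The contribution of the sources after t0 is that of the restarted evolution, by
    a translation in time. *)
Lemma Bt_after M x : msource M -> Bt (after M) (t0 + sg) x = Bt M sg x.
Proof.
move=> mM; apply/rowP => i; rewrite !mxE -[RHS](Rspacetime_shift t0 (measurable_kerB i sg x mM)).
apply: eq_Rintegral => z _; rewrite /kerB /after /= -window.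
have -> : (t0 + sg - z.1 = sg - (z.1 - t0))%R by ring.
case: (boolP (t0 < z.1)%R) => h; rewrite ?andbT ?andbF.
  by congr (_ * _)%R; apply: eq_bigr => jk _; rewrite mul1r.
by rewrite mul0r big1 ?mulr0// => jk _; rewrite mul0r mulr0.
Qed.

Lemma Et_after M x : msource M -> Et (srcn (after M)) (t0 + sg) x = Et (srcn M) sg x.
Proof.
move=> mM; have mE := measurableT_comp (measurable_Et_fun (measurable_srcn mM)) (pair1_measurable ((sg, x) : Z)).
rewrite /Et -[RHS](spacetime_shift t0 mE) => [|z]; last exact: (ge0_Et_fun sg x z (srcn_ge0 M)).
apply: eq_integral => z _; rewrite /srcn /after /= -window fnormZ normr_nat.
have -> : (t0 + sg - z.1 = sg - (z.1 - t0))%R by ring.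
move: (gradn _ _) (fnorm _) => G F.
case: (boolP (t0 < z.1)%R) => h; first by rewrite andbT mul1r.
by rewrite andbF mul0r mule0 mule0 mul0e.
Qed.

Lemma msource_before M : msource M -> msource (before M t0).
Proof.
move=> mM jk; apply: measurable_funM => //.
by apply: measurable_natr_bool; exact: (measurableT_comp (measurable_oo t0) measurable_fst).
Qed.

Definition slice M (z : Z) (jk : 'I_n * 'I_n) : R := ((z.1 == t0)%:R * M z jk)%R.

Lemma msource_slice M : msource M -> msource (slice M).
Proof.
move=> mM jk; apply: measurable_funM => //; apply: measurable_natr_bool.
by apply: (measurable_fun_eqr (f := fst : Z -> mR) (g := cst t0)) => //; exact: measurable_fst.
Qed.

(** A single instant is null; it is treated apart because the identity for the
    kernels requires a positive time lag. *)
Lemma Et_slice M x : msource M -> Et (srcn (slice M)) (t0 + sg) x = 0.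
Proof.
move=> mM; have mS := msource_slice mM.
have mE := measurableT_comp (measurable_Et_fun (measurable_srcn mS)) (pair1_measurable ((t0 + sg, x)%R : Z)).
have E0 z := ge0_Et_fun (t0 + sg)%R x z (srcn_ge0 (slice M)).
rewrite /Et (spacetimeE mE E0).
have mI := @measurable_fun_fubini_tonelli_F _ _ _ _ _ mu _ mE E0.
apply: (etrans _ (integral0 leb setT)); apply: ae_eq_integral => //.
exists [set t0]; split; first exact: measurable_set1.
  exact: lebesgue_measure_set1.
move=> s /=; apply: contra_notP => st _.
rewrite integral0_eq// => y _; rewrite /srcn /slice /= fnormZ.
have -> : (s == t0) = false by apply/eqP.
by rewrite normr0 mul0r !mule0.
Qed.

(** The sources of the glued field split into those before, at and after t0. *)
Lemma restart f u v K1 K2 x : measurable_fun setT f -> mfield u -> mfield v ->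
  (forall y, heatE f t0 y <= K1%:E) ->
  (forall y, Et (srcn (tens u u)) t0 y <= K2%:E) ->
  Et (srcn (before (tens u u) t0)) (t0 + sg) x < +oo ->
  Et (srcn (tens v v)) sg x < +oo ->
  (forall y, u t0 y = S_op f t0 y - Bt (tens u u) t0 y)%R ->
  v sg x = (S_op (u t0) sg x - Bt (tens v v) sg x)%R ->
  let w := concat t0 u v in
  w (t0 + sg)%R x = (S_op f (t0 + sg) x - Bt (tens w w) (t0 + sg) x)%R /\
  Et (srcn (tens w w)) (t0 + sg) x < +oo.
Proof.
move=> mf m_u mv fK1 uK2 fin1 fin2 uE vE w.
have mw : mfield w by exact: mfield_concat.
have mU := msource_tens m_u m_u; have mV := msource_tens mv mv.
have mC := msource_before mU; have mA := msource_after mV; have mS := msource_slice mU.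
pose M1 z jk := (before (tens u u) t0 z jk + after (tens v v) z jk)%R.
pose M2 z jk := (M1 z jk + slice (tens u u) z jk)%R.
have mM1 : msource M1 by move=> jk; exact: measurable_funD.
have mM2 : msource M2 by move=> jk; exact: measurable_funD.
have wE z jk : (0 < z.1 < t0 + sg)%R -> tens w w z jk = M2 z jk.
  move=> /andP[z0 zt]; rewrite /M2 /M1 /before /after /slice /tens /w /concat z0 /=.
  by case: (ltgtP z.1 t0) => h; rewrite ?mul0r ?mul1r ?addr0 ?add0r.
have EtD M M' : msource M -> msource M' -> Et (srcn M) (t0 + sg) x < +oo ->
    Et (srcn M') (t0 + sg) x < +oo ->
    Et (srcn (fun z jk => M z jk + M' z jk)%R) (t0 + sg) x < +oo.
  move=> mM mM' E1 E2.
  have mE N' : msource N' -> measurable_fun setT (fun z : Z => ind (0 < z.1 < t0 + sg)%R *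
      ((gradn (t0 + sg - z.1) (x - z.2))%:E * srcn N' z)).
    move=> mN; exact: (measurableT_comp (measurable_Et_fun (measurable_srcn mN)) (pair1_measurable ((t0 + sg, x)%R : Z))).
  have E12 := lte_add_pinfty E1 E2; apply: le_lt_trans E12.
  rewrite /Et -ge0_integralD//; [|by move=> z _; exact: (ge0_Et_fun (t0 + sg)%R x z (srcn_ge0 M))|exact: mE|by move=> z _; exact: (ge0_Et_fun (t0 + sg)%R x z (srcn_ge0 M'))|exact: mE].
  apply: ge0_le_integral => //.
  - by move=> z _; exact: (ge0_Et_fun (t0 + sg)%R x z (srcn_ge0 _)).
  - by apply: mE => jk; exact: measurable_funD.
  - by apply: emeasurable_funD; exact: mE.
  - move=> z _; rewrite /srcn -!EFinM -EFinD lee_fin -!mulrDr ler_wpM2l// ler_wpM2l ?gradn_ge0//.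
    exact: ler_fnormD.
have finA : Et (srcn (after (tens v v))) (t0 + sg) x < +oo by rewrite Et_after.
have finS : Et (srcn (slice (tens u u))) (t0 + sg) x < +oo by rewrite Et_slice// ltry.
have finM1 := EtD _ _ mC mA fin1 finA.
have finM2 := EtD _ _ mM1 mS finM1 finS.
split; last first.
  apply: le_lt_trans finM2; apply: le_Et.
  - by apply: measurable_srcn; exact: msource_tens.
  - exact: measurable_srcn.
  - exact: srcn_ge0.
  - by move=> z zt; rewrite /srcn (_ : tens w w z = M2 z)//; apply/funext => jk; exact: wE.
have BS : Bt (slice (tens u u)) (t0 + sg) x = 0%R.
  apply: enorm_eq0; apply/eqP; rewrite eq_le enorm_ge0 andbT -lee_fin.
  by apply: le_trans (Bt_le _ _ mS) _; rewrite Et_slice.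
rewrite (eq_Bt x wE) (BtD mM1 mS finM1 finS) (BtD mC mA fin1 finA) BS addr0 Bt_after//.
rewrite {1}/w /concat leNgt ltrDl sg0/= addrC addKr vE opprD addrA; congr (_ - _)%R.
have tE : (t0 + sg = sg + t0)%R by rewrite addrC.
have -> : u t0 = (fun y => S_op f t0 y - Bt (tens u u) t0 y)%R by apply/funext.
rewrite tE -(S_semigroup sg0 x mf t00 fK1) -(Bt_semigroup sg0 x mU t00 uK2).
have bS i y : (`|S_op f t0 y 0%R i| <= K1)%R.
  by apply: le_trans (ler_enorm _ _) _; rewrite -lee_fin; apply: le_trans (S_op_le t0 y mf) (fK1 y).
have bB i y : (`|Bt (tens u u) t0 y 0%R i| <= K2)%R.
  by apply: le_trans (ler_enorm _ _) _; rewrite -lee_fin; apply: le_trans (Bt_le t0 y mU) (uK2 y).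
have mSt := measurableT_comp (measurable_S_op mf) (pair1_measurable (t0 : mR)).
have mBt := measurableT_comp (measurable_Bt mU) (pair1_measurable (t0 : mR)).
apply/rowP => i; rewrite [LHS]mxE [RHS]mxE [X in (_ = X + _)%R]mxE [X in (_ = _ + X)%R]mxE [X in (_ = _ - X)%R]mxE.
rewrite -RintegralB//; last 2 first.
- exact: (integrable_heat_shift sg0 x (measurable_fun_coord i mSt) (bS i)).
- exact: (integrable_heat_shift sg0 x (measurable_fun_coord i mBt) (bB i)).
apply: eq_Rintegral => y _; rewrite -mulrBr; congr (_ * _)%R.
by rewrite [LHS]mxE [X in (_ + X)%R = _]mxE.
Qed.

End restart.

End glue.

(** * Extension beyond the maximal time *)

Section solutions.
Context {R : realType} (n : nat).
Local Notation mR := (measurableTypeR R).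
Local Notation mu := (@lebesgue_rV R n).
Local Notation Z := (mR * 'rV[R]_n)%type.
Implicit Types (u v : R -> 'rV[R]_n -> 'rV[R]_n).

Lemma lty_ub (e : \bar R) : e < +oo -> exists K : R, (0 <= K)%R /\ e <= K%:E.
Proof.
case: e => [e| |] // _; last by exists 0%R; split=> //; rewrite leNye.
by exists (Num.max e 0%R); rewrite le_max lexx orbT lee_fin le_max lexx.
Qed.

Lemma eq_B_op u v t (x : 'rV[R]_n) : (forall s y, (0 < s < t)%R -> u s y = v s y) ->
  B_op u u t x = B_op v v t x.
Proof.
move=> uv; apply/rowP => i; rewrite !mxE; apply: eq_Rintegral => s.
rewrite mem_setE in_itv/= => st; apply: eq_Rintegral => y _.
by apply: eq_bigr => j _; apply: eq_bigr => k _; rewrite uv.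
Qed.

(** Fields are measurable on a time interval only; extending them by zero makes them
    measurable everywhere without changing the equation. *)
Definition trunc (tau : R) u (s : R) (y : 'rV[R]_n) : 'rV[R]_n :=
  if (0 < s < tau)%R then u s y else 0%R.

Lemma truncE tau u s y : (0 < s < tau)%R -> trunc tau u s y = u s y.
Proof. by rewrite /trunc => ->. Qed.

Lemma mfield_trunc tau u :
  measurable_fun [set z : Z | (0 < z.1)%R /\ z.1%:E < tau%:E] (fun z : Z => u z.1 z.2) ->
  mfield (trunc tau u).
Proof.
set D := [set z | _] => m_u.
have mD : measurable D.
  rewrite (_ : D = [set z : Z | (0 < z.1 < tau)%R]); last first.
    apply/seteqP; split => z /=; first by move=> []; rewrite lte_fin => -> ->.
    by move=> /andP[h1 h2]; split => //; rewrite lte_fin.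
  by apply: measurable_bool_set; exact: (measurableT_comp (measurable_oo tau) measurable_fst).
apply: measurable_fun_rV => i.
have mi : measurable_fun D (fun z : Z => u z.1 z.2 0%R i).
  exact: (measurableT_comp (measurable_coordT i) m_u).
have := (measurable_restrictT _ mD).1 mi.
apply: eq_measurable_fun => z _; rewrite /trunc patchE.
case: ifPn => [/set_mem[h1]|/negP h]; first by rewrite lte_fin => h2; rewrite h1 h2.
case: ifPn => [/andP[h1 h2]|_]; last by rewrite mxE.
by exfalso; apply: h; apply/mem_set; split => //; rewrite lte_fin.
Qed.

Lemma path_bound N sigma (T : \bar R) u : path_space N sigma T u ->
  exists K : R, (0 <= K)%R /\ forall t, (0 < t)%R -> t%:E < T ->
    (t `^ (- sigma / 2))%:E * N (enorm \o u t) <= K%:E.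
Proof.
move=> [_ /lty_ub[K [K0 uK]]]; exists K; split => // t t0 tT; apply: le_trans uK.
by apply: ereal_sup_ubound; exists t.
Qed.

Lemma sup_path_wbound a tau u : path_space (@sup_norm R n) (- a) tau%:E u ->
  exists K : R, (0 <= K)%R /\ wbound a tau (trunc tau u) K.
Proof.
move=> /path_bound[K [K0 uK]]; exists K; split => // s y hs; have /andP[s0 st] := hs.
have h : (s `^ (a / 2))%:E * (enorm (u s y))%:E <= K%:E.
  apply: le_trans (uK s s0 _); last by rewrite lte_fin.
  rewrite opprK lee_wpmul2l ?lee_fin ?powR_ge0//; apply: ereal_sup_ubound.
  by exists y => //; rewrite /= ger0_norm ?enorm_ge0.
rewrite truncE// powRN ler_pdivlMr ?powR_gt0// mulrC.
by rewrite -lee_fin EFinM.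
Qed.

Variables (gamma : R) (gamma0 : (0 < gamma)%R).
Hypothesis gammaP : forall t : R, (0 < t)%R ->
  \int[mu]_x (@grad_oseen_norm R n t x)%:E <= (gamma * t `^ (- 2^-1))%:E.
Variables (p q r0 : \bar R) (f : 'rV[R]_n -> 'rV[R]_n).
Hypothesis a01 : (0 <= n%:R * rinv r0 < 1)%R.
Local Notation a := (n%:R * rinv r0)%R.

Lemma solution_mild T u tau : mild_solution p q r0 f T u -> (0 < tau)%R -> tau%:E < T ->
  mfield (trunc tau u) /\ exists K : R, [/\ (0 <= K)%R,
    wbound a tau (trunc tau u) K & mild tau f (trunc tau u)].
Proof.
move=> [_ hs ueq] tau0 tauT; have hp := hs tau tau0 tauT.
have m_u : mfield (trunc tau u) by apply: mfield_trunc; case: hp.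
split => //; have [K [K0 uK]] := sup_path_wbound hp; exists K; split => // t x tt.
have /andP[t0 ttau] := tt.
rewrite truncE// ueq//; last by apply: lt_trans tauT; rewrite lte_fin.
congr (_ - _)%R; rewrite (@eq_B_op u (trunc tau u)); last first.
  by move=> s y /andP[s0 st]; rewrite truncE// s0 (lt_trans st).
rewrite B_opE//; apply: le_lt_trans (Et_tens_lty gamma0 gammaP a01 tau0 x m_u uK tt) _.
by rewrite ltry.
Qed.

Lemma solution_unique T u v t x : mild_solution p q r0 f T u -> mild_solution p q r0 f T v ->
  (0 < t)%R -> t%:E < T -> v t x = u t x.
Proof.
move=> hu hv t0 tT.
have [tau [ttau tauT]] : exists tau : R, (t < tau)%R /\ tau%:E < T.
  case: T tT {hu hv} => [T| |]//; last by exists (t + 1)%R; rewrite ltrDl ltry.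
  by rewrite lte_fin => tT; exists ((t + T) / 2)%R; rewrite lte_fin; split; lra.
have tau0 := lt_trans t0 ttau; have tt : (0 < t < tau)%R by rewrite t0.
have [m_u [K [K0 uK ue]]] := solution_mild hu tau0 tauT.
have [mv [K' [K'0 vK ve]]] := solution_mild hv tau0 tauT.
have mx w K1 : wbound a tau w K1 -> (K1 <= Num.max K K')%R -> wbound a tau w (Num.max K K').
  by move=> wK h s y hs; apply: le_trans (wK s y hs) _; rewrite ler_wpM2r ?powR_ge0.
have := @mild_unique R n gamma gamma0 gammaP a tau a01 tau0 f _ _ (Num.max K K') mv m_u.
move=> /(_ _ _ _ ve ue t x tt); rewrite !truncE//; apply.
- by rewrite le_max K0.
- by apply: mx vK _; rewrite le_max lexx orbT.
- by apply: mx uK _; rewrite le_max lexx.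
Qed.

End solutions.

Lemma exists_longer_time (R : realType) (X d e : R) : (0 <= X)%R -> (0 < d)%R -> (0 < e)%R ->
  (X * d `^ e < 1)%R -> exists tau : R, (d < tau)%R /\ (X * tau `^ e < 1)%R.
Proof.
rewrite le_eqVlt => /orP[/eqP <- d0 e0 _|X0 d0 e0 h].
  by exists (d + 1)%R; rewrite ltrDl mul0r !ltr01.
have hX : (d `^ e < X^-1)%R by rewrite -ltr_pdivlMl ?mulr1 // in h *.
pose Y := (X^-1 `^ e^-1)%R.
have dY : (d < Y)%R.
  have {1}-> : d = ((d `^ e) `^ e^-1)%R.
    by rewrite -powRrM mulfV ?gt_eqF// powRr1// ltW.
  by apply: gt0_ltr_powR; rewrite ?invr_gt0 ?nnegrE ?powR_ge0 ?invr_ge0 ?(ltW X0).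
exists ((d + Y) / 2)%R; split; first by lra.
rewrite -ltr_pdivlMl// mulr1.
have Y0 : (0 <= Y)%R by exact: powR_ge0.
have <- : (Y `^ e = X^-1)%R.
  by rewrite /Y -powRrM mulVf ?gt_eqF// powRr1// invr_ge0 ltW.
apply: gt0_ltr_powR; rewrite // ?nnegrE ?divr_ge0 ?addr_ge0 ?(ltW d0)//.
by rewrite ltr_pdivrMr// mulrDr mulr1 ltrD2r.
Qed.

Section theorem.
Context {R : realType} (n : nat) (n_ge1 : (1 <= n)%N).
Local Notation mR := (measurableTypeR R).
Local Notation mu := (@lebesgue_rV R n).
Local Notation Z := (mR * 'rV[R]_n)%type.
Variables (alpha gamma : R) (alpha0 : (0 < alpha)%R) (gamma0 : (0 < gamma)%R).
Hypothesis alphaP : forall (r : \bar R) (t : R), n%:R%:E < r -> (0 < t)%R ->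
  lorentz_norm (hoelder_conjugate r) 1 (@heat_kernel R n t)
    <= (alpha * t `^ (- (n%:R * rinv r / 2)))%:E.
Hypothesis gammaP : forall t : R, (0 < t)%R ->
  \int[mu]_x (@grad_oseen_norm R n t x)%:E <= (gamma * t `^ (- 2^-1))%:E.
Variables (p q r0 : \bar R) (p1 : 1 < p) (q1 : 1 <= q) (pq : p = +oo -> q = +oo).
Hypothesis r0n : n%:R%:E < r0.
Variables (f : 'rV[R]_n -> 'rV[R]_n) (mf : measurable_fun setT f).
Hypothesis f_r0 : lorentz_norm r0 +oo (enorm \o f) < +oo.

Let exponent (r : \bar R) : n%:R%:E < r -> (0 <= n%:R * rinv r < 1)%R.
Proof.
by move=> rn; have [h1 [h2 _]] := rinv_bounds n_ge1 rn; rewrite h2 mulr_ge0.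
Qed.

Local Notation a0 := (n%:R * rinv r0)%R.
Let a01 : (0 <= a0 < 1)%R. Proof. exact: exponent. Qed.

Lemma one_lt_exponent (r : \bar R) : n%:R%:E < r -> 1 < r.
Proof. by apply: le_lt_trans; rewrite lee_fin (ler_nat _ 1 n). Qed.

Lemma enormE_norm (g : 'rV[R]_n -> 'rV[R]_n) :
  (fun x => `|(enorm \o g) x|%:E) = (fun x => (enorm (g x))%:E).
Proof. by apply/funext => x; rewrite /= ger0_norm ?enorm_ge0. Qed.

Lemma heatE_data (r : \bar R) (g : 'rV[R]_n -> 'rV[R]_n) M t x : n%:R%:E < r ->
  measurable_fun setT g -> (0 <= M)%R -> lorentz_norm r +oo (enorm \o g) <= M%:E -> (0 < t)%R ->
  heatE g t x <= (fine (hoelder_conjugate r) * alpha * M * t `^ (- (n%:R * rinv r / 2)))%:E.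
Proof.
move=> rn mg M0 gM t0.
exact: (heat_bound x n_ge1 rn t0 (ltW alpha0) M0 (alphaP rn t0) mg gM).
Qed.

(** Below the threshold the restarted solution outlives the maximal time. *)
Lemma extension (Tm t0 M : R) (r : \bar R) u : mild_solution p q r0 f Tm%:E u ->
  n%:R%:E < r -> (0 < t0 < Tm)%R -> (0 <= M)%R ->
  lorentz_norm r +oo (enorm \o u t0) <= M%:E ->
  (4 * eta_const n alpha gamma r * M * (Tm - t0) `^ ((1 - n%:R * rinv r) / 2) < 1)%R ->
  exists (T1 : R) w, (Tm < T1)%R /\ mild_solution p q r0 f T1%:E w.
Proof.
move=> hu rn /andP[t00 t0T] M0 uM small.
have a1 := exponent rn; set a := (n%:R * rinv r)%R in a1 small *.
have /andP[a_0 a_1] := a1.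
have [_ [_ rinv1]] := rinv_bounds n_ge1 rn.
have hc0 : (0 <= fine (hoelder_conjugate r))%R.
  by rewrite (hoelder_conjugateE n_ge1 rn)/= invr_ge0 subr_ge0 ltW.
have X0 : (0 <= 4 * eta_const n alpha gamma r * M)%R.
  by rewrite !mulr_ge0 ?beta_const_ge0// ltW.
have d0 : (0 < Tm - t0)%R by rewrite subr_gt0.
have e0 : (0 < (1 - a) / 2)%R by rewrite divr_gt0// subr_gt0.
have [tau [dtau htau]] := exists_longer_time X0 d0 e0 small.
have tau0 := lt_trans d0 dtau.
(* tau1 lies strictly between t0 and the maximal time, so that u is controlled
   on a neighbourhood of t0 *)
pose tau1 := ((t0 + Tm) / 2)%R.
have t01 : (t0 < tau1)%R by rewrite /tau1; lra.
have t1T : (tau1 < Tm)%R by rewrite /tau1; lra.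
have tau10 := lt_trans t00 t01.
have [m_u [K [K0 uK ue]]] := solution_mild gamma0 gammaP a01 hu tau10 t1T.
set U := trunc tau1 u in m_u uK ue.
have t0in : (0 < t0 < tau1)%R by rewrite t00.
have Ut0 : U t0 = u t0 by apply/funext => y; rewrite /U truncE.
have mU0 := mfield_slice t0 m_u.
pose A := (fine (hoelder_conjugate r) * alpha * M)%R.
have A0 : (0 <= A)%R by rewrite !mulr_ge0// ltW.
have UA t x : (0 < t < tau)%R -> heatE (U t0) t x <= (A * t `^ (- (a / 2)))%:E.
  have UM : lorentz_norm r +oo (enorm \o U t0) <= M%:E by rewrite Ut0.
  by move=> /andP[t_0 _]; exact: (heatE_data x rn mU0 M0 UM t_0).
have th1 : (4 * A * kap gamma a tau < 1)%R.
  apply: le_lt_trans htau; rewrite le_eqVlt; apply/orP; left; apply/eqP.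
  by rewrite /A /kap /eta_const -/a; ring.
have [v [mv vA ve vN]] := picard gamma0 gammaP a1 tau0 mU0 A0 UA th1.
pose w := concat t0 U v; have mw : mfield w by exact: mfield_concat.
have wU s : (s <= t0)%R -> w s = U s by move=> st; apply/funext => y; rewrite /w /concat st.
have wV s : (t0 < s)%R -> w s = v (s - t0)%R.
  by move=> st; apply/funext => y; rewrite /w /concat leNgt st.
exists (t0 + tau)%R, w; split; first by lra.
(* the sup norm at the restart is finite, hence it stays finite *)
have supU0 : supN (fun x => (enorm (U t0 x))%:E) <= (K * t0 `^ (- (a0 / 2)))%:E.
  by apply: supN_le => y; rewrite lee_fin uK.
have KU0 : (0 <= K * t0 `^ (- (a0 / 2)))%R by rewrite mulr_ge0// powR_ge0.
have [W1 hW1] := vN _ _ (@good_norm_supN R n) KU0 supU0.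
have [hpq _ ueq] := hu.
have [C1 [C10 hC1]] := path_bound (hpq tau1 tau10 t1T).
have lorU s : (0 < s < tau1)%R -> lorentz_norm p q (enorm \o U s) <= C1%:E.
  move=> hs; have -> : enorm \o U s = enorm \o u s.
    by apply/funext => y; rewrite /= /U (truncE _ _ hs).
  have /andP[s0 st] := hs; have := hC1 s s0; rewrite lte_fin => /(_ st).
  by rewrite oppr0 mul0r powRr0 mul1e.
have me (g : 'rV[R]_n -> 'rV[R]_n) : measurable_fun setT g -> measurable_fun setT (enorm \o g).
  by move=> mg; exact: (measurableT_comp (@measurable_enorm R n) mg).
have [N [gN Nfin Nbound]] := @lorentz_good_norm R n p q p1 q1 pq.
have NU0 : N (fun x => (enorm (U t0 x))%:E) < +oo.
  have := Nfin _ (me _ mU0); rewrite enormE_norm; apply.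
    by apply: le_lt_trans (lorU t0 t0in) _; rewrite ltry.
  by apply: le_lt_trans supU0 _; rewrite ltry.
have [C2 [C20 hC2]] := lty_ub NU0.
have [W2 hW2] := vN _ _ gN C20 hC2.
have [C3 hC3] := Nbound W2.
have lorV s : (0 < s < tau)%R -> lorentz_norm p q (enorm \o v s) <= C3%:E.
  by move=> hs; apply: hC3; [exact: me (mfield_slice s mv)|rewrite enormE_norm hW2].
split.
- move=> T' T'0; rewrite lte_fin => T'T; split; first exact: measurable_funTS.
  apply: (@le_lt_trans _ _ (Num.max C1 C3)%:E); last by rewrite ltry.
  apply: ge_ereal_sup => _ [t [t_0 tT'] <-].
  have {tT'}tT : (t < t0 + tau)%R by move: tT'; rewrite lte_fin => /lt_trans; apply.
  rewrite oppr0 mul0r powRr0 mul1e; have [h|h] := leP t t0.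
    rewrite wU//; apply: le_trans (lorU t _) _; first by rewrite t_0 (le_lt_trans h).
    by rewrite lee_fin le_max lexx.
  rewrite wV//; apply: le_trans (lorV (t - t0)%R _) _; first by apply/andP; split; lra.
  by rewrite lee_fin le_max lexx orbT.
- move=> T' T'0; rewrite lte_fin => T'T; split; first exact: measurable_funTS.
  pose W := ((t0 + tau) `^ (a0 / 2) * Num.max W1 0%R)%R.
  apply: (@le_lt_trans _ _ (Num.max K W)%:E); last by rewrite ltry.
  apply: ge_ereal_sup => _ [t [t_0 tT'] <-].
  have {tT'}tT : (t < t0 + tau)%R by move: tT'; rewrite lte_fin => /lt_trans; apply.
  rewrite opprK.
  have sup_le c : (forall y, enorm (w t y) <= c)%R -> sup_norm (enorm \o w t) <= c%:E.
    by move=> wc; apply: ge_ereal_sup => _ [y _ <-]; rewrite /= ger0_norm ?enorm_ge0// lee_fin.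
  have [h|h] := leP t t0.
    have ht : (0 < t < tau1)%R by rewrite t_0 (le_lt_trans h).
    apply: (@le_trans _ _ ((t `^ (a0 / 2))%:E * (K * t `^ (- (a0 / 2)))%:E)).
      by rewrite lee_wpmul2l ?lee_fin ?powR_ge0// sup_le// => y; rewrite wU// uK.
    rewrite -EFinM lee_fin mulrCA powRN mulfV ?gt_eqF ?powR_gt0// mulr1.
    by rewrite le_max lexx.
  have ht : (0 < t - t0 < tau)%R by apply/andP; split; lra.
  apply: (@le_trans _ _ ((t `^ (a0 / 2))%:E * (Num.max W1 0%R)%:E)).
    rewrite lee_wpmul2l ?lee_fin ?powR_ge0// sup_le// => y; rewrite wV//.
    rewrite le_max -lee_fin; apply/orP; left; apply: le_trans (hW1 _ ht).
    exact: (supN_ge (fun x => (enorm (v (t - t0)%R x))%:E) y).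
  rewrite -EFinM lee_fin le_max; apply/orP; right; rewrite /W.
  rewrite ler_wpM2r ?le_max ?lexx ?orbT// ge0_ler_powR ?nnegrE ?(ltW t_0) ?(ltW tT)//.
  + by have /andP[h0 _] := a01; rewrite divr_ge0.
  + by rewrite addr_ge0 ?(ltW t00) ?(ltW tau0).
- move=> t x t_0; rewrite lte_fin => tT; have [h|h] := leP t t0.
    have ht : (0 < t < tau1)%R by rewrite t_0 (le_lt_trans h).
    have tT' : t%:E < Tm%:E by rewrite lte_fin (lt_trans (le_lt_trans h t01)).
    have EU : U t x = (S_op f t x - B_op u u t x)%R by rewrite /U (truncE _ _ ht) (ueq t x t_0 tT').
    rewrite (wU t h) EU; congr (_ - _)%R; apply: eq_B_op => s y /andP[s0 st].
    rewrite (wU s (le_trans (ltW st) h)) /U truncE// s0.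
    by case/andP: ht => _; apply: lt_trans.
  have ht : (0 < t - t0 < tau)%R by apply/andP; split; lra.
  have sg0 : (0 < t - t0)%R by case/andP: ht.
  have [Mf [Mf0 hMf]] := lty_ub f_r0.
  have H1 y := heatE_data y r0n mf Mf0 hMf t00.
  have H2 y := Et_tens_lty gamma0 gammaP a01 tau10 y m_u uK t0in.
  have H3 : Et (srcn (before (tens U U) t0)) (t0 + (t - t0)) x < +oo.
    have tau'0 : (0 < t0 + (t - t0) + 1)%R by lra.
    apply: (@le_lt_trans _ _ (kap gamma a0 (t0 + (t - t0) + 1) * (K * K) * (t0 + (t - t0)) `^ (- (a0 / 2)))%:E); last by rewrite ltry.
    apply: (Et_small gamma0 gammaP a01 tau'0) => //.
    - by apply: measurable_srcn; apply: msource_before; exact: msource_tens.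
    - exact: srcn_ge0.
    - by rewrite mulr_ge0.
    - by apply/andP; split; lra.
    - move=> s y /andP[s0 _]; rewrite /srcn lee_fin /before fnormZ normr_nat /=.
      case: (boolP (0 < s < t0)%R) => st; last by rewrite mul0r !mulr_ge0 ?powR_ge0.
      have hs : (0 < s < tau1)%R by case/andP: st => -> /lt_trans; apply.
      rewrite mul1r fnorm_tens (_ : - a0 = - (a0 / 2) + - (a0 / 2))%R; last by field.
      by rewrite powRDp// mulrACA ler_pM ?enorm_ge0 ?uK.
  have H4 : Et (srcn (tens v v)) (t - t0) x < +oo.
    by apply: le_lt_trans (Et_tens_lty gamma0 gammaP a1 tau0 x mv vA ht) _; rewrite ltry.
  have [E1 E2] := restart t00 sg0 mf m_u mv H1 H2 H3 H4 (fun y => ue t0 y t0in) (ve _ x ht).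
  have tE : (t0 + (t - t0) = t)%R by rewrite addrC subrK.
  rewrite tE in E1 E2; rewrite (B_opE mw mw E2); exact: E1.
Qed.

End theorem.

Theorem theorem2p5 (R : realType) (n : nat) (n_ge1 : (1 <= n)%N)
    (alpha gamma : R) (alpha_gt0 : (0 < alpha)%R) (gamma_gt0 : (0 < gamma)%R)
    (alphaP : forall (r : \bar R) (t : R), n%:R%:E < r -> (0 < t)%R ->
       lorentz_norm (hoelder_conjugate r) 1 (@heat_kernel R n t)
         <= (alpha * t `^ (- (n%:R * rinv r / 2)))%:E)
    (gammaP : forall t : R, (0 < t)%R ->
       \int[lebesgue_rV n]_x (@grad_oseen_norm R n t x)%:E
         <= (gamma * t `^ (- 2^-1))%:E)
    (p q r0 : \bar R) (p_gt1 : 1 < p) (q_ge1 : 1 <= q)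
    (pq : p = +oo -> q = +oo) (r0_gtn : n%:R%:E < r0)
    (f : 'rV[R]_n -> 'rV[R]_n)
    (f_pq : lorentz_space p q f) (f_r0 : lorentz_space r0 +oo f)
    (T : \bar R) (T_max : is_maximal_time p q r0 f T) :
  T < +oo ->
  exists u : R -> 'rV[R]_n -> 'rV[R]_n,
    [/\ mild_solution p q r0 f T u,
        forall v, mild_solution p q r0 f T v ->
          forall (t : R) (x : 'rV[R]_n), (0 < t)%R -> t%:E < T -> v t x = u t x &
        forall (r : \bar R) (t0 : R), n%:R%:E < r -> (0 < t0)%R -> t0%:E < T ->
          let bound : R :=
            ((4 * eta_const n alpha gamma r *
              (fine T - t0) `^ (2^-1 * (1 - n%:R * rinv r)))^-1)%R in
          bound%:E <= lorentz_norm r +oo (enorm \o u t0) /\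
          (forall q' : \bar R, 1 <= q' -> (r = +oo -> q' = +oo) ->
             bound%:E <= lorentz_norm r q' (enorm \o u t0))].
Proof.
have [mf f_r] := f_r0; have n1 := n_ge1.
have [T0 [u hu] Tmax] := T_max; case: T T0 hu T_max Tmax => [Tm| |] // T0 hu T_max Tmax _.
have Tm0 : (0 < Tm)%R by rewrite -lte_fin.
have a01 : (0 <= n%:R * rinv r0 < 1)%R.
  by have [h1 [h2 _]] := rinv_bounds n1 r0_gtn; rewrite h2 mulr_ge0.
exists u; split => // [v hv t x t0 tT|r t0 rn t00].
  exact: (solution_unique gamma_gt0 gammaP a01 x hu hv t0 tT).
rewrite lte_fin => t0T bound.
have r1 := one_lt_exponent n1 rn.
have e1 : (2^-1 * (1 - n%:R * rinv r) = (1 - n%:R * rinv r) / 2)%R by rewrite mulrC.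
have [m_u _] : measurable_fun setT (u t0) /\ True.
  split => //; pose tau := ((t0 + Tm) / 2)%R.
  have t0tau : (0 < t0 < tau)%R by rewrite t00 /tau; apply/andP; split; lra.
  have tauT : tau%:E < Tm%:E by rewrite lte_fin /tau; lra.
  have tau0 : (0 < tau)%R by case/andP: t0tau => h; apply: lt_trans.
  have [m_u _] := solution_mild gamma_gt0 gammaP a01 hu tau0 tauT.
  have -> : u t0 = trunc tau u t0 by apply/funext => y; rewrite truncE.
  exact: mfield_slice.
have me : measurable_fun setT (enorm \o u t0).
  exact: (measurableT_comp (@measurable_enorm R n) m_u).
have main : bound%:E <= lorentz_norm r +oo (enorm \o u t0).
  rewrite leNgt; apply/negP => small.
  have L0 : 0 <= lorentz_norm r +oo (enorm \o u t0) by apply: lorentz_norm_ge0; rewrite ?leey.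
  have LE : lorentz_norm r +oo (enorm \o u t0) = (fine (lorentz_norm r +oo (enorm \o u t0)))%:E.
    by rewrite fineK// ge0_fin_numE// (lt_trans small) ?ltry.
  move: LE small L0; set M := fine _ => LE; rewrite LE lte_fin lee_fin => small M0.
  have X0 : (0 < 4 * eta_const n alpha gamma r * (Tm - t0) `^ ((1 - n%:R * rinv r) / 2))%R.
    by rewrite -invr_gt0 -e1; exact: le_lt_trans M0 small.
  have h : (4 * eta_const n alpha gamma r * M * (Tm - t0) `^ ((1 - n%:R * rinv r) / 2) < 1)%R.
    rewrite mulrAC -ltr_pdivlMl// mulr1; apply: lt_le_trans small _.
    by rewrite /bound e1.
  have [T1 [w [TT1 hw]]] := extension n1 alpha_gt0 gamma_gt0 alphaP gammaP p_gt1 q_ge1 pq r0_gtn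
    mf f_r hu rn (introT andP (conj t00 t0T)) M0 (eq_ind _ (fun e => e <= M%:E) (lexx _) _ (esym LE)) h.
  have := Tmax T1%:E _ (ex_intro _ w hw); rewrite lte_fin lee_fin => /(_ (lt_trans Tm0 TT1)).
  by rewrite leNgt TT1.
split => // q' q'1 rq'; apply: le_trans main _.
exact: lorentz_weak_le.
Qed.
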